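(* Let $m,n\geq 2$ be integers and let $\mathbf{k}$ be an algebraically closed field of positive characteristic. Let $M^2_{m,n}\subset\mathbf{k}^{mn}$ be the zero locus of the ideal generated by the $(2\times 2)$-minors of a generic $m\times n$ matrix. Then the normalized Nash blowup of $M^2_{m,n}$ is non-singular.
   Context: A generic $m\times n$ matrix is a matrix whose entries are $mn$ independent variables (the coordinates on $\mathbf{k}^{mn}$). Nash blowup: for an equidimensional affine variety $X\subseteq\mathbb{A}^r_{\mathbf{k}}$ of dimension $d$, consider the Gauss map $\mathcal{G}\colon X\setminus\operatorname{Sing}(X)\to\operatorname{Grass}(d,r)$, $x\mapsto T_xX$. Let $X^*$ be the Zariski closure of the graph of $\mathcal{G}$ in $X\times\operatorname{Grass}(d,r)$. The projection $\nu\colon X^*\to X$ is the Nash blowup of $X$; the normalized Nash blowup of $X$ is the normalization of $X^*$ together with the composition of the normalization map and $\nu$. *)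

(* Defs.v *)
From HB Require Import structures.
From mathcomp Require Import all_boot all_order all_algebra.
From mathcomp Require Import boolp classical_sets.
From mathcomp Require Import mpoly.

Set Implicit Arguments.
Unset Strict Implicit.
Unset Printing Implicit Defensive.

Import GRing.Theory.

Local Open Scope classical_set_scope.
Local Open Scope ring_scope.

(** Varieties over an algebraically closed field are treated classically, as
    spaces with functions: a topological space of (closed) points together
    with a sheaf of k-valued functions, in which a regular function is
    invertible exactly where it does not vanish. *)

(* A function on an open set U is represented by a total function, of which
   only the values on U are relevant (see [regular_ext]). *)
Record fspace (k : fieldType) := FSpace {
  point :> Type;
  is_open : set point -> Prop;
  is_regular : set point -> (point -> k) -> Prop;
  open_setT : is_open setT;
  open_setI : forall U V, is_open U -> is_open V -> is_open (U `&` V);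
  open_local : forall U : set point,
    (forall x, U x -> exists V, [/\ is_open V, V x & V `<=` U]) -> is_open U;
  regular_open : forall U f, is_regular U f -> is_open U;
  regular_ext : forall U (f g : point -> k),
    (forall x, U x -> f x = g x) -> is_regular U f -> is_regular U g;
  regular_restrict : forall U V f,
    is_open V -> V `<=` U -> is_regular U f -> is_regular V f;
  regular_local : forall (U : set point) f,
    (forall x, U x -> exists V, [/\ V x, V `<=` U & is_regular V f]) ->
    is_regular U f;
  regular_cst : forall U c, is_open U -> is_regular U (fun=> c);
  regular_add : forall U (f g : point -> k), is_regular U f -> is_regular U g ->
    is_regular U (fun x => f x + g x);
  regular_mul : forall U (f g : point -> k), is_regular U f -> is_regular U g ->
    is_regular U (fun x => f x * g x);
  regular_inv : forall U (f : point -> k), is_regular U f ->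
    is_regular [set x | U x /\ f x != 0] (fun x => (f x)^-1)
}.

Section InitialSpace.
Variables (k : fieldType) (T : Type) (G : set T -> (T -> k) -> Prop).

Inductive basic : set T -> (T -> k) -> Prop :=
| basic_gen U f : G U f -> basic U f
| basic_cst c : basic setT (fun=> c)
| basic_add U V f g :
    basic U f -> basic V g -> basic (U `&` V) (fun x => f x + g x)
| basic_mul U V f g :
    basic U f -> basic V g -> basic (U `&` V) (fun x => f x * g x).

Definition initial_open (W : set T) : Prop := forall x, W x ->
  exists U h, [/\ basic U h, U x, h x != 0 &
    forall y, U y -> h y != 0 -> W y].

Definition initial_regular (W : set T) (f : T -> k) : Prop := forall x, W x ->
  exists U a h, [/\ basic U a, basic U h, U x, h x != 0 &
    forall y, U y -> h y != 0 -> W y /\ f y = a y / h y].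

Fact initial_openT : initial_open setT.
Proof.
move=> x _; exists setT, (fun=> 1); split=> //; first exact: basic_cst.
exact: oner_neq0.
Qed.

Fact initial_openI U V :
  initial_open U -> initial_open V -> initial_open (U `&` V).
Proof.
move=> oU oV x [Ux Vx].
have [U' [h [bh U'x hx hU]]] := oU x Ux.
have [V' [g [bg V'x gx gV]]] := oV x Vx.
exists (U' `&` V'), (fun y => h y * g y); split=> //.
- exact: basic_mul.
- by rewrite mulf_neq0.
- by move=> y [U'y V'y]; rewrite mulf_eq0 negb_or => /andP[hy gy]; split; auto.
Qed.

Fact initial_open_local (U : set T) :
  (forall x, U x -> exists V, [/\ initial_open V, V x & V `<=` U]) ->
  initial_open U.
Proof.
move=> H x /H[V [oV Vx VU]]; have [U' [h [bh U'x hx hV]]] := oV x Vx.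
by exists U', h; split=> // y U'y hy; apply/VU/hV.
Qed.

Fact initial_regular_open U f : initial_regular U f -> initial_open U.
Proof.
move=> rf x /rf[U' [a [h [ba bh U'x hx H]]]]; exists U', h; split=> // y U'y hy.
by have [] := H y U'y hy.
Qed.

Fact initial_regular_ext U (f g : T -> k) :
  (forall x, U x -> f x = g x) -> initial_regular U f -> initial_regular U g.
Proof.
move=> fg rf x /rf[U' [a [h [ba bh U'x hx H]]]]; exists U', a, h; split=> //.
by move=> y U'y hy; have [Uy <-] := H y U'y hy; rewrite fg.
Qed.

Fact initial_regular_restrict U V f : initial_open V -> V `<=` U ->
  initial_regular U f -> initial_regular V f.
Proof.
move=> oV VU rf x Vx.
have [U' [a [h [ba bh U'x hx H]]]] := rf x (VU x Vx).
have [V' [g [bg V'x gx gV]]] := oV x Vx.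
exists (U' `&` V'), (fun y => a y * g y), (fun y => h y * g y); split=> //.
- exact: basic_mul.
- exact: basic_mul.
- by rewrite mulf_neq0.
move=> y [U'y V'y]; rewrite mulf_eq0 negb_or => /andP[hy gy].
split; first exact: gV.
by have [_ ->] := H y U'y hy; rewrite -mulf_div divff // mulr1.
Qed.

Fact initial_regular_local (U : set T) f :
  (forall x, U x -> exists V, [/\ V x, V `<=` U & initial_regular V f]) ->
  initial_regular U f.
Proof.
move=> H x /H[V [Vx VU rf]]; have [U' [a [h [ba bh U'x hx fa]]]] := rf x Vx.
exists U', a, h; split=> // y U'y hy; have [Vy fy] := fa y U'y hy.
by split=> //; exact: VU.
Qed.

Fact initial_regular_cst U c : initial_open U -> initial_regular U (fun=> c).
Proof.
move=> oU x /oU[V [h [bh Vx hx hU]]].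
exists V, (fun y => c * h y), h; split=> //.
  by rewrite -[V]setTI; apply: basic_mul bh; apply: basic_cst.
by move=> y Vy hy; rewrite mulfK //; split=> //; exact: hU.
Qed.

Fact initial_regular_add U (f g : T -> k) : initial_regular U f ->
  initial_regular U g -> initial_regular U (fun x => f x + g x).
Proof.
move=> rf rg x Ux.
have [U' [a [h [ba bh U'x hx fa]]]] := rf x Ux.
have [V' [b [e [bb be V'x ex gb]]]] := rg x Ux.
exists (U' `&` V'), (fun y => a y * e y + b y * h y), (fun y => h y * e y).
split=> //.
- rewrite -[U' `&` V']setIid; apply: basic_add; first exact: basic_mul.
  by rewrite setIC; exact: basic_mul.
- exact: basic_mul.
- by rewrite mulf_neq0.
move=> y [U'y V'y]; rewrite mulf_eq0 negb_or => /andP[hy ey].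
have [Uy ->] := fa y U'y hy; have [_ ->] := gb y V'y ey.
by split=> //; rewrite addf_div.
Qed.

Fact initial_regular_mul U (f g : T -> k) : initial_regular U f ->
  initial_regular U g -> initial_regular U (fun x => f x * g x).
Proof.
move=> rf rg x Ux.
have [U' [a [h [ba bh U'x hx fa]]]] := rf x Ux.
have [V' [b [e [bb be V'x ex gb]]]] := rg x Ux.
exists (U' `&` V'), (fun y => a y * b y), (fun y => h y * e y); split=> //.
- exact: basic_mul.
- exact: basic_mul.
- by rewrite mulf_neq0.
move=> y [U'y V'y]; rewrite mulf_eq0 negb_or => /andP[hy ey].
have [Uy ->] := fa y U'y hy; have [_ ->] := gb y V'y ey.
by split=> //; rewrite mulf_div.
Qed.

Fact initial_regular_inv U (f : T -> k) : initial_regular U f ->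
  initial_regular [set x | U x /\ f x != 0] (fun x => (f x)^-1).
Proof.
move=> rf x [Ux fx].
have [U' [a [h [ba bh U'x hx fa]]]] := rf x Ux.
exists U', (fun y => h y * h y), (fun y => a y * h y); split=> //.
- by rewrite -[U']setIid; exact: basic_mul.
- by rewrite -[U']setIid; exact: basic_mul.
- rewrite mulf_neq0 //; apply: contraNneq fx => a0.
  by have [_ ->] := fa x U'x hx; rewrite a0 mul0r.
move=> y U'y; rewrite mulf_eq0 negb_or => /andP[ay hy].
have [Uy fy] := fa y U'y hy; split.
  by split=> //; rewrite fy mulf_neq0 ?invr_eq0.
by rewrite fy invf_div -mulf_div divff // mulr1.
Qed.

(* The coarsest structure for which every U with G U f is open and every such
   f is regular on U: regular functions are locally quotients of polynomial
   expressions in the functions f. *)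
Definition initial_space : fspace k :=
  FSpace initial_openT initial_openI initial_open_local initial_regular_open
    initial_regular_ext initial_regular_restrict initial_regular_local
    initial_regular_cst initial_regular_add initial_regular_mul
    initial_regular_inv.

End InitialSpace.

Section QuotientSpace.
Variables (k : fieldType) (S : fspace k) (T : Type) (q : S -> T).

Definition quotient_space : fspace k.
Proof.
refine (@FSpace k T (fun V => is_open (q @^-1` V))
  (fun V f => is_regular (q @^-1` V) (f \o q)) _ _ _ _ _ _ _ _ _ _ _).
- exact: open_setT.
- by move=> U V; exact: open_setI.
- move=> U H; apply: open_local => x /H[V [oV Vx VU]].
  by exists (q @^-1` V); split=> // y; exact: VU.
- by move=> U f; exact: regular_open.
- by move=> U f g fg; apply: regular_ext => x Ux; rewrite /= fg.
- by move=> U V f oV VU; apply: regular_restrict => // x; exact: VU.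
- move=> U f H; apply: regular_local => x /H[V [Vx VU rf]].
  by exists (q @^-1` V); split=> // y; exact: VU.
- by move=> U c oU; exact: regular_cst.
- by move=> U f g; exact: regular_add.
- by move=> U f g; exact: regular_mul.
- by move=> U f; exact: regular_inv.
Defined.

End QuotientSpace.

Definition affine_space (k : fieldType) (r : nat) : fspace k :=
  @initial_space k 'rV[k]_r (fun U f => U = setT /\ exists i, f = fun x => x 0 i).

Definition subspace (k : fieldType) (S : fspace k) (A : set S) : fspace k :=
  @initial_space k A (fun U f => exists V g, is_regular V g /\
    U = val @^-1` V /\ f = g \o val).

Definition product_space (k : fieldType) (S T : fspace k) : fspace k :=
  @initial_space k (S * T) (fun U f =>
    (exists V g, is_regular V g /\ U = fst @^-1` V /\ f = g \o fst) \/
    (exists V g, is_regular V g /\ U = snd @^-1` V /\ f = g \o snd)).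

(** ** Topology and dimension *)

Section Topology.
Variables (k : fieldType) (S : fspace k).
Implicit Types (A Z : set S) (x : S) (d : nat).

Definition is_closed A := is_open (~` A).

Definition zariski_closure A : set S := smallest is_closed A.

Definition is_dense A := zariski_closure A = setT.

Definition irreducible Z := (exists x, Z x) /\
  forall A B, is_closed A -> is_closed B -> Z `<=` A `|` B ->
    Z `<=` A \/ Z `<=` B.

Definition irreducible_chain d (C : nat -> set S) :=
  (forall i, (i <= d)%N -> is_closed (C i) /\ irreducible (C i)) /\
  (forall i, (i < d)%N -> C i `<` C i.+1).

Definition has_dim d :=
  (exists C, irreducible_chain d C) /\
  ~ (exists C, irreducible_chain d.+1 C).

(* Junk value 0 if the dimension is infinite. *)
Definition dimension : nat := xget 0%N [set d | has_dim d].

(* The dimension of S at x, that is, the Krull dimension of the local ring at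
   x, whose primes are the irreducible closed sets through x. *)
Definition has_dim_at x d :=
  (exists C, irreducible_chain d C /\ C 0%N x) /\
  ~ (exists C, irreducible_chain d.+1 C /\ C 0%N x).

End Topology.

(** ** Local rings *)

Section LocalRing.
Variables (k : fieldType) (S : fspace k).
Implicit Types (x : S) (f g h : S -> k) (d : nat).

(* Elements of the local ring at x are represented by functions regular near
   x, two of them being equal when they agree near x. *)
Definition near x (P : S -> Prop) :=
  exists U : set S, [/\ is_open U, U x & forall y, U y -> P y].

Definition germ x f := exists U : set S, U x /\ is_regular U f.

Definition in_max x f := germ x f /\ f x = 0.

Definition in_max2 x f := exists l (g h : 'I_l -> S -> k),
  (forall i, in_max x (g i) /\ in_max x (h i)) /\
  near x (fun y => f y = \sum_i g i y * h i y).

(* The classes of the t i form a basis of m/m^2 over k. *)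
Definition has_cotangent_dim x d := exists t : 'I_d -> S -> k,
  (forall i, in_max x (t i)) /\
  forall f, in_max x f ->
    exists! c : 'rV[k]_d, in_max2 x (fun y => f y - \sum_i c 0 i * t i y).

(* The local ring at x is regular. *)
Definition nonsingular_at x :=
  exists d, has_cotangent_dim x d /\ has_dim_at x d.

Definition nonsingular := forall x, nonsingular_at x.

(* The local ring at x is a domain which is integrally closed in its fraction
   field: every fraction f/g which is a root of a monic polynomial with
   coefficients a i belongs to it. *)
Definition normal_at x :=
  (forall f g, germ x f -> germ x g -> near x (fun y => f y * g y = 0) ->
     near x (fun y => f y = 0) \/ near x (fun y => g y = 0)) /\
  (forall f g, germ x f -> germ x g -> ~ near x (fun y => g y = 0) ->
     forall d (a : 'I_d -> S -> k), (forall i, germ x (a i)) ->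
     near x (fun y =>
       f y ^+ d + \sum_(i < d) a i y * f y ^+ i * g y ^+ (d - i) = 0) ->
     exists h, germ x h /\ near x (fun y => f y = h y * g y)).

Definition normal_space := forall x, normal_at x.

End LocalRing.

(** ** Varieties and normalization *)

Definition zero_locus (k : fieldType) r (P : set {mpoly k[r]}) :
    set (affine_space k r) :=
  [set x : 'rV[k]_r | forall p, P p -> p.@[fun i => x 0 i] = 0].

Section Morphisms.
Variable k : fieldType.
Implicit Types S T N Y : fspace k.

Definition regular_map S T (phi : S -> T) :=
  (forall V, is_open V -> is_open (phi @^-1` V)) /\
  (forall V f, is_regular V f -> is_regular (phi @^-1` V) (f \o phi)).

Definition isomorphic S T := exists (phi : S -> T) (psi : T -> S),
  [/\ cancel phi psi, cancel psi phi, regular_map phi & regular_map psi].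

Definition affine S :=
  exists r (P : set {mpoly k[r]}), isomorphic S (subspace (zero_locus P)).

Definition locally_affine S :=
  forall x : S, exists U, [/\ is_open U, U x & affine (subspace U)].

Definition finite_morphism N Y (nu : N -> Y) := regular_map nu /\
  forall y, exists V : set Y, [/\ is_open V, V y,
    affine (subspace V), affine (subspace (nu @^-1` V)) &
    exists l (b : 'I_l -> N -> k),
      (forall i, is_regular (nu @^-1` V) (b i)) /\
      forall f, is_regular (nu @^-1` V) f ->
        exists a : 'I_l -> Y -> k, (forall i, is_regular V (a i)) /\
          forall x, V (nu x) -> f x = \sum_i a i (nu x) * b i x].

(* nu restricts to an isomorphism nu @^-1` V -> V, with inverse psi, between
   dense open subsets of N and Y. *)
Definition birational_morphism N Y (nu : N -> Y) := regular_map nu /\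
  exists V : set Y, [/\ is_open V, is_dense V, is_dense (nu @^-1` V) &
    exists psi : subspace V -> N, [/\ regular_map psi,
      range psi = nu @^-1` V & forall y, nu (psi y) = val y]].

(* Separatedness and quasi-compactness of N are inherited from Y, because nu
   is finite. *)
Definition normalization N Y (nu : N -> Y) :=
  [/\ locally_affine N, normal_space N, finite_morphism nu &
      birational_morphism nu].

End Morphisms.

(** ** Grassmannians *)

Section Grassmannian.
Variables (k : fieldType) (d r : nat).

(* The rows of a d x r matrix are listed in a vector of k^(d r). *)
Definition full_rank : set (affine_space k (d * r)) :=
  [set x : 'rV[k]_(d * r) | row_free (vec_mx x : 'M[k]_(d, r))].

Definition row_space (M : 'M[k]_(d, r)) : {vspace 'rV[k]_r} :=
  limg (linfun (mulmxr M : 'rV[k]_d -> 'rV[k]_r)).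

Definition subspaces : set {vspace 'rV[k]_r} := [set W | \dim W = d].

Fact row_space_subproof (x : full_rank) :
  row_space (vec_mx (val x)) \in subspaces.
Proof.
have /= free := set_valP x; apply/mem_set; rewrite /subspaces /row_space /=.
rewrite limg_dim_eq; first by rewrite dimvf dim_matrix mul1r.
apply/eqP; rewrite -subv0 capfv; apply/subvP => u.
rewrite memv_ker lfunE /= memv0 => /eqP uM0; apply/eqP/(row_free_inj free).
by rewrite uM0 mul0mx.
Qed.

Definition grass_proj (x : subspace full_rank) : subspaces :=
  exist _ (row_space (vec_mx (val x))) (row_space_subproof x).

(* Grass(d, r) is the quotient of the variety of d x r matrices of rank d by
   the action of GL_d on the left. *)
Definition grassmannian : fspace k := quotient_space grass_proj.

End Grassmannian.

(** ** Nash blowups *)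

Section Nash.
Variables (k : fieldType) (r : nat) (X : set (affine_space k r)).

Definition is_tangent_space (x : 'rV[k]_r) (W : {vspace 'rV[k]_r}) :=
  forall v : 'rV[k]_r, v \in W <->
    forall p : {mpoly k[r]}, (forall y, X y -> p.@[fun i => y 0 i] = 0) ->
      \sum_i p^`M(i).@[fun j => x 0 j] * v 0 i = 0.

Definition nash_ambient : fspace k :=
  product_space (subspace X) (grassmannian k (dimension (subspace X)) r).

Definition gauss_graph : set nash_ambient :=
  [set xW | nonsingular_at (S := subspace X) xW.1 /\
            is_tangent_space (val xW.1) (val xW.2)].

Definition nash_blowup : fspace k := subspace (zariski_closure gauss_graph).

Definition nash_map (y : nash_blowup) : subspace X := (val y).1.

(* N, together with the composite nash_map \o nu, is the normalized Nash
   blowup of X. *)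
Definition normalized_nash_blowup (N : fspace k) (nu : N -> nash_blowup) :=
  normalization nu.

End Nash.

(** ** Determinantal varieties *)

Section Determinantal.
Variables (k : fieldType) (m n : nat).

Definition generic_matrix : 'M[{mpoly k[m * n]}]_(m, n) :=
  \matrix_(i, j) 'X_(mxvec_index i j).

Definition minors t : set {mpoly k[m * n]} :=
  [set p | exists (f : 'I_t -> 'I_m) (g : 'I_t -> 'I_n),
    [/\ {homo f : i j / (i < j)%N}, {homo g : i j / (i < j)%N} &
        p = \det (mxsub f g generic_matrix)]].

Definition is_ideal (I : set {mpoly k[m * n]}) :=
  [/\ I 0, forall p q, I p -> I q -> I (p + q) & forall a p, I p -> I (a * p)].

Definition determinantal_variety t : set (affine_space k (m * n)) :=
  zero_locus (smallest is_ideal (minors t)).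

End Determinantal.

(* Main.v *)
Require Import Defs.
From mathcomp Require Import all_boot all_order all_algebra.
From mathcomp Require Import boolp classical_sets.
From mathcomp Require Import perm mpoly.
From mathcomp Require Import ring zify.

(* A nonzero matrix of rank one is u (x) v, and the tangent space there is
   T(u,v) = u (x) k^n + k^m (x) v.  In every characteristic (u,v) |-> T(u,v) is a
   closed embedding of P^(m-1) x P^(n-1) into the Grassmannian: for a fixed
   complement, u and v are read off the entries of a basis of T(u,v) adapted to
   it.  So the Nash blowup is the line bundle {(x,[u],[v]) : x in k u (x) v}; it
   is closed because T(u,v) is characterized by the degeneracy of the linear
   conditions "u (x) k^n and k^m (x) v lie in W", and it is covered by affine
   spaces of dimension m + n - 1.  Hence it is nonsingular and normal, and every
   finite birational morphism to it is an isomorphism: functions upstairs are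
   integral over those downstairs, so they descend by normality. *)

Set Implicit Arguments.
Unset Strict Implicit.
Unset Printing Implicit Defensive.

Import Order.TTheory GRing.Theory.

Local Open Scope classical_set_scope.
Local Open Scope ring_scope.

(** * Spaces with functions *)

(** Over the origin, x says nothing about [u] and [v], so both must be recovered from W alone, and
    by regular functions: in positive characteristic a bijective regular map need not be an
    isomorphism. Entries of the adapted basis that are linear in u and v achieve this. They exist as
    soon as [K] and [K'] have a row, one place where both sizes being at least two matters. The
    Grassmannian is indexed by the [dimension] of X, defined through chains of irreducible closed
    sets, so this number must be computed before the blowup can be described. The upper bound rests
    on a count of monomials: d + 1 polynomials in d variables are algebraically dependent. The Gauss
    graph has no point over the origin, because the tangent space there consists of all matrices and
    is too large for the Grassmannian. *)

Section Basics.
Variables (k : fieldType) (S : fspace k).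
Implicit Types (U V A Z : set S) (f g : S -> k).

Lemma open_regular_neq0 U f :
  is_regular U f -> is_open [set x | U x /\ f x != 0].
Proof. by move=> rf; apply: regular_open (regular_inv rf). Qed.

Lemma regular_div U f g : is_regular U f -> is_regular U g ->
  (forall x, U x -> g x != 0) -> is_regular U (fun x => f x / g x).
Proof.
move=> rf rg g0; apply: regular_mul => //.
apply: (regular_restrict (regular_open rg) _ (regular_inv rg)) => x Ux.
by split=> //; exact: g0.
Qed.

Lemma regular_opp U f : is_regular U f -> is_regular U (fun x => - f x).
Proof.
move=> rf; apply: (regular_ext (f := fun x => -1 * f x)).
  by move=> x _; rewrite mulN1r.
by apply: regular_mul => //; apply: regular_cst (regular_open rf).
Qed.

Lemma regular_sub U f g : is_regular U f -> is_regular U g ->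
  is_regular U (fun x => f x - g x).
Proof. by move=> rf rg; apply/regular_add/regular_opp. Qed.

Lemma regular_sum U (I : Type) (s : seq I) (P : pred I) (F : I -> S -> k) :
  is_open U -> (forall i, is_regular U (F i)) ->
  is_regular U (fun x => \sum_(i <- s | P i) F i x).
Proof.
move=> oU rF; elim: s => [|i s IH].
  by apply: regular_ext (regular_cst 0 oU) => x _; rewrite big_nil.
apply: (regular_ext
  (f := fun x => (if P i then F i x else 0) + \sum_(j <- s | P j) F j x)).
  by move=> x _; rewrite big_cons; case: (P i); rewrite ?add0r.
by apply: regular_add => //; case: (P i); [exact: rF | exact: regular_cst].
Qed.

Lemma regular_prod U (I : Type) (s : seq I) (P : pred I) (F : I -> S -> k) :
  is_open U -> (forall i, is_regular U (F i)) ->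
  is_regular U (fun x => \prod_(i <- s | P i) F i x).
Proof.
move=> oU rF; elim: s => [|i s IH].
  by apply: regular_ext (regular_cst 1 oU) => x _; rewrite big_nil.
apply: (regular_ext
  (f := fun x => (if P i then F i x else 1) * \prod_(j <- s | P j) F j x)).
  by move=> x _; rewrite big_cons; case: (P i); rewrite ?mul1r.
by apply: regular_mul => //; case: (P i); [exact: rF | exact: regular_cst].
Qed.

Lemma regular_exp U f n : is_regular U f -> is_regular U (fun x => f x ^+ n).
Proof.
move=> rf; elim: n => [|n IH].
  by apply: regular_ext (regular_cst 1 (regular_open rf)) => x _; rewrite expr0.
apply: (regular_ext (f := fun x => f x * f x ^+ n)) => [x _|].
  by rewrite exprS.
exact: regular_mul.
Qed.

Lemma regular_meval U n (p : {mpoly k[n]}) (F : 'I_n -> S -> k) :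
  is_open U -> (forall i, is_regular U (F i)) ->
  is_regular U (fun x => p.@[fun i => F i x]).
Proof.
move=> oU rF; apply: (regular_ext (f := fun x =>
    \sum_(m <- msupp p) p@_m * \prod_i F i x ^+ m i)) => [x _|].
  by rewrite mevalE.
apply: regular_sum => // m; apply: regular_mul; first exact: regular_cst.
by apply: regular_prod => // i; exact: regular_exp.
Qed.

Lemma regular_det U n (M : S -> 'M[k]_n) : is_open U ->
  (forall i j, is_regular U (fun x => M x i j)) ->
  is_regular U (fun x => \det (M x)).
Proof.
move=> oU rM; apply: regular_sum => // s; apply: regular_mul.
  exact: regular_cst.
by apply: regular_prod => // i; exact: rM.
Qed.

Lemma regular_mulmx U m n p (M : S -> 'M[k]_(m, n)) (N : S -> 'M[k]_(n, p)) :
  is_open U -> (forall i j, is_regular U (fun x => M x i j)) ->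
  (forall i j, is_regular U (fun x => N x i j)) ->
  forall i j, is_regular U (fun x => (M x *m N x) i j).
Proof.
move=> oU rM rN i j.
apply: (regular_ext (f := fun x => \sum_l M x i l * N x l j)) => [x _|].
  by rewrite mxE.
by apply: regular_sum => // l; exact: regular_mul.
Qed.

Lemma regular_invmx U n (M : S -> 'M[k]_n) : is_open U ->
  (forall i j, is_regular U (fun x => M x i j)) ->
  (forall x, U x -> M x \in unitmx) ->
  forall i j, is_regular U (fun x => invmx (M x) i j).
Proof.
move=> oU rM uM i j; apply: (regular_ext (f := fun x =>
    (-1) ^+ (j + i) * \det (row' j (col' i (M x))) / \det (M x))).
  by move=> x Ux; rewrite /invmx uM // !mxE mulrC.
apply: regular_div.
- apply: regular_mul; first exact: regular_cst.
  apply: regular_det => // i' j'.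
  by apply: (regular_ext _ (rM (lift j i') (lift i j'))) => x _; rewrite !mxE.
- exact: regular_det.
- by move=> x Ux; rewrite -unitfE; have := uM x Ux; rewrite unitmxE.
Qed.

Lemma closed_setI A B : is_closed A -> is_closed B -> is_closed (A `&` B).
Proof.
move=> cA cB; rewrite /is_closed setCI; apply: open_local => x [Ax|Bx].
  by exists (~` A); split=> // y; left.
by exists (~` B); split=> // y; right.
Qed.

Lemma closed_zero f : is_regular setT f -> is_closed [set x | f x = 0].
Proof.
move=> rf; rewrite /is_closed; suff -> : ~` [set x | f x = 0] = [set x | setT x /\ f x != 0].
  exact: open_regular_neq0.
by apply/seteqP; split=> x /=; [move/eqP|case=> _ /eqP].
Qed.

Lemma closureP A x :
  zariski_closure A x <-> forall U, is_open U -> U x -> exists2 y, U y & A y.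
Proof.
split=> [cAx U oU Ux | H B [cB AB]].
  apply: contrapT => nUA; apply: (cAx (~` U)) => //; split.
    by rewrite /is_closed setCK.
  by move=> y Ay Uy; apply: nUA; exists y.
apply: contrapT => nBx; have [y nBy Ay] := H _ cB nBx.
exact/nBy/AB.
Qed.

Lemma closed_closure A : is_closed (zariski_closure A).
Proof.
apply: open_local => x ncx.
have [U [oU Ux nUA]] : exists U, [/\ is_open U, U x & ~ exists2 y, U y & A y].
  apply: contrapT => nU; apply: ncx; apply/closureP => U oU Ux.
  by apply: contrapT => H; apply: nU; exists U.
by exists U; split=> // y Uy /closureP/(_ U oU Uy).
Qed.

Lemma sub_closure A : A `<=` zariski_closure A.
Proof. by move=> x Ax B [_]; exact. Qed.

Lemma closure_min A B : is_closed B -> A `<=` B -> zariski_closure A `<=` B.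
Proof. by move=> cB AB x; apply. Qed.

Lemma is_denseP A :
  is_dense A <-> forall U, is_open U -> U !=set0 -> exists2 y, U y & A y.
Proof.
split=> [dA U oU [x Ux]|H].
  by have /closureP : zariski_closure A x; [rewrite dA | apply].
apply/seteqP; split=> // x _; apply/closureP => U oU Ux.
by apply: H => //; exists x.
Qed.

Lemma irreducible_meet Z U V : irreducible Z -> is_open U -> is_open V ->
  (exists2 x, Z x & U x) -> (exists2 x, Z x & V x) ->
  exists x, [/\ Z x, U x & V x].
Proof.
move=> [_ iZ] oU oV [x Zx Ux] [y Zy Vy]; apply: contrapT => nUV.
have [||z Zz|ZU|ZV] := iZ (~` U) (~` V).
- by rewrite /is_closed setCK.
- by rewrite /is_closed setCK.
- have [Uz|nUz] := pselect (U z); last by left.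
  by right=> Vz; apply: nUV; exists z.
- by have := ZU _ Zx.
- by have := ZV _ Zy.
Qed.

Lemma irreducible_closure Z : irreducible Z -> irreducible (zariski_closure Z).
Proof.
move=> [[x Zx] iZ]; split; first by exists x; exact: sub_closure.
move=> A B cA cB sAB; have [|ZA|ZB] := iZ A B cA cB.
- by move=> y Zy; apply: sAB; exact: sub_closure.
- by left; exact: closure_min.
- by right; exact: closure_min.
Qed.

End Basics.

(** * Regular maps and the universal property of initial structures *)

Section RegularMaps.
Variable k : fieldType.
Implicit Types (S T R : fspace k).

(** Inverses of charts are total functions with junk values off an open set; this is regularity of
    such a map on the part that matters. *)
Definition regular_on S T (V : set S) (phi : S -> T) :=
  (forall U, is_open U -> is_open (V `&` phi @^-1` U)) /\
  (forall U f, is_regular U f -> is_regular (V `&` phi @^-1` U) (f \o phi)).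

Lemma regular_onT S T (phi : S -> T) : regular_on setT phi <-> regular_map phi.
Proof.
by split=> -[H1 H2]; split=> [U oU|U f rf];
  have := H1 U; have := H2 U; rewrite setTI; auto.
Qed.

Lemma regular_map_comp S T R (phi : S -> T) (psi : T -> R) :
  regular_map phi -> regular_map psi -> regular_map (psi \o phi).
Proof.
move=> [p1 p2] [q1 q2]; split=> [U oU|U f rf]; first exact: p1 (q1 _ oU).
exact: p2 (q2 _ _ rf).
Qed.

(** Universal property of the initial structure: regularity passes from the generators to sums and
    products, then to local quotients. *)
Lemma regular_on_initial S (T : Type) G V (phi : S -> T) : is_open V ->
  (forall U f, G U f -> is_regular (V `&` phi @^-1` U) (f \o phi)) ->
  @regular_on S (@initial_space k T G) V phi.
Proof.
move=> oV HG.
have Hb U f : basic G U f -> is_regular (V `&` phi @^-1` U) (f \o phi).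
  elim=> [U0 f0|c|U1 V1 f1 g1 _ r1 _ r2|U1 V1 f1 g1 _ r1 _ r2].
  - exact: HG.
  - by rewrite setIT; exact: regular_cst.
  - have o12 := open_setI (regular_open r1) (regular_open r2).
    have e12 : V `&` phi @^-1` (U1 `&` V1) =
        (V `&` phi @^-1` U1) `&` (V `&` phi @^-1` V1).
      by rewrite preimage_setI setIACA setIid.
    rewrite e12; apply: regular_add.
      by apply: (regular_restrict _ _ r1) => // x [].
    by apply: (regular_restrict _ _ r2) => // x [].
  - have o12 := open_setI (regular_open r1) (regular_open r2).
    have e12 : V `&` phi @^-1` (U1 `&` V1) =
        (V `&` phi @^-1` U1) `&` (V `&` phi @^-1` V1).
      by rewrite preimage_setI setIACA setIid.
    rewrite e12; apply: regular_mul.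
      by apply: (regular_restrict _ _ r1) => // x [].
    by apply: (regular_restrict _ _ r2) => // x [].
split=> [U oU|U f rf].
  apply: open_local => x [Vx Ux]; have [U' [h [bh U'x hx H]]] := oU _ Ux.
  exists [set y | (V `&` phi @^-1` U') y /\ (h \o phi) y != 0]; split.
  - exact/open_regular_neq0/Hb.
  - by [].
  - by move=> y [[Vy U'y] hy]; split=> //; exact: H.
apply: regular_local => x [Vx Ux].
have [U' [a [h [ba bh U'x hx H]]]] := rf _ Ux.
have oh := open_regular_neq0 (Hb _ _ bh).
exists [set y | (V `&` phi @^-1` U') y /\ (h \o phi) y != 0]; split=> //.
  by move=> y [[Vy U'y] hy]; split=> //; have [] := H _ U'y hy.
apply: (regular_ext (f := fun y => (a \o phi) y / (h \o phi) y)).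
  by move=> y [[Vy U'y] hy] /=; have [_ ->] := H _ U'y hy.
apply: regular_div.
- by apply: (regular_restrict oh _ (Hb _ _ ba)) => y [].
- by apply: (regular_restrict oh _ (Hb _ _ bh)) => y [].
- by move=> y [].
Qed.

Lemma regular_map_initial S (T : Type) G (phi : S -> T) :
  (forall U f, G U f -> is_regular (phi @^-1` U) (f \o phi)) ->
  @regular_map k S (@initial_space k T G) phi.
Proof.
move=> HG; apply/regular_onT/regular_on_initial; first exact: open_setT.
by move=> U f Gf; rewrite setTI; exact: HG.
Qed.

Lemma basic_regular (T : Type) G U f : basic G U f ->
  @is_regular k (@initial_space k T G) U f.
Proof.
move=> bf x Ux.
(* Numerator and denominator must be basic on the same set, but constants are basic on [setT] only;
   hence 1 is written as [f y * 0 + 1], whose domain involves U. *)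
exists ((U `&` setT) `&` setT), (fun y => f y * 1 + 0),
  (fun y => f y * 0 + 1); split=> //.
- by do 2!constructor=> //; exact: basic_cst.
- by do 2!constructor=> //; exact: basic_cst.
- by rewrite mulr0 add0r oner_neq0.
- by move=> y [[Uy _] _] _; rewrite mulr0 add0r addr0 mulr1 divr1.
Qed.

Lemma gen_regular (T : Type) (G : set T -> (T -> k) -> Prop) U f : G U f ->
  @is_regular k (@initial_space k T G) U f.
Proof. by move=> Gf; apply/basic_regular/basic_gen. Qed.

End RegularMaps.

(** * Subspaces, products and maps to affine space *)

Section Constructions.
Variables (k : fieldType).
Implicit Types (S T R : fspace k).

Lemma regular_map_val S (A : set S) : regular_map (val : subspace A -> S).
Proof.
split=> [U oU|U f rf]; last by apply: gen_regular; exists U, f.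
by apply: (@regular_open _ (subspace A) _ ((fun _ : S => 1) \o val));
  apply: gen_regular; exists U, (fun=> 1); split=> //; exact: regular_cst.
Qed.

Lemma regular_map_subspace S T (A : set T) (phi : S -> A) :
  regular_map (val \o phi : S -> T) -> @regular_map k S (subspace A) phi.
Proof.
move=> [_ H]; apply: regular_map_initial => U f [V [g [rg [-> ->]]]].
exact: H.
Qed.

(** Restrictions of regular functions are already stable under constants, sums and products, so
    closing them under these operations adds nothing. *)
Lemma basic_subspace S (A : set S) (U : set A) f :
  basic (fun U f => exists V g, is_regular V g /\
    U = val @^-1` V /\ f = g \o val) U f ->
  exists V g, [/\ @is_regular k S V g, U = val @^-1` V & f = g \o val].
Proof.
elim=> [U0 f0 [V [g [rg [-> ->]]]]|c||].
- by exists V, g.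
- by exists setT, (fun=> c); split=> //; apply/regular_cst/open_setT.
- move=> U1 V1 f1 g1 _ [V [g [rg -> ->]]] _ [W [h [rh -> ->]]].
  have oVW := open_setI (regular_open rg) (regular_open rh).
  exists (V `&` W), (fun x => g x + h x); split=> //; apply: regular_add.
    by apply: regular_restrict rg => // x [].
  by apply: regular_restrict rh => // x [].
- move=> U1 V1 f1 g1 _ [V [g [rg -> ->]]] _ [W [h [rh -> ->]]].
  have oVW := open_setI (regular_open rg) (regular_open rh).
  exists (V `&` W), (fun x => g x * h x); split=> //; apply: regular_mul.
    by apply: regular_restrict rg => // x [].
  by apply: regular_restrict rh => // x [].
Qed.

Lemma subspace_open S (A : set S) (W : set (subspace A)) : is_open W ->
  exists V, is_open V /\ W = val @^-1` V.
Proof.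
move=> oW.
exists [set x | exists V, [/\ is_open V, V x & val @^-1` V `<=` W]].
split.
  apply: open_local => x [V [oV Vx VW]]; exists V; split=> // y Vy.
  by exists V.
apply/seteqP; split=> [x Wx|x [V [_ Vx]]]; last exact.
have [U [h [/basic_subspace[V [g [rg -> ->]]] Vx gx H]]] := oW x Wx.
exists [set y | V y /\ g y != 0]; split=> //; first exact: open_regular_neq0.
by move=> y [Vy gy]; exact: H.
Qed.

Lemma regular_map_fst S T : regular_map (fst : product_space S T -> S).
Proof.
split=> [U oU|U f rf]; last by apply: gen_regular; left; exists U, f.
by apply: (@regular_open _ (product_space S T) _ ((fun _ : S => 1) \o fst));
  apply: gen_regular; left; exists U, (fun=> 1); split=> //; exact: regular_cst.
Qed.

Lemma regular_map_snd S T : regular_map (snd : product_space S T -> T).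
Proof.
split=> [U oU|U f rf]; last by apply: gen_regular; right; exists U, f.
by apply: (@regular_open _ (product_space S T) _ ((fun _ : T => 1) \o snd));
  apply: gen_regular; right; exists U, (fun=> 1); split=> //; exact: regular_cst.
Qed.

Lemma regular_map_pair R S T (phi : R -> S) (psi : R -> T) :
  regular_map phi -> regular_map psi ->
  @regular_map k R (product_space S T) (fun x => (phi x, psi x)).
Proof.
move=> [_ H1] [_ H2]; apply: regular_map_initial => U f.
by case=> -[V [g [rg [-> ->]]]]; [exact: H1 | exact: H2].
Qed.

Lemma regular_on_affine S r (V : set S) (phi : S -> 'rV[k]_r) : is_open V ->
  (forall i, is_regular V (fun x => phi x 0 i)) ->
  @regular_on k S (affine_space k r) V phi.
Proof.
move=> oV H; apply: regular_on_initial => // U f [-> [i ->]].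
by rewrite setIT; exact: H.
Qed.

Lemma regular_map_affine S r (phi : S -> 'rV[k]_r) :
  (forall i, is_regular setT (fun x => phi x 0 i)) ->
  @regular_map k S (affine_space k r) phi.
Proof.
by move=> H; apply/regular_onT/regular_on_affine => //; exact: open_setT.
Qed.

Lemma regular_coord r i :
  @is_regular k (affine_space k r) setT (fun x => x 0 i).
Proof. by apply: gen_regular; split=> //; exists i. Qed.

End Constructions.

(** * Open embeddings *)

Section OpenEmbeddings.
Variable k : fieldType.
Implicit Types (S T R : fspace k).

(* j identifies T with an open subset of S; outside of it r is junk. *)
Definition open_embedding S T (j : T -> S) (r : S -> T) :=
  [/\ regular_map j, cancel j r,
      forall U, is_open U -> is_open (j @` U) &
      forall U f, is_regular U f -> is_regular (j @` U) (f \o r)].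

Lemma open_embeddingI S T (j : T -> S) (r : S -> T) V :
  is_open V -> regular_map j -> cancel j r -> (forall x, V (j x)) ->
  (forall y, V y -> j (r y) = y) -> regular_on V r -> open_embedding j r.
Proof.
move=> oV rj jK jV rK [r1 r2].
have jE U : j @` U = V `&` r @^-1` U.
  apply/seteqP; split=> [_ [x Ux <-]|y [Vy Ury]].
    by split; rewrite /= ?jK.
  by exists (r y) => //; exact: rK.
by split=> // U; [move=> oU | move=> f rf]; rewrite jE; [exact: r1 | exact: r2].
Qed.

Lemma open_embedding_range S T (j : T -> S) r :
  open_embedding j r -> is_open (range j).
Proof. by case=> _ _ + _; apply; exact: open_setT. Qed.

Lemma open_embedding_comp S T R (j : T -> S) r (i : R -> T) s :
  open_embedding j r -> open_embedding i s -> open_embedding (j \o i) (s \o r).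
Proof.
move=> [rj jK oj fj] [ri iK oi fi]; split.
- exact: regular_map_comp.
- by move=> x /=; rewrite jK iK.
- by move=> U oU; rewrite -image_comp; exact/oj/oi.
- by move=> U f rf; rewrite -image_comp; exact: fj (fi _ _ rf).
Qed.

Lemma open_embedding_val S (U : set S) (x0 : subspace U) : is_open U ->
  exists r, @open_embedding S (subspace U) val r.
Proof.
move=> oU; pose r (y : S) : U :=
  if pselect (U y) is left Uy then exist _ y (mem_set Uy) else x0.
have rK y : U y -> val (r y) = y by rewrite /r; case: pselect.
exists r; apply: (@open_embeddingI _ _ _ _ U) => //.
- exact: regular_map_val.
- by move=> x; apply/val_inj/rK/set_valP.
- exact: set_valP.
- apply: regular_on_initial => // _ _ [V [g [rg [-> ->]]]].
  have -> : U `&` r @^-1` (val @^-1` V) = U `&` V.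
    by apply/seteqP; split=> y [Uy /=]; rewrite rK.
  apply: (regular_ext (f := g)) => [y [Uy _]|]; first by rewrite /= rK.
  by apply: (regular_restrict _ _ rg); [exact/open_setI/(regular_open rg) | move=> y []].
Qed.

Lemma open_embedding_isomorphic S T (j : T -> S) r :
  open_embedding j r -> isomorphic T (subspace (range j)).
Proof.
move=> [rj jK oj fj].
pose j' (x : T) : subspace (range j) := exist _ (j x) (mem_set (imageT j x)).
have rK y : range j y -> j (r y) = y by case=> x _ <-; rewrite jK.
exists j', (r \o val); split.
- by move=> x /=; rewrite jK.
- by move=> y; apply/val_inj/rK/set_valP.
- exact: (@regular_map_subspace _ _ _ _ j').
- have [v1 v2] := @regular_map_val k S (range j).
  have pE U : (r \o val) @^-1` U = val @^-1` (j @` U) :> set (subspace (range j)).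
    apply/seteqP; split=> [y Uy|y [x Ux] /= <-]; last by rewrite jK.
    by exists (r (val y)) => //; exact/rK/set_valP.
  by split=> U; [move=> oU | move=> f rf]; rewrite pE;
    [exact/v1/oj | exact: v2 (fj _ _ rf)].
Qed.

Lemma isomorphic_sym S T : isomorphic S T -> isomorphic T S.
Proof. by case=> f [g [? ? ? ?]]; exists g, f. Qed.

Lemma isomorphic_trans S T R : isomorphic S T -> isomorphic T R -> isomorphic S R.
Proof.
move=> [f [g [fK gK rf rg]]] [f' [g' [fK' gK' rf' rg']]].
exists (f' \o f), (g \o g'); split.
- exact: can_comp.
- exact: can_comp.
- exact: regular_map_comp.
- exact: regular_map_comp.
Qed.

Lemma near_sub S (x : S) (P Q : S -> Prop) :
  (forall y, P y -> Q y) -> near x P -> near x Q.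
Proof. by move=> PQ [U [oU Ux UP]]; exists U; split=> // y /UP/PQ. Qed.

Lemma nearI S (x : S) (P Q : S -> Prop) :
  near x P -> near x Q -> near x (fun y => P y /\ Q y).
Proof.
move=> [U [oU Ux UP]] [V [oV Vx VQ]]; exists (U `&` V); split=> //.
  exact: open_setI.
by move=> y [Uy Vy]; split; auto.
Qed.

Lemma in_max2_near S (x : S) f g :
  near x (fun y => f y = g y) -> in_max2 x f -> in_max2 x g.
Proof.
move=> nfg [l [a [b [ab nf]]]]; exists l, a, b; split=> //.
by apply: near_sub (nearI nfg nf) => y [<- ->].
Qed.

(** * Local rings and dimensions are invariant under open embeddings *)

Section Transfer.
Variables (S T : fspace k) (j : T -> S) (r : S -> T).
Hypothesis emb : open_embedding j r.

Let jK : cancel j r. Proof. by case: emb. Qed.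

Let rK y : range j y -> j (r y) = y. Proof. by case=> x _ <-; rewrite jK. Qed.

Lemma near_pull x P : near (j x) P -> near x (P \o j).
Proof.
move=> [U [oU Ux UP]]; exists (j @^-1` U); split=> //.
  by case: emb => -[+ _] _ _ _; apply.
by move=> y; exact: UP.
Qed.

Lemma near_push x P : near x P -> near (j x) (fun y => range j y /\ P (r y)).
Proof.
move=> [U [oU Ux UP]]; exists (j @` U); split.
- by case: emb => _ _ + _; apply.
- by exists x.
- by move=> _ [y Uy <-]; rewrite jK; split; [exists y | exact: UP].
Qed.

Lemma germ_pull x f : germ (j x) f -> germ x (f \o j).
Proof.
move=> [U [Ux rf]]; exists (j @^-1` U); split=> //.
by case: emb => -[_ +] _ _ _; apply.
Qed.

Lemma germ_push x f : germ x f -> germ (j x) (f \o r).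
Proof.
move=> [U [Ux rf]]; exists (j @` U); split; first by exists x.
by case: emb => _ _ _; apply.
Qed.

Lemma in_max_pull x f : in_max (j x) f -> in_max x (f \o j).
Proof. by case=> gf f0; split=> //; exact: germ_pull. Qed.

Lemma in_max_push x f : in_max x f -> in_max (j x) (f \o r).
Proof. by case=> gf f0; split; [exact: germ_push | rewrite /= jK]. Qed.

Lemma in_max2_pull x f : in_max2 (j x) f -> in_max2 x (f \o j).
Proof.
move=> [l [a [b [ab nf]]]]; exists l, (fun i => a i \o j), (fun i => b i \o j).
split; last exact: near_pull nf.
by move=> i; have [ai bi] := ab i; split; exact: in_max_pull.
Qed.

Lemma in_max2_push x f : in_max2 x f -> in_max2 (j x) (f \o r).
Proof.
move=> [l [a [b [ab nf]]]]; exists l, (fun i => a i \o r), (fun i => b i \o r).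
split; last by apply: near_sub (near_push nf) => y [].
by move=> i; have [ai bi] := ab i; split; exact: in_max_push.
Qed.

Lemma cotangent_dim_transfer x d :
  has_cotangent_dim x d <-> has_cotangent_dim (j x) d.
Proof.
split=> -[t [tm H]].
  exists (fun i => t i \o r); split=> [i|f fm]; first exact: in_max_push.
  have [c [c2 cu]] := H _ (in_max_pull fm).
  exists c; split.
    apply: in_max2_near (in_max2_push c2).
    apply: near_sub (@near_push x (fun=> True) _) => [y [jy _] /=|].
      by rewrite rK.
    by exists setT; split=> //; exact: open_setT.
  move=> c' c'2; apply: cu; apply: in_max2_near (in_max2_pull c'2).
  exists setT; split=> //; first exact: open_setT.
  by move=> y _ /=; rewrite jK.
exists (fun i => t i \o j); split=> [i|f fm]; first exact: in_max_pull.
have [c [c2 cu]] := H _ (in_max_push fm).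
exists c; split.
  apply: in_max2_near (in_max2_pull c2).
  exists setT; split=> //; first exact: open_setT.
  by move=> y _ /=; rewrite jK.
move=> c' c'2; apply: cu; apply: in_max2_near (in_max2_push c'2).
apply: near_sub (@near_push x (fun=> True) _) => [y [jy _] /=|].
  by rewrite rK.
by exists setT; split=> //; exact: open_setT.
Qed.

Lemma normal_at_transfer x : normal_at x -> normal_at (j x).
Proof.
move=> [dom int]; split=> [f g gf gg fg0|f g gf gg g0 d a ga rel].
  have [|||f0|g0] := dom (f \o j) (g \o j);
    try exact: germ_pull; first exact: near_pull fg0.
  - left; apply: near_sub (near_push f0) => y [jy] /=; by rewrite rK.
  - right; apply: near_sub (near_push g0) => y [jy] /=; by rewrite rK.
have [|||h [gh fh]] := int (f \o j) (g \o j) (germ_pull gf) (germ_pull gg) _ d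
  (fun i => a i \o j).
- move=> g0'; apply: g0; apply: near_sub (near_push g0') => y [jy] /=.
  by rewrite rK.
- by move=> i; exact: germ_pull.
- exact: near_pull rel.
exists (h \o r); split; first exact: germ_push.
by apply: near_sub (near_push fh) => y [jy] /=; rewrite rK.
Qed.

(** All members of the chain pass through [j x]. If two consecutive ones had the same trace on the
    range, the larger would be covered by the smaller and the complement of the range; being
    irreducible and meeting the range, it would equal the smaller. *)
Lemma chain_pull x d C : irreducible_chain d C -> C 0%N (j x) ->
  irreducible_chain d (fun i => j @^-1` C i).
Proof.
move=> [C1 C2] C0x.
have sub i : (i <= d)%N -> C i (j x).
  elim: i => [//|i IH] lid; have [sC _] := C2 _ lid.
  exact/sC/IH/(ltnW lid).
have oj : is_open (range j) := open_embedding_range emb.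
split=> i lid; [have [cC [_ iC]] := C1 _ lid; split | split].
- by case: emb => -[oj' _] _ _ _; exact: oj' cC.
- split; first by exists x; exact: sub.
  (* This set is the image of A together with the complement of the range: a closed set of S whose
     trace on the range is A. *)
  have cl A : is_closed A -> is_closed (~` (j @` ~` A)).
    by move=> cA; rewrite /is_closed setCK; case: emb => _ _ + _; apply.
  move=> A B cA cB CAB.
  have back A' : C i `<=` ~` (j @` ~` A') -> j @^-1` C i `<=` A'.
    by move=> H y /H nA; apply: contrapT => nAy; apply: nA; exists y.
  case: (iC _ _ (cl A cA) (cl B cB)); last 2 first.
  + by left; exact: back.
  + by right; exact: back.
  + move=> y Cy; have [[z _ zy]|njy] := pselect (range j y); last first.
      by left=> -[z _ zy]; apply: njy; exists z.
    have : (A `|` B) z by apply: CAB; rewrite /= zy.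
    case=> Az; [left|right] => -[z' Az' z'y]; apply: Az'.
      by rewrite -(jK z') z'y -zy jK.
    by rewrite -(jK z') z'y -zy jK.
- by move=> y; have [sC _] := C2 _ lid; exact: sC.
- move=> sC; have [cC [_ iC]] := C1 _ lid.
  have [cC' _] := C1 _ (ltnW lid).
  case: (iC (C i) (~` range j)) => //.
  + by rewrite /is_closed setCK.
  + move=> y Cy; have [[z _ zy]|] := pselect (range j y); last by right.
    by left; rewrite -zy; apply: sC; rewrite /= zy.
  + by have [] := C2 _ lid.
  + by move=> /(_ _ (sub _ lid)); apply; exists x.
Qed.

(** Since j is open, the closure of the image of a closed set meets the range in that image only
    ([closI]), so strict inclusions survive. *)
Lemma chain_push x d C : irreducible_chain d C -> C 0%N x ->
  irreducible_chain d (fun i => zariski_closure (j @` C i)).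
Proof.
move=> [C1 C2] C0x; case: emb => -[oj _] _ jo _.
have closI i : (i <= d)%N -> forall y, zariski_closure (j @` C i) (j y) -> C i y.
  move=> lid y; have [cC _] := C1 _ lid.
  have cl : is_closed (~` (j @` ~` C i)) by rewrite /is_closed setCK; exact: jo.
  move=> /(closure_min cl) H; apply: contrapT => nCy; apply: H; last by exists y.
  move=> _ [z Cz <-] [z' nCz' /(can_inj jK) zz']; by rewrite zz' in nCz'.
split=> i lid; [have [cC [ne iC]] := C1 _ lid; split | split].
- exact: closed_closure.
- apply: irreducible_closure; split.
    by case: ne => y Cy; exists (j y); exists y.
  move=> A B cA cB sAB.
  have cp A' : is_closed A' -> is_closed (j @^-1` A') by exact: oj.
  have [|CA|CB] := iC _ _ (cp A cA) (cp B cB).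
  + by move=> y Cy; apply: sAB; exists y.
  + by left=> _ [y Cy <-]; exact: CA.
  + by right=> _ [y Cy <-]; exact: CB.
- apply: closure_min; first exact: closed_closure.
  move=> _ [y Cy <-]; apply: sub_closure; exists y => //.
  by have [sC _] := C2 _ lid; exact: sC.
- move=> sC; have [_] := C2 _ lid; apply=> y Cy; apply: (closI _ (ltnW lid)).
  by apply: sC; apply: sub_closure; exists y.
Qed.

Lemma dim_at_transfer x d : has_dim_at x d <-> has_dim_at (j x) d.
Proof.
split=> -[[C [cC C0]] nC]; split.
- exists (fun i => zariski_closure (j @` C i)); split; first exact: chain_push C0.
  by apply: sub_closure; exists x.
- move=> [C' [cC' C'0]]; apply: nC; exists (fun i => j @^-1` C' i).
  by split=> //; exact: chain_pull C'0.
- exists (fun i => j @^-1` C i); split=> //; exact: chain_pull C0.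
- move=> [C' [cC' C'0]]; apply: nC.
  exists (fun i => zariski_closure (j @` C' i)); split; first exact: chain_push C'0.
  by apply: sub_closure; exists x.
Qed.

Lemma nonsingular_at_transfer x : nonsingular_at x <-> nonsingular_at (j x).
Proof.
by split=> -[d [cd dd]]; exists d; split;
  [apply/cotangent_dim_transfer | apply/dim_at_transfer
  |apply/cotangent_dim_transfer | apply/dim_at_transfer].
Qed.

End Transfer.

End OpenEmbeddings.

(** * Polynomials in several variables *)

Section Multivariate.

Lemma muni_eval (R : comNzRingType) n (p : {mpoly R[n.+1]}) (v : 'I_n.+1 -> R) :
  p.@[v] = (map_poly (meval (fun i => v (widen_ord (leqnSn n) i))) (muni p)).[v ord_max].
Proof.
rewrite muniE mevalE rmorph_sum /= horner_sum; apply: eq_bigr => m _.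
rewrite map_polyZ map_polyXn hornerZ hornerXn /= mevalZ mevalX.
rewrite big_ord_recr /= mulrA; congr (_ * _ * _).
by apply: eq_bigr => i _; rewrite mnmE.
Qed.

Lemma muni_eq0 (R : nzRingType) n (p : {mpoly R[n.+1]}) : muni p = 0 -> p = 0.
Proof.
move=> p0; apply/mpolyP => m; rewrite mcoeff0; apply: contrapT => pm.
pose t (m' : 'X_{1..n.+1}) :=
  [multinom m' (widen_ord (leqnSn n) i) | i < n].
have : ((muni p)`_(m ord_max))@_(t m) = 0 by rewrite p0 coef0 mcoeff0.
have mp : m \in msupp p by rewrite mcoeff_msupp; apply/eqP.
rewrite muniE coef_sum raddf_sum (bigD1_seq m) //= big1_seq ?addr0.
  by rewrite coefZ coefXn eqxx mulr1 mcoeffZ mcoeffX eqxx mulr1.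
move=> m' /andP[m'm _]; rewrite coefZ coefXn.
have [e|_] := eqVneq; last by rewrite mulr0 mcoeff0.
rewrite mulr1 mcoeffZ mcoeffX; case: eqVneq => [e'|_]; last by rewrite mulr0.
case/eqP: m'm; apply/mnmP => i; case: (unliftP ord_max i) => [j ->|-> //].
move/mnmP/(_ j): e'; rewrite !mnmE.
suff -> : widen_ord (leqnSn n) j = lift ord_max j by [].
by apply: val_inj; rewrite /= /bump leqNgt ltn_ord.
Qed.

(** Induction on the number of variables: the first coordinates avoid the zeros of the leading
    coefficient in the last variable, and the last coordinate avoids the finitely many roots that
    remain. *)
Lemma mpoly_nonroot (k : closedFieldType) n (p : {mpoly k[n]}) :
  p != 0 -> exists v, p.@[v] != 0.
Proof.
elim: n p => [|n IH] p p0.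
  exists (fun=> 0); rewrite (nvar0_mpolyC p) mevalC -(mpolyC_eq0 0).
  by rewrite -nvar0_mpolyC.
have mu0 : muni p != 0 by apply: contra_neq p0 => /muni_eq0.
have [v lv] := IH _ (etrans (congr1 negb (lead_coef_eq0 _)) mu0).
have q0 : map_poly (meval v) (muni p) != 0.
  apply: contra_neq lv => /(congr1 (fun q : {poly k} => q`_(size (muni p)).-1)).
  by rewrite coef_map coef0.
have [x qx] := closed_nonrootP _ q0.
exists (fun i => if unlift ord_max i is Some j then v j else x).
rewrite muni_eval unlift_none /=.
have -> : map_poly (meval (fun i => if unlift ord_max (widen_ord (leqnSn n) i)
    is Some j then v j else x)) (muni p) = map_poly (meval v) (muni p).
  apply: eq_map_poly => q; apply: meval_eq => i.
  suff -> : widen_ord (leqnSn n) i = lift ord_max i by rewrite liftK.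
  by apply: val_inj; rewrite /= /bump leqNgt ltn_ord.
exact: qx.
Qed.

(* If g^N divides c f^N for all N, comparing leading monomials shows that the
   leading term of g divides that of f, and the hypothesis is inherited by
   f minus the corresponding multiple of g. *)
Lemma mpoly_completely_integrally_closed (k : fieldType) n
    (c f g : {mpoly k[n]}) : c != 0 -> g != 0 ->
  (forall N, exists h, c * f ^+ N = h * g ^+ N) -> exists h, f = h * g.
Proof.
move=> c0 g0.
have H (m : 'X_{1..n}) : forall f, mlead f = m ->
    (forall N, exists h, c * f ^+ N = h * g ^+ N) -> exists h, f = h * g.
  elim/(well_founded_ind (@ltom_wf n)): m => m IH {}f fm Hf.
  have [->|f0] := eqVneq f 0; first by exists 0; rewrite mul0r.
  have le_gf : (mlead g <= m)%MM.
    apply/mnm_lepP => i; rewrite leqNgt; apply/negP => lt.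
    (* If the exponent of g at i exceeds that of f, comparing exponents in c f^N = h g^N gives N
       (m_i + 1) <= c_i + N m_i, that is N <= c_i; so N = c_i + 1 is a contradiction. *)
    have [h hE] := Hf (mlead c i).+1.
    have h0 : h != 0.
      apply: contra_neq (mulf_neq0 c0 (expf_neq0 (mlead c i).+1 f0)) => h0.
      by rewrite hE h0 mul0r.
    have := etrans (esym (mleadM c0 (expf_neq0 _ f0)))
      (etrans (congr1 (@mlead _ _) hE) (mleadM h0 (expf_neq0 _ g0))).
    rewrite (mleadX _ f0) (mleadX _ g0) fm => /mnmP/(_ i).
    rewrite !mnmDE !mulmnE => e.
    have : ((mlead c i).+1 * m i + (mlead c i).+1 <=
        mlead c i + m i * (mlead c i).+1)%N.
      rewrite e -mulnSr mulnC; apply: leq_trans (leq_addl _ _).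
      by rewrite leq_mul2r lt orbT.
    by rewrite [(_ * m i)%N]mulnC [leqRHS]addnC leq_add2l ltnn.
  pose q := (mleadc f / mleadc g) *: 'X_[m - mlead g] : {mpoly k[n]}.
  have [hh Hh] := choice Hf.
  have Hf' N : exists h, c * (f - q * g) ^+ N = h * g ^+ N.
    (* Binomial expansion: [hh (N - i)] accounts for g^(N - i), and the i-th power of q g brings the
       missing g^i. *)
    exists (\sum_(i < N.+1) (hh (N - i)%N * (- q) ^+ i) *+ 'C(N, i)).
    rewrite -mulNr exprDn mulr_sumr mulr_suml; apply: eq_bigr => i _.
    have eN : g ^+ N = g ^+ (N - i) * g ^+ i.
      by rewrite -exprD subnK // -ltnS.
    rewrite -mulrnAr mulrA Hh exprMn eN mulrnAr mulrnAl; congr (_ *+ _).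
    by rewrite -!mulrA; congr (_ * _); rewrite mulrCA.
  have [f'0|f'0] := eqVneq (f - q * g) 0.
    by exists q; apply/eqP; rewrite -subr_eq0 f'0.
  have [h fh] : exists h, f - q * g = h * g; last first.
    by exists (h + q); rewrite mulrDl -fh subrK.
  apply: (IH (mlead (f - q * g))) => //.
  have lg : mleadc g != 0 by rewrite mleadc_eq0.
  have lf : mleadc f != 0 by rewrite mleadc_eq0.
  have q0 : q != 0.
    by rewrite /q scaler_eq0 mulf_eq0 invr_eq0 (negPf lf) (negPf lg) -msupp_eq0
      msuppX.
  have lq : mlead q = (m - mlead g)%MM.
    by rewrite mleadZ ?mulf_neq0 ?invr_eq0 // mleadXm.
  have cqg : (q * g)@_m = mleadc f.
    rewrite -[X in _@_X](submK le_gf) -lq mleadcM lq mcoeffZ mcoeffX eqxx.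
    by rewrite mulr1 divfK.
  rewrite lt_neqAle; apply/andP; split; last first.
    apply: le_trans (mleadB_le _ _) _.
    by rewrite (mleadM q0 g0) fm lq submK // joinxx.
  apply: contra_neq f'0 => e; apply/eqP.
  by rewrite -mleadc_eq0 e mcoeffB cqg fm subrr.
by move=> Hf; exact: (H (mlead f)).
Qed.

(** The equation rewrites high powers of f/g in terms of lower ones, so g^d is a common denominator
    of all of them and complete integral closedness applies. *)
Lemma mpoly_integrally_closed (k : fieldType) n (f g : {mpoly k[n]}) d
    (a : 'I_d -> {mpoly k[n]}) : g != 0 ->
  f ^+ d + \sum_(i < d) a i * f ^+ i * g ^+ (d - i) = 0 ->
  exists h, f = h * g.
Proof.
move=> g0 /eqP; rewrite addr_eq0 => /eqP fd.
apply: (@mpoly_completely_integrally_closed _ _ (g ^+ d)) => //.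
  exact: expf_neq0.
elim/ltn_ind => N IH; have [ltNd|ledN] := ltnP N d.
  exists (g ^+ (d - N) * f ^+ N).
  by rewrite mulrAC -exprD subnK // ltnW.
have /choice[h hE] : forall i : 'I_d, exists h : {mpoly k[n]},
    g ^+ d * f ^+ (N - d + i) = h * g ^+ (N - d + i).
  move=> i; apply: IH.
  by rewrite -[ltnRHS](subnK ledN) ltn_add2l.
exists (- \sum_(i < d) a i * h i).
rewrite -[in LHS](subnK ledN) [f ^+ _]exprD fd !mulrN mulNr !mulr_sumr mulr_suml.
congr (- _); apply: eq_bigr => i _.
have -> : g ^+ N = g ^+ (N - d + i) * g ^+ (d - i).
  by rewrite -exprD -addnA subnKC ?subnK // ltnW.
transitivity (a i * (g ^+ d * f ^+ (N - d + i)) * g ^+ (d - i)).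
  by rewrite exprD; move: (f ^+ (N - d)) (f ^+ i) => u v; ring.
by rewrite hE !mulrA.
Qed.

Lemma mpoly_ring_ind (R : comNzRingType) n (P : {mpoly R[n]} -> Prop) :
  (forall c, P c%:MP) -> (forall i, P 'X_i) ->
  (forall p q, P p -> P q -> P (p + q)) ->
  (forall p q, P p -> P q -> P (p * q)) -> forall p, P p.
Proof.
move=> PC PX PD PM p; rewrite (mpolyE p).
apply: (big_ind P) => //; first by rewrite -mpolyC0.
move=> m _; rewrite -mul_mpolyC; apply: (PM _ _ (PC _)).
rewrite mpolyXE_id; elim/big_ind: _ => //; first by rewrite -mpolyC1.
move=> i _; elim: (m i) => [|e IH]; first by rewrite expr0 -mpolyC1.
by rewrite exprS; exact: PM.
Qed.

Lemma poly_factor_X (R : nzRingType) (p : {poly R}) : p != 0 ->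
  exists e q, p = q * 'X^e /\ q`_0 != 0.
Proof.
elim/poly_ind: p => [|p c IH]; first by rewrite eqxx.
have [->|c0] := eqVneq c 0; last first.
  move=> _; exists 0%N, (p * 'X + c%:P); split; first by rewrite expr0 mulr1.
  by rewrite coefD coefMX coefC add0r.
rewrite addr0 => pX0; have [|e [q [pq q0]]] := IH.
  by apply: contra_neq pX0 => ->; rewrite mul0r.
by exists e.+1, q; rewrite exprSr mulrA -pq.
Qed.

Lemma msize_prod_exp (R : idomainType) n s (F : 'I_s -> {mpoly R[n]}) D
    (e : 'I_s -> nat) : (forall i, msize (F i) <= D.+1)%N ->
  (msize (\prod_i F i ^+ e i)%R <= (\sum_i e i * D).+1)%N.
Proof.
move=> FD.
have M (p q : {mpoly R[n]}) a b : (msize p <= a.+1)%N -> (msize q <= b.+1)%N ->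
    (msize (p * q) <= (a + b).+1)%N.
  have [->|p0] := eqVneq p 0; first by rewrite mul0r msize0.
  have [->|q0] := eqVneq q 0; first by rewrite mulr0 msize0.
  by rewrite msizeM //; lia.
apply: (big_ind2 (fun (p : {mpoly R[n]}) a => msize p <= a.+1)%N) => //.
- by rewrite msize1.
- by move=> p a q b; exact: M.
move=> i _; elim: (e i) => [|c IH]; first by rewrite expr0 msize1.
by rewrite exprS mulSn; exact: M.
Qed.

(* The N^(d+1) products of powers < N of d+1 polynomials in d variables lie in
   a space of dimension O(N^d), hence are linearly dependent for N large. *)
Lemma mpoly_dependent (k : fieldType) d (F : 'I_d.+1 -> {mpoly k[d]}) :
  exists2 Q : {mpoly k[d.+1]}, Q != 0 & forall v, Q.@[fun i => (F i).@[v]] = 0.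
Proof.
pose D := (\max_i msize (F i))%N.
have FD i : (msize (F i) <= D.+1)%N by apply: leqW; exact: leq_bigmax.
(* A product has degree at most (d + 1) N D < N K = E, so each of its exponents is below E. There
   are E^d = N^d K^d such monomials, fewer than the N^(d + 1) products because N > K^d. *)
pose K := (d.+1 * D).+1; pose N := (K ^ d).+1; pose E := (N * K)%N.
pose I := {ffun 'I_d.+1 -> 'I_N}; pose J := {ffun 'I_d -> 'I_E}.
pose G (a : I) : {mpoly k[d]} := \prod_i F i ^+ a i.
pose mon s n (b : {ffun 'I_s -> 'I_n}) : 'X_{1..s} := [multinom val (b i) | i < s].
have mon_inj s n : injective (mon s n).
  move=> b b' /mnmP e; apply/ffunP => i; apply: val_inj.
  by have := e i; rewrite !mnmE.
pose A : 'M[k]_(#|I|, #|J|) := \matrix_(i, j) (G (enum_val i))@_(mon _ _ (enum_val j)).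
have [c c0 cA] : exists2 c : 'rV[k]_#|I|, c != 0 & c *m A = 0.
  have : (0 < \rank (kermx A))%N.
    rewrite mxrank_ker subn_gt0; apply: leq_ltn_trans (rank_leq_col A) _.
    rewrite !card_ffun !card_ord /E expnMn expnSr ltn_mul2l expn_gt0 /=.
    exact: leqnn.
  rewrite lt0n mxrank_eq0 => /rowV0Pn[c /sub_kermxP cA c0].
  by exists c.
have GE a (m : 'X_{1..d}) : m \in msupp (G a) -> exists b : J, m = mon _ _ b.
  move=> mG; have Em i : (m i < E)%N.
    have := leq_trans (msize_mdeg_lt mG) (msize_prod_exp (fun j => val (a j)) FD).
    rewrite ltnS => lem.
    have : (m i <= mdeg m)%N by rewrite mdegE (bigD1 i) //= leq_addr.
    move=> /leq_trans/(_ lem) mi; apply: (leq_ltn_trans mi).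
    apply: (@leq_ltn_trans (\sum_(i < d.+1) N * D)%N).
      by apply: leq_sum => j _; rewrite leq_mul2r (ltnW (ltn_ord _)) orbT.
    rewrite sum_nat_const card_ord /E /K mulnS mulnCA.
    by rewrite -[ltnLHS]add0n ltn_add2r.
  by exists [ffun i => Ordinal (Em i)]; apply/mnmP => i; rewrite mnmE ffunE.
have cG : \sum_i c 0 i *: G (enum_val i) = 0.
  apply/mpolyP => m; rewrite raddf_sum mcoeff0 /=.
  have [[b ->]|nb] := pselect (exists b : J, m = mon _ _ b).
    move/matrixP/(_ 0 (enum_rank b)): cA; rewrite !mxE => cAb.
    rewrite -[RHS]cAb; apply: eq_bigr => i _.
    by rewrite mcoeffZ !mxE enum_rankK.
  apply: big1 => i _; rewrite mcoeffZ memN_msupp_eq0 ?mulr0 //.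
  by apply/negP => /GE.
exists (\sum_i c 0 i *: 'X_[mon _ _ (enum_val i)]).
  have [i ci] : exists i, c 0 i != 0.
    by apply/rV0Pn.
  apply: contra_neq ci => /mpolyP/(_ (mon _ _ (enum_val i))).
  rewrite mcoeff0 raddf_sum /= (bigD1 i) //= mcoeffZ mcoeffX eqxx mulr1.
  rewrite big1 ?addr0 // => j ji; rewrite mcoeffZ mcoeffX.
  by rewrite (inj_eq (@mon_inj _ _)) (inj_eq enum_val_inj) (negPf ji) mulr0.
move=> v; transitivity (\sum_i c 0 i *: G (enum_val i)).@[v]; last first.
  by rewrite cG meval0.
rewrite !raddf_sum /=; apply: eq_bigr => i _; rewrite !mevalZ mevalX; congr (_ * _).
by rewrite rmorph_prod; apply: eq_bigr => j _; rewrite mnmE rmorphXn.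
Qed.

End Multivariate.

(** * Affine space *)

Section ChainIndependence.
Variables (k : fieldType) (S : fspace k) (Fc : (S -> k) -> Prop).
Hypothesis Fc_regular : forall f, Fc f -> is_regular setT f.
Hypothesis Fc_separates : forall A x, is_closed A -> ~ A x ->
  exists f, [/\ Fc f, forall y, A y -> f y = 0 & f x != 0].

(* If g vanishes on C i but not on C i.+1, and functions are algebraically
   independent on C i, they are so together with g on C i.+1: a relation can be
   divided by a power of g until its constant term in g is nonzero. *)
Lemma chain_independent d C : irreducible_chain d C ->
  exists g : 'I_d -> S -> k, (forall i, Fc (g i)) /\
    forall Q : {mpoly k[d]}, (forall x, C d x -> Q.@[fun i => g i x] = 0) -> Q = 0.
Proof.
elim: d => [|d IH] [C1 C2].
  exists (fun=> fun=> 0); split=> [[]//|Q HQ].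
  have [_ [[x Cx] _]] := C1 0%N isT.
  by have := HQ x Cx; rewrite (nvar0_mpolyC Q) mevalC => ->; rewrite mpolyC0.
have [|g [gF gi]] := IH.
  by split=> i id; [exact: C1 (leqW id) | exact: C2 (leqW id)].
have [CC /existsNP[x0 /not_implyP[Cx0 nCx0]]] := C2 d (leqnn _).
have [cC [[xd Cxd] iC]] := C1 d (leqnSn _).
have [cC' [_ iC']] := C1 d.+1 (leqnn _).
have [h [hF h0 hx0]] := Fc_separates cC nCx0.
pose G (i : 'I_d.+1) := if unlift ord_max i is Some j then g j else h.
have GF i : Fc (G i) by rewrite /G; case: (unlift _ _).
exists G; split=> // Q HQ; apply: contrapT => /eqP Q0.
have [e [P [QP P0]]] : exists e P, muni Q = P * 'X^e /\ P`_0 != 0.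
  by apply: poly_factor_X; apply: contra_neq Q0; exact: muni_eq0.
pose R x := (map_poly (meval (fun i => g i x)) P).[h x].
have QR x : Q.@[fun i => G i x] = R x * h x ^+ e.
  rewrite muni_eval /R {2}/G unlift_none.
  have -> : map_poly (meval (fun i => G (widen_ord (leqnSn d) i) x)) (muni Q) =
      map_poly (meval (fun i => g i x)) (muni Q).
    apply: eq_map_poly => q; apply: meval_eq => i.
    suff -> : widen_ord (leqnSn d) i = lift ord_max i by rewrite /G liftK.
    by apply: val_inj; rewrite /= /bump leqNgt ltn_ord.
  by rewrite QP rmorphM /= map_polyXn hornerM hornerXn.
have oT := @open_setT k S.
have rR : is_regular setT R.
  apply: (regular_ext (f := fun x =>
      \sum_(i < size P) (P`_i).@[fun i => g i x] * h x ^+ i)).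
    move=> x _; rewrite /R (@horner_coef_wide _ (size P)).
      by apply: eq_bigr => i _; rewrite coef_map.
    by rewrite size_poly.
  apply: regular_sum => // i; apply: regular_mul.
    by apply: regular_meval => // j; exact/Fc_regular/gF.
  exact/regular_exp/Fc_regular.
have [||y Cy|CR|Ch] := iC' [set x | R x = 0] [set x | h x = 0].
- exact: closed_zero.
- exact/closed_zero/Fc_regular.
- have /eqP := HQ y Cy; rewrite QR mulf_eq0 expf_eq0.
  by case/orP=> [|/andP[_]] /eqP; [left|right].
- have P00 : P`_0 = 0.
    apply: gi => x Cx; have := CR _ (CC _ Cx); rewrite /= /R h0 //.
    by rewrite horner_coef0 coef_map.
  by rewrite P00 eqxx in P0.
- by have /eqP := Ch _ Cx0; rewrite (negPf hx0).
Qed.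

End ChainIndependence.

(** * Density, lines and integral equations on affine space *)

Section Affine.
Variables (k : closedFieldType) (r : nat).
Local Notation A := (affine_space k r).
Implicit Types (U V : set A) (x y v : 'rV[k]_r) (p q : {mpoly k[r]}).

Definition ev p x : k := p.@[fun i => x 0 i].

Lemma ev_regular p : @is_regular k A setT (ev p).
Proof.
apply: (@regular_meval _ A _ _ p (fun i x => x 0 i)); first exact: open_setT.
exact: regular_coord.
Qed.

Lemma ev_nonroot p : p != 0 -> exists x, ev p x != 0.
Proof.
move=> /mpoly_nonroot[v pv]; exists (\row_i v i).
by rewrite /ev (meval_eq (v2 := v)) // => i; rewrite mxE.
Qed.

Lemma ev_eq0 p : (forall x, ev p x = 0) -> p = 0.
Proof.
by move=> H; apply/eqP/negPn/negP => /ev_nonroot[x]; rewrite H eqxx.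
Qed.

Lemma basic_affine U f :
  basic (fun (U : set A) f => U = setT /\ exists i, f = fun x => x 0 i) U f ->
  U = setT /\ exists p, f = ev p.
Proof.
elim=> [_ _ [-> [i ->]]|c|U1 V1 f1 g1 _ [-> [p ->]] _ [-> [q ->]]
  |U1 V1 f1 g1 _ [-> [p ->]] _ [-> [q ->]]]; split; rewrite ?setTI //.
- by exists 'X_i; apply/funext => x; rewrite /ev mevalXU.
- by exists c%:MP; apply/funext => x; rewrite /ev mevalC.
- by exists (p + q); apply/funext => x; rewrite /ev mevalD.
- by exists (p * q); apply/funext => x; rewrite /ev mevalM.
Qed.

Lemma affine_open U x : is_open U -> U x ->
  exists p, ev p x != 0 /\ forall y, ev p y != 0 -> U y.
Proof.
move=> oU Ux; have [V [h [/basic_affine[-> [p ->]] _ hx H]]] := oU x Ux.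
by exists p; split=> // y; exact: H.
Qed.

Lemma affine_regular U f x : is_regular U f -> U x -> exists a h,
  ev h x != 0 /\ forall y, ev h y != 0 -> U y /\ f y = ev a y / ev h y.
Proof.
move=> rf Ux.
have [V [a [h [/basic_affine[-> [p ->]] /basic_affine[_ [q ->]] _ hx H]]]] :=
  rf x Ux.
by exists p, q; split=> // y; exact: H.
Qed.

(** Restriction to lines reduces irreducibility, and later the independence of the coordinates
    modulo m^2, to polynomials in one variable. *)
Lemma ev_line p x v : exists q : {poly k}, forall s, ev p (x + s *: v) = q.[s].
Proof.
rewrite /ev; elim/mpoly_ring_ind: p => [c|i|p q [p' Hp] [q' Hq]|p q [p' Hp] [q' Hq]].
- by exists c%:P => s; rewrite mevalC hornerC.
- exists ((x 0 i)%:P + v 0 i *: 'X) => s.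
  by rewrite mevalXU !mxE hornerD hornerC hornerZ hornerX mulrC.
- by exists (p' + q') => s; rewrite mevalD Hp Hq hornerD.
- by exists (p' * q') => s; rewrite mevalM Hp Hq hornerM.
Qed.

Lemma open_line U x v : is_open U -> U x ->
  exists u : {poly k}, u.[0] != 0 /\ forall s, u.[s] != 0 -> U (x + s *: v).
Proof.
move=> oU Ux; have [p [px pU]] := affine_open oU Ux.
have [q Hq] := ev_line p x v; exists q; split=> [|s].
  by rewrite -Hq scale0r addr0.
by rewrite -Hq => /pU.
Qed.

(** On the line joining a point outside B to a point outside C, both complements are nonempty and
    contain all but finitely many points, so they meet. *)
Lemma irreducible_convex (Z : set A) : Z !=set0 ->
  (forall x y s, Z x -> Z y -> Z (x + s *: (y - x))) -> irreducible Z.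
Proof.
move=> Z0 cvx; split=> // B C cB cC ZBC.
have [ZB|/existsNP[x /not_implyP[Zx nBx]]] := pselect (Z `<=` B); first by left.
have [ZC|/existsNP[y /not_implyP[Zy nCy]]] := pselect (Z `<=` C); first by right.
have [u [u0 uB]] := open_line (y - x) cB nBx.
have [w [w0 wC]] := open_line (x - y) cC nCy.
(* [w] is taken along the same line started at y, where the parameter is 1 - s. *)
have [s] : exists s, (u * (w \Po (1 - 'X))).[s] != 0.
  apply/closed_nonrootP; rewrite mulf_neq0 //.
    by apply: contra_neq u0 => ->; rewrite horner0.
  apply: contra_neq w0 => /(congr1 (fun q : {poly k} => q.[1])).
  by rewrite horner_comp !hornerE subrr.
rewrite hornerM mulf_eq0 negb_or => /andP[/uB nB].
rewrite horner_comp !hornerE => /wC nC.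
case: (ZBC _ (cvx x y s Zx Zy)) => // Cs; case: nC.
suff -> : y + (1 - s) *: (x - y) = x + s *: (y - x) by [].
by rewrite scalerBl scale1r -scalerN opprB [LHS]addrA; congr (_ + _); rewrite addrC subrK.
Qed.

Lemma affine_irreducible : irreducible (setT : set A).
Proof. by apply: irreducible_convex => //; exists (0 : 'rV_r). Qed.

Lemma affine_meet U V : is_open U -> is_open V -> U !=set0 -> V !=set0 ->
  exists x, U x /\ V x.
Proof.
move=> oU oV [x Ux] [y Vy].
by have [||z []] := irreducible_meet affine_irreducible oU oV;
  [exists x | exists y | exists z].
Qed.

Lemma affine_identity U V f : is_regular U f -> is_open V -> V !=set0 ->
  (forall x, V x -> U x -> f x = 0) -> forall x, U x -> f x = 0.
Proof.
move=> rf oV V0 fV x Ux; apply/eqP/negPn/negP => fx.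
have [|y [Vy [Uy]]] := affine_meet oV (open_regular_neq0 rf) V0.
  by exists x.
by rewrite fV // eqxx.
Qed.

(* Clearing denominators, f = F/H satisfies a monic equation over the ring of
   polynomials after multiplication by a polynomial E invertible at x. *)
Lemma affine_integral U V x f d (a : 'I_d -> A -> k) :
  U !=set0 -> V x -> is_regular U f -> is_open V ->
  (forall i, is_regular V (a i)) ->
  (forall y, U y -> V y -> f y ^+ d + \sum_(i < d) a i y * f y ^+ i = 0) ->
  exists (W : set A) e, [/\ W x, is_regular W e & forall y, W y -> U y -> f y = e y].
Proof.
move=> [z Uz] Vx rf oV ra rel.
have [F [H [Hz FH]]] := affine_regular rf Uz.
have /choice[AE AEP] : forall i, exists ae : {mpoly k[r]} * {mpoly k[r]},
    ev ae.2 x != 0 /\ forall y, ev ae.2 y != 0 -> V y /\ a i y = ev ae.1 y / ev ae.2 y.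
  by move=> i; have [b [h Hb]] := affine_regular (ra i) Vx; exists (b, h).
have [v [vx vV]] := affine_open oV Vx.
have evM p q y : ev (p * q) y = ev p y * ev q y by rewrite /ev mevalM.
have ev_prod (P : pred 'I_d) (G : 'I_d -> {mpoly k[r]}) y :
  ev (\prod_(i | P i) G i) y = \prod_(i | P i) ev (G i) y by rewrite /ev rmorph_prod.
have [E [B [Ex EB]]] : exists (E : {mpoly k[r]}) (B : 'I_d -> {mpoly k[r]}),
    ev E x != 0 /\
    forall y, ev E y != 0 -> V y /\ forall i, a i y = ev (B i) y / ev E y.
  pose E := v * \prod_i (AE i).2.
  pose B i := (AE i).1 * (v * \prod_(j | j != i) (AE j).2).
  have Ex : ev E x != 0.
    rewrite evM mulf_neq0 // ev_prod; apply/prodf_neq0 => i _.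
    by have [] := AEP i.
  exists E, B; split=> // y.
  move=> Ey; have /andP[vy /prodf_neq0 ny] : (ev v y != 0) && (\prod_i ev (AE i).2 y != 0).
    by rewrite -negb_or -mulf_eq0 -ev_prod -evM.
  split=> [|i]; first exact: vV.
  have [_ /(_ y (ny i isT))[_ ->]] := AEP i.
  have -> : ev E y = ev (AE i).2 y * ev (v * \prod_(j | j != i) (AE j).2) y.
    by rewrite -evM /E (bigD1 i) //= mulrCA.
  rewrite /B evM -mulf_div divff ?mulr1 //.
  rewrite evM mulf_neq0 // ev_prod; apply/prodf_neq0 => j _; exact: ny.
have E0 : E != 0 by apply: contra_neq Ex => ->; rewrite /ev meval0.
have H0 : H != 0 by apply: contra_neq Hz => ->; rewrite /ev meval0.
have [h hE] : exists h, E * F = h * H.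
  (* Multiply the equation of F/H by (E H)^d: with E a_i = B_i, the i-th term becomes B_i E^(d - i -
     1) (E F)^i H^(d - i). *)
  apply: (@mpoly_integrally_closed _ _ _ _ d (fun i => B i * E ^+ (d - i.+1))) => //.
  (* The relation is known only where E and H do not vanish; multiplying by E H makes it hold at
     every point, hence as polynomials. *)
  set R := (X in X = 0); have : R * (E * H) = 0.
    apply: ev_eq0 => y; rewrite evM; have [EH|] := eqVneq (ev (E * H) y) 0.
      by rewrite EH mulr0.
    rewrite evM mulf_eq0 negb_or => /andP[Ey Hy].
    have [Uy fy] := FH y Hy; have [Vy ay] := EB y Ey.
    have := rel y Uy Vy; rewrite fy => rely.
    suff -> : ev R y = 0 by rewrite mul0r.
    transitivity ((ev E y * ev H y) ^+ d * ((ev F y / ev H y) ^+ d +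
        \sum_(i < d) a i y * (ev F y / ev H y) ^+ i)); last by rewrite rely mulr0.
    have evX p n : ev (p ^+ n) y = ev p y ^+ n by rewrite /ev rmorphXn.
    have evD p q : ev (p + q) y = ev p y + ev q y by rewrite /ev mevalD.
    have ev_sum (G : 'I_d -> {mpoly k[r]}) : ev (\sum_i G i) y = \sum_i ev (G i) y.
      by rewrite /ev raddf_sum.
    rewrite /R evD ev_sum mulrDr; congr (_ + _).
      rewrite evX evM -exprMn; congr (_ ^+ _).
      by field.
    rewrite mulr_sumr; apply: eq_bigr => i _; rewrite ay.
    rewrite !evM !evX evM exprMn expr_div_n.
    rewrite -[X in (_ * _) ^+ X](subnK (ltn_ord i)).
    have -> : ev H y ^+ (d - i) = ev H y ^+ (d - i.+1) * ev H y.
      by rewrite -exprSr subnSK.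
    rewrite exprMn !exprD !exprS.
    have := expf_neq0 i Hy.
    move: (ev H y ^+ i) (ev H y ^+ _) (ev E y ^+ i) (ev E y ^+ _) => h1 h2 e1 e2 h10.
    by field; rewrite h10 Ey.
  move=> /eqP; rewrite mulf_eq0 => /orP[/eqP//|].
  by rewrite mulf_eq0 (negPf E0) (negPf H0).
have H0' : exists y, ev H y != 0 by exists z.
exists [set y | setT y /\ ev E y != 0], (fun y => ev h y / ev E y); split=> //.
  have oE := open_regular_neq0 (ev_regular E).
  apply: regular_div; last by move=> y [].
  - by apply: (regular_restrict oE _ (ev_regular h)).
  - by apply: (regular_restrict oE _ (ev_regular E)).
move=> y [_ Ey] Uy; apply/eqP; rewrite -subr_eq0; apply/eqP.
have oE := open_regular_neq0 (ev_regular E).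
have oUE := open_setI (regular_open rf) oE.
(* Where H is nonzero, f = F/H = h/E; the equality then spreads by density. *)
apply: (@affine_identity (U `&` [set y | setT y /\ ev E y != 0])
  [set y | setT y /\ ev H y != 0] (fun y => f y - ev h y / ev E y)).
- apply: regular_sub; first by apply: (regular_restrict oUE _ rf) => ? [].
  apply: regular_div; last by move=> ? [_ []].
  - by apply: (regular_restrict oUE _ (ev_regular h)).
  - by apply: (regular_restrict oUE _ (ev_regular E)).
- exact: open_regular_neq0 (ev_regular H).
- by exists z.
- move=> {Ey Uy}y [_ Hy] [Uy [_ Ey]]; have [_ ->] := FH y Hy.
  apply/eqP; rewrite subr_eq0 eqr_div //; apply/eqP.
  by rewrite mulrC -!evM hE.
- by split.
Qed.

End Affine.

Section LocalRings.
Variables (k : fieldType) (S : fspace k).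

Lemma open_bigcap_ord n (U : 'I_n -> set S) :
  (forall i, is_open (U i)) -> is_open [set x | forall i, U i x].
Proof.
move=> oU.
suff H (s : seq 'I_n) : is_open [set x | forall i, i \in s -> U i x].
  have -> : [set x | forall i, U i x] = [set x | forall i, i \in enum 'I_n -> U i x].
    by apply/seteqP; split=> x Ux i => [_|]; apply: Ux; rewrite ?mem_enum.
  exact: H.
elim: s => [|i s IH].
  by have -> : [set x | forall i, i \in [::] -> U i x] = setT;
    [apply/seteqP | exact: open_setT].
have -> : [set x | forall j, j \in i :: s -> U j x] =
    U i `&` [set x | forall j, j \in s -> U j x].
  apply/seteqP; split=> [x Ux|x [Ui Us] j].
    by split=> [|j js]; apply: Ux; rewrite inE ?eqxx // js orbT.
  by rewrite inE => /predU1P[->|/Us].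
exact: open_setI.
Qed.

Lemma germ_family x n (f : 'I_n -> S -> k) : (forall i, germ x (f i)) ->
  exists U : set S, [/\ is_open U, U x & forall i, is_regular U (f i)].
Proof.
move=> /choice[U HU]; exists [set y | forall i, U i y].
have oU : is_open [set y | forall i, U i y].
  by apply: open_bigcap_ord => i; have [_ /regular_open] := HU i.
split=> // [i|i]; have [Ux rf] := HU i; first exact: Ux.
by apply: regular_restrict rf => // y; exact.
Qed.

End LocalRings.

(** * Normality and cotangent spaces of affine space *)

Section AffineLocal.
Variables (k : closedFieldType) (r : nat).
Local Notation A := (affine_space k r).

(** The local ring is a domain because nonempty open sets meet. The fraction f/g is regular where g
    is nonzero, so [affine_integral] provides e near x, and f = e g spreads from that dense open
    set. *)
Lemma affine_normal_at (x : A) : normal_at x.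
Proof.
split=> [f g [U [Ux rf]] [V [Vx rg]] [W [oW Wx fg0]]|
         f g [U [Ux rf]] [V [Vx rg]] g0 d a ga [W [oW Wx rel]]].
  have oUV := open_setI (regular_open rf) (regular_open rg).
  have oO := open_setI oUV oW.
  have Ox : ((U `&` V) `&` W) x by split.
  have {}rf := regular_restrict oO (fun y O => O.1.1) rf.
  have {}rg := regular_restrict oO (fun y O => O.1.2) rg.
  have [nf|/existsNP[y /not_implyP[Oy /eqP fy]]] :=
      pselect (forall y, ((U `&` V) `&` W) y -> f y = 0).
    by left; exists ((U `&` V) `&` W).
  right; exists ((U `&` V) `&` W); split=> //.
  apply: (affine_identity rg (open_regular_neq0 rf)); first by exists y.
  move=> z [Oz fz] _; have := fg0 z Oz.2.
  by move/eqP; rewrite mulf_eq0 (negPf fz) => /eqP.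
have [U' [oU' U'x ra]] := germ_family ga.
have oUV := open_setI (regular_open rf) (regular_open rg).
have oO := open_setI oUV (open_setI oW oU').
set O := (U `&` V) `&` (W `&` U') in oO.
have Ox : O x by [].
have {}rf : is_regular O f by apply: regular_restrict rf => // y [[]].
have {}rg : is_regular O g by apply: regular_restrict rg => // y [[]].
have {}ra i : is_regular O (a i) by apply: regular_restrict (ra i) => // y [_ []].
have oOg := open_regular_neq0 rg.
have [y Oy] : [set y | O y /\ g y != 0] !=set0.
  apply: contrapT => Og0; apply: g0; exists O; split=> // y Oy.
  by apply: contrapT => /eqP gy; apply: Og0; exists y.
have [||z Oz Oz'|P [e [Px re fe]]] :=
    @affine_integral k r [set y | O y /\ g y != 0] O x (fun y => f y / g y) d a _ Ox
      _ oO ra.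
- by exists y.
- apply: regular_div.
  + by apply: regular_restrict rf => // z [].
  + by apply: regular_restrict rg => // z [].
  + by move=> z [].
- have := rel z Oz'.2.1; have gz := Oz.2.
  move/(congr1 (fun w => w / g z ^+ d)); rewrite mul0r mulrDl expr_div_n mulr_suml.
  move=> e; rewrite -[RHS]e; congr (_ + _); apply: eq_bigr => i _.
  have -> : g z ^+ d = g z ^+ (d - i) * g z ^+ i.
    by rewrite -exprD subnK // ltnW.
  rewrite expr_div_n.
  have := expf_neq0 (d - i) gz; have := expf_neq0 i gz.
  by move: (g z ^+ i) (g z ^+ (d - i)) (f z ^+ i) => u v w u0 v0; field; rewrite u0 v0.
exists e; split; first by exists P.
have oOP := open_setI oO (regular_open re).
exists (O `&` P); split=> // z Oz; apply/eqP; rewrite -subr_eq0; apply/eqP; move: z Oz.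
apply: (@affine_identity k r (O `&` P) [set y | O y /\ g y != 0] (fun z => f z - e z * g z)).
- have re' : is_regular (O `&` P) e by apply: regular_restrict re => // z [].
  apply: regular_sub; first by apply: regular_restrict rf => // z [].
  by apply: regular_mul => //; apply: regular_restrict rg => // z [].
- exact: oOg.
- by exists y.
- move=> z Oz [_ Pz]; rewrite -fe // divfK ?subrr //; exact: Oz.2.
Qed.

Lemma regular_line U (f : A -> k) x v : is_regular U f -> U x ->
  exists a h : {poly k}, h.[0] != 0 /\
    forall s, h.[s] != 0 -> U (x + s *: v) /\ f (x + s *: v) = a.[s] / h.[s].
Proof.
move=> rf Ux; have [a [h [hx H]]] := affine_regular rf Ux.
have [a' Ha] := ev_line a x v; have [h' Hh] := ev_line h x v.
exists a', h'; split; first by rewrite -Hh scale0r addr0.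
by move=> s; rewrite -Hh -Ha; exact: H.
Qed.

(** Elements of m^2 vanish to order two along every line through x; this will give the uniqueness of
    linear parts. *)
Lemma in_max2_line (f : A -> k) x v : in_max2 x f -> exists a h : {poly k},
  h.[0] != 0 /\ forall s, h.[s] != 0 -> f (x + s *: v) = s ^+ 2 * a.[s] / h.[s].
Proof.
move=> [l [g [g' [gm [U [oU Ux fE]]]]]].
have in_max_line (b : A -> k) : in_max x b -> exists a h : {poly k}, h.[0] != 0 /\
    forall s, h.[s] != 0 -> b (x + s *: v) = s * a.[s] / h.[s].
  move=> [[V [Vx rb]] b0]; have [a [h [h0 H]]] := regular_line v rb Vx.
  have [_] := H 0 h0; rewrite scale0r addr0 b0 => /esym/eqP.
  rewrite mulf_eq0 invr_eq0 (negPf h0) orbF => /factor_theorem[q aq].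
  exists q, h; split=> // s hs; have [_ ->] := H s hs.
  by rewrite aq hornerM hornerXsubC subr0 [s * _]mulrC.
have [u [u0 uU]] := open_line v oU Ux.
have [a [h [h0 H]]] : exists a h : {poly k}, h.[0] != 0 /\
    forall s, h.[s] != 0 -> \sum_i g i (x + s *: v) * g' i (x + s *: v) =
      s ^+ 2 * a.[s] / h.[s].
  elim: (index_enum _) => [|i js [a [h [h0 H]]]].
    exists 0, 1; rewrite hornerC oner_neq0; split=> // s _.
    by rewrite big_nil horner0 mulr0 mul0r.
  have [gi gi'] := gm i.
  have [a1 [h1 [h10 H1]]] := in_max_line _ gi.
  have [a2 [h2 [h20 H2]]] := in_max_line _ gi'.
  exists (a1 * a2 * h + a * (h1 * h2)), (h1 * h2 * h).
  split=> [|s]; first by rewrite !hornerM !mulf_eq0 !negb_or h10 h20 h0.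
  rewrite hornerD !hornerM !mulf_eq0 !negb_or => /andP[/andP[h1s h2s] hs].
  by rewrite big_cons H // H1 // H2 //; field; rewrite h1s h2s hs.
exists (a * u), (h * u); split; first by rewrite hornerM mulf_neq0.
move=> s; rewrite !hornerM mulf_eq0 negb_or => /andP[hs us].
by rewrite fE ?H //; [field; rewrite hs us | exact: uU].
Qed.

(** First-order expansion with polynomial coefficients: a product is handled by telescoping p q -
    p(x) q(x). *)
Lemma ev_hadamard (p : {mpoly k[r]}) (x : A) : exists g : 'I_r -> {mpoly k[r]},
  forall y, ev p y - ev p x = \sum_i (y 0 i - x 0 i) * ev (g i) y.
Proof.
rewrite /ev; elim/mpoly_ring_ind: p => [c|j|p q [g Hg] [h Hh]|p q [g Hg] [h Hh]].
- exists (fun=> 0) => y; rewrite !mevalC subrr big1 // => i _.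
  by rewrite /ev /= mulr0.
- exists (fun i => (i == j)%:R) => y; rewrite !mevalXU (bigD1 j) //= /ev /= eqxx ?meval1.
  by rewrite mulr1 big1 ?addr0 // => i /negPf ->; rewrite /= ?meval0 mulr0.
- exists (fun i => g i + h i) => y; rewrite !mevalD opprD addrACA Hg Hh -big_split.
  by apply: eq_bigr => i _; rewrite /ev mevalD mulrDr.
- exists (fun i => g i * q + p.@[fun i => x 0 i] *: h i) => y.
  transitivity ((p.@[fun i => y 0 i] - p.@[fun i => x 0 i]) * q.@[fun i => y 0 i] +
    p.@[fun i => x 0 i] * (q.@[fun i => y 0 i] - q.@[fun i => x 0 i])).
    by rewrite !mevalM; ring.
  rewrite Hg Hh mulr_suml mulr_sumr -big_split; apply: eq_bigr => i _.
  by rewrite /ev mevalD mevalM mevalZ /=; ring.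
Qed.

Lemma affine_cotangent_dim (x : A) : has_cotangent_dim x r.
Proof.
pose t i : A -> k := fun y => y 0 i - x 0 i.
have rt i : is_regular setT (t i).
  by apply: regular_sub; [exact: regular_coord | apply/regular_cst/open_setT].
have tm i : in_max x (t i) by split; [exists setT | rewrite /t subrr].
exists t; split=> // f [[U [Ux rf]] f0].
have [a [h [hx fE]]] := affine_regular rf Ux.
have a0 : ev a x = 0.
  have [_ /esym/eqP] := fE x hx.
  by rewrite f0 mulf_eq0 invr_eq0 (negPf hx) orbF => /eqP.
have [g Hg] := ev_hadamard a x.
have oh := open_regular_neq0 (ev_regular h).
(* With f = sum_i t_i g_i/h and c_i the value of g_i/h at x, the remainder f - sum_i c_i t_i is
   sum_i t_i e_i, which lies in m^2. *)
pose e i y := ev (g i) y / ev h y - ev (g i) x / ev h x.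
have em i : in_max x (e i).
  split; last by rewrite /e subrr.
  exists [set y | setT y /\ ev h y != 0]; split=> //.
  apply: regular_sub; last exact: regular_cst.
  apply: regular_div; last by move=> y [].
    by apply: regular_restrict (ev_regular (g i)).
  by apply: regular_restrict (ev_regular h).
pose c : 'rV[k]_r := \row_i (ev (g i) x / ev h x).
have c2 : in_max2 x (fun y => f y - \sum_i c 0 i * t i y).
  exists r, t, e; split=> //.
  exists [set y | setT y /\ ev h y != 0]; split=> // y [_ hy].
  have [_ ->] := fE y hy; rewrite -[ev a y]subr0 -{1}a0 Hg mulr_suml -sumrB.
  by apply: eq_bigr => i _; rewrite mxE /e /t; ring.
exists c; split=> // c' c'2; apply/rowP => i.
have [b [u [u0 H]]] := in_max2_line (delta_mx 0 i) c2.
have [b' [u' [u'0 H']]] := in_max2_line (delta_mx 0 i) c'2.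
have sumE (d : 'rV[k]_r) s :
    \sum_j d 0 j * t j (x + s *: delta_mx 0 i) = s * d 0 i.
  rewrite (bigD1 i) //= big1 => [|j ji].
    by rewrite /t !mxE !eqxx /= mulr1n; ring.
  by rewrite /t !mxE (negPf ji) andbF mulr0 addr0 subrr mulr0.
(* Along the i-th axis the two expansions differ by s (c'_i - c_i) = s^2 (b/u - b'/u'). Dividing by
   s and clearing denominators gives w = 0 where s u u' is nonzero, hence identically; at s = 0 it
   says c'_i = c_i. *)
pose w := (c' 0 i - c 0 i)%:P * u * u' - 'X * (b * u' - b' * u).
have /eqP : w * ('X * u * u') = 0.
  apply/eqP/negPn/negP => /closed_nonrootP[s]; rewrite rootE !hornerM !mulf_eq0 !negb_or.
  rewrite hornerX => /andP[ws /andP[/andP[s0 us] u's]].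
  have := H s us; have := H' s u's; rewrite !sumE => E' E.
  have cc : s * c' 0 i - s * c 0 i =
      s ^+ 2 * b.[s] / u.[s] - s ^+ 2 * b'.[s] / u'.[s].
    by rewrite -E -E'; ring.
  case/negP: ws; rewrite /w !hornerE; apply/eqP; apply: (mulfI s0); rewrite mulr0.
  transitivity (((s * c' 0 i - s * c 0 i) -
      (s ^+ 2 * b.[s] / u.[s] - s ^+ 2 * b'.[s] / u'.[s])) * u.[s] * u'.[s]).
    by field; rewrite us u's.
  by rewrite cc subrr !mul0r.
rewrite mulf_eq0 => /orP[/eqP w0|].
  have := congr1 (fun q : {poly k} => q.[0]) w0.
  rewrite /w hornerD hornerN !hornerM hornerC hornerX mul0r subr0 horner0 => /eqP.
  rewrite !mulf_eq0 (negPf u0) (negPf u'0) !orbF.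
  by rewrite subr_eq0 => /eqP.
have nz (q : {poly k}) : q.[0] != 0 -> q != 0.
  by apply: contra_neq => ->; rewrite horner0.
by rewrite !mulf_eq0 polyX_eq0 (negPf (nz _ u0)) (negPf (nz _ u'0)).
Qed.

End AffineLocal.

(** Contrapositive use of [chain_independent]: algebraic dependence in a class of functions that
    separates points from closed sets bounds the dimension. *)
Lemma chain_bound (k : fieldType) (S : fspace k) (Fc : (S -> k) -> Prop) d :
  (forall f, Fc f -> is_regular setT f) ->
  (forall A x, is_closed A -> ~ A x ->
    exists f, [/\ Fc f, forall y, A y -> f y = 0 & f x != 0]) ->
  (forall g : 'I_d -> S -> k, (forall i, Fc (g i)) ->
    exists2 Q : {mpoly k[d]}, Q != 0 & forall x, Q.@[fun i => g i x] = 0) ->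
  ~ exists C, irreducible_chain d (S := S) C.
Proof.
move=> Fr Fs dep [C cC]; have [g [gF gi]] := chain_independent Fr Fs cC.
by have [Q Q0 HQ] := dep g gF; move: Q0; rewrite (gi Q) ?eqxx.
Qed.

Lemma has_dim_uniq (k : fieldType) (S : fspace k) d e :
  has_dim S d -> has_dim S e -> d = e.
Proof.
have lt a b : has_dim S a -> has_dim S b -> (a < b)%N -> False.
  move=> [_ na] [[C [C1 C2]] _] ab; apply: na; exists C.
  by split=> i ia; [apply: C1 | apply: C2]; exact: leq_trans ab.
by move=> dd de; case: (ltngtP d e) => // /lt; case.
Qed.

Lemma dimensionE (k : fieldType) (S : fspace k) d :
  has_dim S d -> dimension S = d.
Proof.
move=> dd; rewrite /dimension; case: xgetP => [e _ de|/(_ d)//].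
exact: has_dim_uniq de dd.
Qed.

(** * Dimension and nonsingularity of affine space *)

Section AffineDimension.
Variables (k : closedFieldType) (r : nat).
Local Notation A := (affine_space k r).

Lemma affine_dim_at (x : A) : has_dim_at x r.
Proof.
split.
  (* The flag of coordinate subspaces through x, of dimensions 0 to r, is a chain of length r. *)
  pose C i : set A := [set y : 'rV[k]_r | forall j : 'I_r, (i <= j)%N -> y 0 j = x 0 j].
  exists C; split; last by move=> j _.
  split=> [i _|i ir]; split.
  - apply: open_local => y /existsNP[j /not_implyP[ij /eqP yj]].
    exists [set z : A | setT z /\ z 0 j - x 0 j != 0]; split.
    + apply: open_regular_neq0; apply: regular_sub; first exact: regular_coord.
      exact/regular_cst/open_setT.
    + by rewrite /= subr_eq0.
    + by move=> z [_ /eqP zj] Cz; apply: zj; rewrite Cz // subrr.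
  - apply: irreducible_convex; first by exists x => j.
    move=> y z s Cy Cz j ij; rewrite !mxE Cy // Cz // subrr mulr0 addr0 //.
  - by move=> y Cy j /ltnW; exact: Cy.
  - move=> /(_ (x + delta_mx 0 (Ordinal ir))) sub.
    have : C i.+1 (x + delta_mx 0 (Ordinal ir)).
      move=> j ij; rewrite !mxE [j == _]negbTE ?andbF ?addr0 //.
      by apply: contraTneq ij => ->; rewrite /= ltnn.
    move=> /sub/(_ (Ordinal ir) (leqnn _)); rewrite !mxE !eqxx => /eqP.
    by rewrite /= addrC -subr_eq0 addrK oner_eq0.
move=> [C [cC _]]; apply: (@chain_bound k A (fun f => exists p, f = ev p) r.+1 _ _ _
  (ex_intro _ C cC)).
- by move=> _ [p ->]; exact: ev_regular.
- move=> B y cB nBy; have [p [py H]] := affine_open cB nBy.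
  exists (ev p); split=> //; first by exists p.
  by move=> z Bz; apply/eqP/negPn/negP => /H.
- move=> g /choice[F gE]; have [Q Q0 HQ] := mpoly_dependent F.
  exists Q => // y; rewrite -[RHS](HQ (fun i => y 0 i)).
  by apply: meval_eq => i; rewrite gE.
Qed.

Lemma affine_nonsingular_at (x : A) : nonsingular_at x.
Proof.
by exists r; split; [exact: affine_cotangent_dim | exact: affine_dim_at].
Qed.

End AffineDimension.

(** * Finite birational morphisms *)

Section RegularCharPoly.
Variables (k : fieldType) (S : fspace k) (V : set S).
Hypothesis oV : is_open V.

Let coef_regular (Q : S -> {poly k}) := forall i, is_regular V (fun y => (Q y)`_i).

Lemma regular_char_poly n (M : S -> 'M[k]_n) :
  (forall i j, is_regular V (fun y => M y i j)) ->
  forall i, is_regular V (fun y => (char_poly (M y))`_i).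
Proof.
move=> rM.
have cC (f : S -> k) : is_regular V f -> coef_regular (fun y => (f y)%:P).
  move=> rf i; apply: (regular_ext (f := fun y => if i == 0%N then f y else 0)).
    by move=> y _; rewrite coefC.
  by case: (i == _) => //; exact: regular_cst.
have cD Q1 Q2 : coef_regular Q1 -> coef_regular Q2 ->
    coef_regular (fun y => Q1 y + Q2 y).
  move=> r1 r2 i; apply: (regular_ext _ (regular_add (r1 i) (r2 i))) => y _.
  by rewrite coefD.
have cM Q1 Q2 : coef_regular Q1 -> coef_regular Q2 ->
    coef_regular (fun y => Q1 y * Q2 y).
  move=> r1 r2 i.
  apply: (regular_ext (f := fun y => \sum_(j < i.+1) (Q1 y)`_j * (Q2 y)`_(i - j))).
    by move=> y _; rewrite coefM.
  by apply: regular_sum => // j; exact: regular_mul.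
suff : coef_regular (fun y => \det (char_poly_mx (M y))) by [].
have cE (Q1 Q2 : S -> {poly k}) : Q1 =1 Q2 -> coef_regular Q1 -> coef_regular Q2.
  by move=> /funext ->.
have csum (I : Type) (s : seq I) (Q : I -> S -> {poly k}) :
    (forall i, coef_regular (Q i)) -> coef_regular (fun y => \sum_(i <- s) Q i y).
  move=> rQ; elim: s => [|i s IH].
    apply: cE (cC _ (regular_cst 0 oV)) => y; by rewrite big_nil.
  by apply: cE (cD _ _ (rQ i) IH) => y; rewrite big_cons.
have cprod (I : Type) (s : seq I) (Q : I -> S -> {poly k}) :
    (forall i, coef_regular (Q i)) -> coef_regular (fun y => \prod_(i <- s) Q i y).
  move=> rQ; elim: s => [|i s IH].
    apply: cE (cC _ (regular_cst 1 oV)) => y; by rewrite big_nil.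
  by apply: cE (cM _ _ (rQ i) IH) => y; rewrite big_cons.
apply: csum => s; apply: cM.
  apply: (cE (fun=> ((-1) ^+ s)%:P)) => [y|].
    by rewrite rmorphXn rmorphN1.
  exact/cC/regular_cst.
apply: cprod => i.
apply: cE (cD (fun=> 'X *+ (i == s i)) (fun y => (- M y i (s i))%:P) _ _) => [y||].
- by rewrite !mxE polyCN.
- by move=> j; exact: regular_cst.
- exact/cC/regular_opp.
Qed.

End RegularCharPoly.

Section FiniteBirational.
Variable k : closedFieldType.

(* Multiplication by f on the generators b is given by a matrix over V, of
   which f n is an eigenvalue with eigenvector (b i n)_i at every point n. *)
Lemma finite_integral (N Y : fspace k) (nu : N -> Y) (V : set Y) l
    (b : 'I_l -> N -> k) :
  is_open V -> is_open (nu @^-1` V) ->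
  (forall i, is_regular (nu @^-1` V) (b i)) ->
  (forall f, is_regular (nu @^-1` V) f ->
     exists a : 'I_l -> Y -> k, (forall i, is_regular V (a i)) /\
       forall x, V (nu x) -> f x = \sum_i a i (nu x) * b i x) ->
  forall f, is_regular (nu @^-1` V) f ->
  exists a : 'I_l -> Y -> k, (forall i, is_regular V (a i)) /\
    forall x, V (nu x) -> f x ^+ l + \sum_(i < l) a i (nu x) * f x ^+ i = 0.
Proof.
move=> oV oV' rb gen f rf.
have /choice[A HA] : forall j, exists a : 'I_l -> Y -> k,
    (forall i, is_regular V (a i)) /\
    forall x, V (nu x) -> f x * b j x = \sum_i a i (nu x) * b i x.
  by move=> j; apply: (gen (fun x => f x * b j x)); exact: regular_mul.
(* Writing 1 in terms of the generators shows that they have no common zero, so the vector of their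
   values is a genuine eigenvector. *)
have [u [_ Hu]] := gen _ (regular_cst 1 oV').
pose M y : 'M[k]_l := \matrix_(i, j) A j i y.
have rM i j : is_regular V (fun y => M y i j).
  by apply: (regular_ext _ ((HA j).1 i)) => y _; rewrite mxE.
exists (fun i y => (char_poly (M y))`_i); split=> [i|x Vx].
  exact: regular_char_poly.
have : root (char_poly (M (nu x))) (f x).
  rewrite -eigenvalue_root_char; apply/eigenvalueP.
  exists (\row_i b i x).
    apply/rowP => j; rewrite !mxE (HA j).2 //; apply: eq_bigr => i _.
    by rewrite !mxE mulrC.
  apply: contraTneq (oner_neq0 k) => b0; rewrite negbK; apply/eqP.
  rewrite (Hu x Vx); apply: big1 => i _.
  by have /rowP/(_ i) := b0; rewrite !mxE => ->; rewrite mulr0.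
rewrite rootE horner_coef size_char_poly big_ord_recr /= addrC.
have := char_poly_monic (M (nu x)); rewrite monicE lead_coefE size_char_poly /=.
by move=> /eqP ->; rewrite mul1r => /eqP.
Qed.

(** Restates affineness of V on S itself: maps into V can be built from their coordinates through
    [psi], and points of V are determined by their coordinates [b]. *)
Lemma affine_coordinates (S : fspace k) (V : set S) (x0 : S) :
  is_open V -> V x0 -> affine (subspace V) ->
  exists r (P : set {mpoly k[r]}) (b : 'I_r -> S -> k)
    (psi : subspace (zero_locus P) -> S),
  [/\ forall i, is_regular V (b i),
      forall x p, V x -> P p -> p.@[fun i => b i x] = 0,
      regular_map psi, forall z, V (psi z) &
      (forall (z : subspace (zero_locus P)) i,
         b i (psi z) = (val z : 'rV[k]_r) 0 i) /\
      forall x (z : subspace (zero_locus P)), V x ->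
        (forall i, (val z : 'rV[k]_r) 0 i = b i x) -> psi z = x].
Proof.
move=> oV Vx0 [r [P [phi [psi [phiK psiK rphi rpsi]]]]].
have [s emb] := open_embedding_val (exist _ x0 (mem_set Vx0) : subspace V) oV.
have [rval valK _ fval] := emb.
have sK x : V x -> val (s x) = x.
  move=> Vx; pose x' : subspace V := exist _ x (mem_set Vx).
  exact: (congr1 val (valK x')).
have valT : val @` (setT : set (subspace V)) = V.
  apply/seteqP; split=> [_ [x _ <-]|x Vx]; first exact: set_valP.
  by exists (s x) => //; exact: sK.
exists r, P, (fun i x => val (phi (s x)) 0 i), (val \o psi); split.
- move=> i; rewrite -valT; apply: (fval setT (fun x => val (phi x) 0 i)).
  have [_ H] := regular_map_comp rphi (@regular_map_val k _ _).
  exact: (H _ _ (regular_coord i)).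
- by move=> x p Vx Pp; have := set_valP (phi (s x)); apply.
- exact: regular_map_comp.
- by move=> z; exact: set_valP.
- split=> [z i|x z Vx zE]; first by rewrite /= valK psiK.
  rewrite /= -[RHS](sK x Vx) -(phiK (s x)); congr (val (psi _)).
  by apply: val_inj; apply/rowP.
Qed.

Lemma affine_separates (S : fspace k) (V : set S) (x0 : S) :
  is_open V -> V x0 -> affine (subspace V) ->
  exists r (b : 'I_r -> S -> k), (forall i, is_regular V (b i)) /\
    forall x y, V x -> V y -> (forall i, b i x = b i y) -> x = y.
Proof.
move=> oV Vx0 aV; have [r [P [b [psi [rb bP _ _ [_ bK]]]]]] := affine_coordinates oV Vx0 aV.
exists r, b; split=> // x y Vx Vy bxy.
have zx : zero_locus P (\row_i b i x).
  by move=> q Pq; rewrite -(bP x q Vx Pq); apply: meval_eq => i; rewrite mxE.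
pose z : subspace (zero_locus P) :=
  @exist _ (fun z => z \in zero_locus P) _ (mem_set zx).
transitivity (psi z); last by apply: (bK y z Vy) => i; rewrite mxE.
by apply/esym/(bK x z Vx) => i; rewrite mxE.
Qed.

Variables (N Y : fspace k) (nu : N -> Y) (D : nat).
Hypotheses (fin : finite_morphism nu) (bir : birational_morphism nu).

Section Local.
Variables (c : affine_space k D -> Y) (r : Y -> affine_space k D).
Variables (p : affine_space k D) (x0 : N).
Hypotheses (emb : open_embedding c r) (cp : c p = nu x0).

Let rnu : regular_map nu. Proof. by case: fin. Qed.
Let rc : regular_map c. Proof. by case: emb. Qed.
Let cK : cancel c r. Proof. by case: emb. Qed.

(** The inverse of nu over V0 is made total on Y, with junk values off V0. *)
Lemma birational_section : exists (V0 : set Y) (psi : Y -> N),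
  [/\ is_open V0, is_dense V0, is_dense (nu @^-1` V0) &
      [/\ forall f U, is_regular (nu @^-1` U) f ->
             is_regular (V0 `&` U) (f \o psi),
          forall y, V0 y -> nu (psi y) = y &
          forall x, V0 (nu x) -> psi (nu x) = x]].
Proof.
case: bir => _ [V0 [oV0 dV0 dV0' [psi [rpsi rangepsi psiK]]]].
have [y0 _ V0y0] : exists2 y, (setT : set Y) y & V0 y.
  by move/is_denseP: dV0; apply; [exact: open_setT | exists (nu x0)].
have [s emb0] := open_embedding_val (exist _ y0 (mem_set V0y0) : subspace V0) oV0.
have [rval valK _ fval] := emb0.
have sK y : V0 y -> val (s y) = y.
  move=> V0y; pose y' : subspace V0 := exist _ y (mem_set V0y).
  exact: (congr1 val (valK y')).
exists V0, (psi \o s); split=> //; split.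
- move=> f U rf.
  suff -> : V0 `&` U = val @` (psi @^-1` (nu @^-1` U)) by exact: fval (rpsi.2 _ _ rf).
  apply/seteqP; split=> [y [V0y Uy]|_ [y Uy <-]].
    by exists (s y); rewrite /= ?psiK sK.
  by split; [exact: set_valP | move: Uy; rewrite /= psiK].
- by move=> y V0y; rewrite /= psiK sK.
- move=> x V0x; have : range psi x by rewrite rangepsi.
  by case=> z _ <-; rewrite /= psiK valK.
Qed.

(* f descends to a rational function on Y which is integral over the local ring
   at nu x0, and hence belongs to it. *)
Lemma finite_birational_descend (V : set Y) f d (a : 'I_d -> Y -> k) :
  is_open V -> V (nu x0) -> is_regular (nu @^-1` V) f ->
  (forall i, is_regular V (a i)) ->
  (forall x, V (nu x) -> f x ^+ d + \sum_(i < d) a i (nu x) * f x ^+ i = 0) ->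
  exists (W : set (affine_space k D)) e,
    [/\ W p, W `<=` c @^-1` V, is_regular W e &
        forall w x, W w -> nu x = c w -> f x = e w].
Proof.
move=> oV Vx0 rf ra rel.
have [V0 [psi [oV0 dV0 dV0' [fpsi psiK nuK]]]] := birational_section.
have [rc1 rc2] := rc; have [rn1 rn2] := rnu.
have oc : is_open (range c) := open_embedding_range emb.
have [y Vcy V0y] : exists2 y, (V `&` range c) y & V0 y.
  move/is_denseP: dV0; apply; first exact: open_setI.
  by exists (nu x0); split=> //; rewrite -cp; exists p.
have [W [e [Wp re fe]]] : exists (W : set (affine_space k D)) e,
    [/\ W p, is_regular W e &
        forall w, W w -> (c @^-1` (V0 `&` V)) w -> f (psi (c w)) = e w].
  apply: (@affine_integral k D (c @^-1` (V0 `&` V)) (c @^-1` V) p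
    (fun w => f (psi (c w))) d (fun i => a i \o c)).
  - by case: Vcy => Vy [w _ wy]; exists w; rewrite /= wy.
  - by rewrite /= cp.
  - exact: rc2 (fpsi _ _ rf).
  - exact: rc1.
  - by move=> i; exact: rc2 (ra i).
  - move=> w [V0w Vw] _; rewrite /= -{2}(psiK (c w) V0w).
    by apply: rel; rewrite psiK.
have oWV : is_open (W `&` c @^-1` V) := open_setI (regular_open re) (rc1 _ oV).
have {}re : is_regular (W `&` c @^-1` V) e.
  by apply: regular_restrict re => // w [].
exists (W `&` c @^-1` V), e; split=> //; first by split=> //; rewrite /= cp.
(* Over V0 the equality is [fe]. If f and e differed at some other x, they would differ on an open
   set, which meets the preimage of V0 by density. *)
move=> w x [Ww Vw] nux; apply: contrapT => /eqP fx.
pose O := nu @^-1` (c @` (W `&` c @^-1` V)).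
have oO : is_open O by apply: rn1; case: emb => _ _ + _; exact.
have rfe : is_regular O (fun x => f x - e (r (nu x))).
  apply: regular_sub.
    by apply: regular_restrict rf => // x' [w' [_ Vw'] ew']; rewrite /= -ew'.
  by case: emb => _ _ _ /(_ _ _ re); exact: rn2.
have [|x' [[w' [Ww' Vw'] ew'] fx'] V0x'] :=
    (is_denseP _).1 dV0' _ (open_regular_neq0 rfe).
  exists x; split; first by exists w.
  by rewrite nux cK subr_eq0.
move: fx'; rewrite -ew' cK -fe //; last by split=> //; rewrite /= ew'.
by rewrite ew' nuK // subrr eqxx.
Qed.

(** The affine coordinates [t] of N over V are integral over V, so they descend to regular functions
    [e] near p. By density these satisfy the equations [P] of N, and so define [j], which inverts nu
    over U: locally nu is an isomorphism. *)
Lemma finite_birational_chart : exists (U : set (affine_space k D))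
    (j : subspace U -> N) s,
  [/\ is_open U, open_embedding j s & range j x0].
Proof.
have [V0 [psi [oV0 dV0 dV0' [fpsi psiK nuK]]]] := birational_section.
have [rc1 rc2] := rc; have [rn1 rn2] := rnu.
have [_ /(_ (nu x0))[V [oV Vx0 affV affV' [l [b [rb gen]]]]]] := fin.
have oV' := rn1 _ oV.
have [m [P [t [phi [rt tP rphi phiV [tphi phit]]]]]] :=
  @affine_coordinates N (nu @^-1` V) x0 oV' Vx0 affV'.
have [m' [t' [rt' t'inj]]] := affine_separates oV Vx0 affV.
have /choice[W HW] : forall i, exists We : set (affine_space k D) * (affine_space k D -> k),
    [/\ We.1 p, We.1 `<=` c @^-1` V, is_regular We.1 We.2 &
        forall w x, We.1 w -> nu x = c w -> t i x = We.2 w].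
  move=> i; have [a [ra Ha]] := finite_integral oV oV' rb gen (rt i).
  have [U [e He]] := finite_birational_descend oV Vx0 (rt i) ra Ha.
  by exists (U, e).
pose U := c @^-1` V `&` [set w | forall i, (W i).1 w].
have oU : is_open U.
  apply: open_setI; first exact: rc1.
  by apply: open_bigcap_ord => i; have [_ _ /regular_open] := HW i.
have Up : U p by split=> [|i]; [rewrite /= cp | have [] := HW i].
pose e i := (W i).2.
have re i : is_regular U (e i).
  by have [_ _ rW _] := HW i; apply: regular_restrict rW => // w [_]; exact.
have te i w x : U w -> nu x = c w -> t i x = e i w.
  by move=> [_ Uw]; have [_ _ _] := HW i; apply.
pose O := c @^-1` V0.
have oO : is_open O := rc1 _ oV0.
have O0 : O !=set0.
  have [|y [w _ <-] V0y] := (is_denseP _).1 dV0 _ (open_embedding_range emb).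
    by exists (nu x0); exists p.
  by exists w.
have eP w q : U w -> P q -> q.@[fun i => e i w] = 0.
  move=> Uw Pq; move: w Uw; apply: (@affine_identity _ _ U O) => //.
    exact: (regular_meval q oU re).
  move=> w Ow Uw; have nuw := psiK _ Ow.
  rewrite -[RHS](tP (psi (c w)) q) //; last by rewrite /= nuw; case: Uw.
  by apply: meval_eq => i; rewrite (te i w).
have eU (w : subspace U) : zero_locus P (\row_i e i (val w)).
  move=> q Pq; rewrite -(eP (val w) q _ Pq); last exact: set_valP.
  by apply: meval_eq => i; rewrite mxE.
pose E (w : subspace U) : subspace (zero_locus P) :=
  @exist _ (fun z => z \in zero_locus P) _ (mem_set (eU w)).
have [rU embU] := open_embedding_val (exist _ p (mem_set Up) : subspace U) oU.
pose cv (w : subspace U) : Y := c (val w).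
have embc : open_embedding cv (rU \o r) := open_embedding_comp emb embU.
pose j := phi \o E.
have rj : regular_map j.
  apply: regular_map_comp rphi; apply: regular_map_subspace.
  apply: regular_map_affine => i.
  have [_ H] := @regular_map_val k _ U.
  have := H _ _ (re i); rewrite (_ : _ @^-1` U = setT); last first.
    by apply/seteqP; split=> // w _; exact: set_valP.
  by apply: regular_ext => w _; rewrite /= mxE.
have jE w x : nu x = c (val w) -> j w = x.
  move=> nux; have Uw := set_valP w.
  apply: phit => [|i]; first by rewrite /= nux; case: Uw.
  by rewrite /= mxE (te i (val w)).
have nuj w : nu (j w) = c (val w).
  have [[rv1 rv2] vK vo vf] := embU.
  have rUK w' : U w' -> val (rU w') = w'.
    move=> Uw'.
    exact: (congr1 val (vK (@exist _ (fun z => z \in U) w' (mem_set Uw')))).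
  have valT : val @` (setT : set (subspace U)) = U.
    apply/seteqP; split=> [_ [x _ <-]|x Ux]; first exact: set_valP.
    by exists (rU x) => //; exact: rUK.
  have VU : (nu \o j) @^-1` V = setT.
    by apply/seteqP; split=> // w' _; exact: phiV.
  (* Both points lie in V, where the coordinates [t'] separate points; these agree over V0, hence on
     U by density. *)
  apply: t'inj => [||i]; first exact: phiV.
    by have [] := set_valP w.
  apply/eqP; rewrite -subr_eq0; apply/eqP.
  have := @affine_identity _ _ U O (fun w' => t' i (nu (j (rU w'))) - t' i (c w')).
  move=> /(_ _ oO O0 _ (val w) (set_valP w)); rewrite vK; apply.
    apply: regular_sub; last first.
      by apply: regular_restrict (rc2 _ _ (rt' i)) => // w' [].
    rewrite -valT; apply: (vf setT (fun w' => t' i (nu (j w')))).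
    by have [_ /(_ _ _ (rt' i))] := regular_map_comp rj rnu; rewrite VU.
  move=> w' Ow' Uw'.
  by rewrite (jE _ (psi (c w'))) ?psiK ?subrr // rUK.
have rcv := open_embedding_range embc.
have cvK y : range cv y -> c (val (rU (r y))) = y.
  have [_ cvK _ _] := embc.
  by move=> [w _ <-]; congr (c (val _)); exact: cvK.
exists U, j, (rU \o r \o nu); split=> //.
  apply: (@open_embeddingI _ _ _ _ _ (nu @^-1` range cv)) => //.
  - exact: rn1.
  - by have [_ cvK' _ _] := embc; move=> w; rewrite /= nuj; exact: cvK'.
  - by move=> w; exists w => //; rewrite /= nuj.
  - by move=> x nux; apply: jE; rewrite /= cvK.
  - have [_ cvK' ocv fcv] := embc.
    have pE Z : nu @^-1` range cv `&` (rU \o r \o nu) @^-1` Z =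
        nu @^-1` (cv @` Z).
      apply/seteqP; split=> [x [nux Zx]|x [w Zw wx]].
        by exists (rU (r (nu x))) => //; exact: cvK.
      by split; [exists w | rewrite /= -wx; have := cvK' w => /= ->].
    by split=> Z; [move=> oZ | move=> f rf]; rewrite pE;
      [exact/rn1/ocv | exact: rn2 (fcv _ _ rf)].
by exists (@exist _ (fun z => z \in U) p (mem_set Up)) => //; apply: jE.
Qed.

End Local.

(* Where Y is locally an affine space, hence normal, nu is an isomorphism. *)
Lemma finite_birational_nonsingular :
  (forall y, exists (c : affine_space k D -> Y) r,
     open_embedding c r /\ range c y) -> nonsingular N.
Proof.
move=> chart x; have [c [r [emb [p _ cp]]]] := chart (nu x).
have [U [j [s [oU embj [w _ <-]]]]] := finite_birational_chart emb cp.
apply/(nonsingular_at_transfer embj).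
have [rU embU] := open_embedding_val w oU.
apply/(nonsingular_at_transfer embU); exact: affine_nonsingular_at.
Qed.

End FiniteBirational.

(** * Grassmannians *)

Section GrassmannianCharts.
Variables (k : fieldType) (d r : nat).
Local Notation G := (grassmannian k d r).
Implicit Types (R : 'M[k]_(r, d)) (W : G).

Definition gspace (W : G) : {vspace 'rV[k]_r} := val (W : @subspaces k d r).

Lemma mem_row_space (M : 'M[k]_(d, r)) (w : 'rV[k]_r) :
  w \in row_space M <-> exists u, w = u *m M.
Proof.
split=> [/memv_imgP[u _ ->]|[u ->]]; first by exists u; rewrite lfunE.
by apply/memv_imgP; exists u; rewrite ?memvf // lfunE.
Qed.

Lemma grass_proj_surj W : exists x : subspace (@full_rank k d r), grass_proj x = W.
Proof.
have dW : \dim (gspace W) = d := set_valP W.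
pose b := vbasis (gspace W).
pose M : 'M[k]_(d, r) := \matrix_(i, j) (b`_i) 0 j.
have ME (u : 'rV[k]_d) : u *m M = \sum_(i < d) u 0 i *: b`_i.
  by apply/rowP => j; rewrite mxE summxE; apply: eq_bigr => i _; rewrite !mxE.
have frM : row_free M.
  apply: inj_row_free => u; rewrite ME => u0; apply/rowP => i; rewrite mxE.
  have /freeP := basis_free (vbasisP (gspace W)).
  move=> /(_ (fun i => u 0 (cast_ord dW i))) H.
  have := H _ (cast_ord (esym dW) i); rewrite cast_ordKV; apply.
  rewrite -[RHS]u0 (reindex (cast_ord dW)) //=.
  by exists (cast_ord (esym dW)) => j _; rewrite ?cast_ordK ?cast_ordKV.
have frx : full_rank (mxvec M) by rewrite /full_rank /= mxvecK.
exists (@exist _ (fun z => z \in @full_rank k d r) _ (mem_set frx)).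
apply: val_inj; apply/vspaceP => w; rewrite /= mxvecK.
apply/idP/idP => [/mem_row_space[u ->]|Ww].
  rewrite ME; apply: memv_suml => i _; apply: memvZ; apply: vbasis_mem.
  by apply: mem_nth; rewrite size_tuple dW.
apply/mem_row_space; exists (\row_i coord b (cast_ord (esym dW) i) w).
rewrite ME {1}(coord_vbasis Ww) (reindex (cast_ord dW)) /=.
  by apply: eq_bigr => i _; rewrite mxE cast_ordK.
by exists (cast_ord (esym dW)) => j _; rewrite ?cast_ordK ?cast_ordKV.
Qed.

(* The subspaces transverse to the kernel of w |-> w R. *)
Definition grass_chart R : set G :=
  [set W | forall w : 'rV[k]_r, w \in gspace W -> w *m R = 0 -> w = 0].

(* The basis of W which R maps to the standard basis; junk off the chart. *)
Definition grass_coord R W : 'M[k]_(d, r) :=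
  xget 0 [set N : 'M[k]_(d, r) | (forall u : 'rV_d, u *m N \in gspace W) /\ N *m R = 1%:M].

Lemma grass_chart_proj R (x : subspace (@full_rank k d r)) :
  grass_chart R (grass_proj x) <-> vec_mx (val x) *m R \in unitmx.
Proof.
have fr : row_free (vec_mx (val x) : 'M_(d, r)) := set_valP x.
split=> [H|ux w /mem_row_space[u ->]].
  rewrite -row_free_unit; apply: inj_row_free => u.
  rewrite mulmxA => /H; rewrite mem_row_space => H0.
  by apply: (row_free_inj fr); rewrite mul0mx; apply: H0; exists u.
by rewrite -mulmxA => /(congr1 (mulmx^~ (invmx (vec_mx (val x) *m R))));
  rewrite mulmxK // mul0mx => ->; rewrite mul0mx.
Qed.

Lemma grass_coord_uniq R W N : grass_chart R W ->
  (forall u : 'rV_d, u *m N \in gspace W) -> N *m R = 1%:M -> grass_coord R W = N.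
Proof.
move=> cW NW NR; rewrite /grass_coord; case: xgetP => [N' _ [N'W N'R]|/(_ N)];
  last by case.
apply/row_matrixP => i; rewrite !rowE; apply/eqP; rewrite -subr_eq0; apply/eqP.
apply: cW; first by rewrite rpredB.
by rewrite mulmxBl -!mulmxA N'R NR subrr.
Qed.

Lemma grass_coord_proj R (x : subspace (@full_rank k d r)) :
  vec_mx (val x) *m R \in unitmx ->
  grass_coord R (grass_proj x) =
    invmx (vec_mx (val x) *m R) *m vec_mx (val x).
Proof.
move=> ux; apply: grass_coord_uniq; first exact/grass_chart_proj.
- by move=> u; apply/mem_row_space; exists (u *m invmx (vec_mx (val x) *m R));
    rewrite mulmxA.
- by rewrite -mulmxA mulVmx.
Qed.

(** [R *m grass_coord R W] is the projection onto W along the kernel of R, so membership in W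
    becomes a system of equations with regular coefficients. *)
Lemma mem_grass_chart R W (w : 'rV[k]_r) : grass_chart R W ->
  w \in gspace W <-> w *m R *m grass_coord R W = w.
Proof.
have [x <-] := grass_proj_surj W; move=> /grass_chart_proj ux.
rewrite grass_coord_proj // mulmxA; split=> [/mem_row_space[u ->]|<-].
  by rewrite -[u *m _ *m R]mulmxA mulmxK.
by apply/mem_row_space; eexists.
Qed.

Lemma full_rank_entry (V : set (subspace (@full_rank k d r))) i j :
  is_open V -> is_regular V (fun x => (vec_mx (val x) : 'M_(d, r)) i j).
Proof.
move=> oV; have [_ H] := @regular_map_val k _ (@full_rank k d r).
have := regular_restrict oV (fun x _ => I) (H _ _ (regular_coord (mxvec_index i j))).
by apply: regular_ext => x _; rewrite /= mxE.
Qed.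

Lemma grass_chart_open R : is_open (grass_chart R).
Proof.
rewrite -[is_open _]/(is_open (@grass_proj k d r @^-1` grass_chart R)).
have oT := @open_setT k (subspace (@full_rank k d r)).
suff -> : @grass_proj k d r @^-1` grass_chart R =
    [set x | setT x /\ \det (vec_mx (val x) *m R) != 0].
  apply: open_regular_neq0; apply: regular_det => //.
  by apply: regular_mulmx => // i j; [exact: full_rank_entry | exact: regular_cst].
apply/seteqP; split=> x /=; rewrite grass_chart_proj unitmxE unitfE //.
by case.
Qed.

Lemma grass_coord_regular R i j :
  is_regular (grass_chart R) (fun W => grass_coord R W i j).
Proof.
have oR : is_open (@grass_proj k d r @^-1` grass_chart R) := @grass_chart_open R.
rewrite -[is_regular _ _]/(is_regular (@grass_proj k d r @^-1` grass_chart R)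
  ((fun W => grass_coord R W i j) \o @grass_proj k d r)).
apply: (regular_ext (f := fun x : subspace (@full_rank k d r) =>
  (invmx (vec_mx (val x) *m R) *m vec_mx (val x)) i j)) => [x /= cx|].
  by rewrite grass_coord_proj //; exact/grass_chart_proj.
apply: regular_mulmx => //; last by move=> *; exact: full_rank_entry.
apply: regular_invmx => //; last by move=> x /grass_chart_proj.
by apply: regular_mulmx => // *; [exact: full_rank_entry | exact: regular_cst].
Qed.

Lemma grass_chart_exists W : exists R, grass_chart R W.
Proof.
have [x <-] := grass_proj_surj W.
have /row_freeP[B xB] : row_free (vec_mx (val x) : 'M_(d, r)) := set_valP x.
by exists B; apply/grass_chart_proj; rewrite xB unitmx1.
Qed.

(** * Closed conditions on a varying subspace *)

Section Closed.
Variables (S : fspace k) (Ws : S -> G).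
Hypothesis rWs : regular_map Ws.

Let oWs R : is_open (Ws @^-1` grass_chart R).
Proof. by apply: rWs.1; exact: grass_chart_open. Qed.

Let Ws_coord R i j :
  is_regular (Ws @^-1` grass_chart R) (fun s => grass_coord R (Ws s) i j).
Proof. exact: rWs.2 (@grass_coord_regular R i j). Qed.

Lemma closed_mem (w : S -> 'rV[k]_r) :
  (forall j, is_regular setT (fun s => w s 0 j)) ->
  is_closed [set s | w s \in gspace (Ws s)].
Proof.
move=> rw; apply: open_local => s0 nw; have [R cR] := grass_chart_exists (Ws s0).
pose f s := w s *m R *m grass_coord R (Ws s).
have rw' i j : is_regular (Ws @^-1` grass_chart R) (fun s => w s i j).
  by rewrite ord1; apply: regular_restrict (rw j).
have rf i j : is_regular (Ws @^-1` grass_chart R) (fun s => f s i j).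
  apply: regular_mulmx => //.
  by apply: regular_mulmx => // *; exact: regular_cst.
have [j fj] : exists j, f s0 0 j - w s0 0 j != 0.
  apply: contrapT => H; apply: nw; apply/(mem_grass_chart _ cR)/rowP => j.
  by apply/eqP; rewrite -subr_eq0; apply/negPn/negP => Hj; apply: H; exists j.
exists [set s | (Ws @^-1` grass_chart R) s /\ f s 0 j - w s 0 j != 0]; split=> //.
  by apply: open_regular_neq0; apply: regular_sub.
move=> s [cs fs] /(mem_grass_chart _ cs) fE; move: fs.
by rewrite /f fE subrr eqxx.
Qed.

(* The condition says that a matrix with entries regular on the charts is not
   injective. *)
Lemma closed_degenerate a l (psi : 'I_a -> 'I_l -> 'rV[k]_r) :
  is_closed [set s | exists2 u : 'rV[k]_a, u != 0 &
    forall b, \sum_i u 0 i *: psi i b \in gspace (Ws s)].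
Proof.
apply: open_local => s0 nd; have [R cR] := grass_chart_exists (Ws s0).
(* The complementary projection, with kernel W: a row u lies in the kernel of [Phi s] exactly when
   all its combinations of the [psi i b] lie in W. *)
pose Q s := 1%:M - R *m grass_coord R (Ws s).
pose Phi s : 'M[k]_(a, l * r) := \matrix_i mxvec (\matrix_b (psi i b *m Q s)).
have PhiP s (u : 'rV[k]_a) : grass_chart R (Ws s) ->
    (u *m Phi s = 0 <-> forall b, \sum_i u 0 i *: psi i b \in gspace (Ws s)).
  move=> cs; have PhiE b c : (u *m Phi s) 0 (mxvec_index b c) =
      ((\sum_i u 0 i *: psi i b) *m Q s) 0 c.
    rewrite mxE mulmx_suml summxE; apply: eq_bigr => i _.
    rewrite -scalemxAl [RHS]mxE [Phi s i _]mxE mxvecE [in LHS]mxE.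
    by [].
  split=> [u0 b|H].
    have /eqP : (\sum_i u 0 i *: psi i b) *m Q s = 0.
      by apply/rowP => c; rewrite -PhiE u0 !mxE.
    rewrite mulmxBr mulmx1 mulmxA subr_eq0 => /eqP e.
    exact/(mem_grass_chart _ cs)/esym.
  apply/rowP => j; case/mxvec_indexP: j => b c; rewrite PhiE.
  rewrite mulmxBr mulmx1 mulmxA (mem_grass_chart _ cs).1 // subrr.
  by rewrite !mxE.
have rPhi i j : is_regular (Ws @^-1` grass_chart R) (fun s => Phi s i j).
  case/mxvec_indexP: j => b c.
  apply: (regular_ext (f := fun s => (psi i b *m Q s) 0 c)).
    by move=> s _; rewrite [RHS]mxE mxvecE [RHS]mxE.
  apply: regular_mulmx => // i' j'; first exact: regular_cst.
  apply: (regular_ext (f := fun s => (1%:M : 'M_r) i' j' -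
      (R *m grass_coord R (Ws s)) i' j')) => [s _|].
    by rewrite [RHS]mxE [X in _ = _ + X]mxE.
  apply: regular_sub; first exact: regular_cst.
  by apply: regular_mulmx => // *; exact: regular_cst.
(* A right inverse of [Phi] at s0 turns injectivity nearby into the nonvanishing of one
   determinant. *)
have /row_freeP[B PB] : row_free (Phi s0).
  apply: inj_row_free => u /(PhiP s0 u cR) Hu; apply: contrapT => /eqP u0.
  by apply: nd; exists u.
exists [set s | (Ws @^-1` grass_chart R) s /\ \det (Phi s *m B) != 0]; split.
- apply: open_regular_neq0; apply: regular_det => //.
  by apply: regular_mulmx => // *; exact: regular_cst.
- by split=> //; rewrite PB det1 oner_neq0.
- move=> s [cs dB] [u u0 /(PhiP s u cs) Hu]; case/eqP: u0.
  have uB : Phi s *m B \in unitmx by rewrite unitmxE unitfE.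
  by rewrite -(mulmxK uB u) mulmxA Hu !mul0mx.
Qed.

End Closed.

End GrassmannianCharts.

(** * Matrices of rank one *)

Section Polynomials.
Variables (k : closedFieldType) (r : nat).

Lemma meval_closed (S : Type) s (P : {mpoly k[s]}) (F : (S -> k) -> Prop)
    (g : 'I_s -> S -> k) :
  (forall c, F (fun=> c)) -> (forall f h, F f -> F h -> F (fun x => f x + h x)) ->
  (forall f h, F f -> F h -> F (fun x => f x * h x)) -> (forall i, F (g i)) ->
  F (fun x => P.@[fun i => g i x]).
Proof.
move=> FC FD FM Fg; elim/mpoly_ring_ind: P => [c|i|p q Fp Fq|p q Fp Fq].
- by under eq_fun do rewrite mevalC.
- by under eq_fun do rewrite mevalXU.
- by under eq_fun do rewrite mevalD; exact: FD.
- by under eq_fun do rewrite mevalM; exact: FM.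
Qed.

Definition polynomial_map (f : 'rV[k]_r -> k) := exists p, f = ev p.

Lemma polynomial_cst c : polynomial_map (fun=> c).
Proof. by exists c%:MP; apply/funext => x; rewrite /ev mevalC. Qed.

Lemma polynomial_coord i : polynomial_map (fun x => x 0 i).
Proof. by exists 'X_i; apply/funext => x; rewrite /ev mevalXU. Qed.

Lemma polynomial_add f g : polynomial_map f -> polynomial_map g ->
  polynomial_map (fun x => f x + g x).
Proof.
by move=> [p ->] [q ->]; exists (p + q); apply/funext => x; rewrite /ev mevalD.
Qed.

Lemma polynomial_mul f g : polynomial_map f -> polynomial_map g ->
  polynomial_map (fun x => f x * g x).
Proof.
by move=> [p ->] [q ->]; exists (p * q); apply/funext => x; rewrite /ev mevalM.
Qed.

Lemma polynomial_sum (I : Type) (s : seq I) (g : I -> 'rV[k]_r -> k) :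
  (forall i, polynomial_map (g i)) -> polynomial_map (fun x => \sum_(i <- s) g i x).
Proof.
move=> pg; elim: s => [|i s IH].
  by under eq_fun do rewrite big_nil; exact: polynomial_cst.
by under eq_fun do rewrite big_cons; exact: polynomial_add.
Qed.

Lemma polynomial_meval s (P : {mpoly k[s]}) (g : 'I_s -> 'rV[k]_r -> k) :
  (forall i, polynomial_map (g i)) -> polynomial_map (fun x => P.@[fun i => g i x]).
Proof.
apply: meval_closed; [exact: polynomial_cst | exact: polynomial_add
  | exact: polynomial_mul].
Qed.

Lemma polynomial_regular f : polynomial_map f ->
  @is_regular k (affine_space k r) setT f.
Proof. by move=> [p ->]; exact: ev_regular. Qed.

Lemma mderivXU (i j : 'I_r) : ('X_i : {mpoly k[r]})^`M(j) = (i == j)%:R.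
Proof.
rewrite mderivX mnm1E; have [->|_] := eqVneq; last by rewrite scale0r.
rewrite scale1r -mpolyX0; congr 'X_[_].
by apply/mnmP => l; rewrite mnmBE subnn mnm0E.
Qed.

Lemma meval_curve (p : {mpoly k[r]}) (q : 'I_r -> {poly k}) : exists h : {poly k},
  forall s, p.@[fun i => (q i).[s]] = h.[s] /\
    h^`().[s] = \sum_i p^`M(i).@[fun i => (q i).[s]] * (q i)^`().[s].
Proof.
elim/mpoly_ring_ind: p => [c|i|p p' [h Hh] [h' Hh']|p p' [h Hh] [h' Hh']].
- exists c%:P => s; rewrite mevalC hornerC derivC horner0; split=> //.
  by rewrite big1 // => i _; rewrite mderivC meval0 mul0r.
- exists (q i) => s; rewrite mevalXU; split=> //.
  rewrite (bigD1 i) //= big1 => [|j ji].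
    by rewrite mderivXU eqxx meval1 mul1r addr0.
  by rewrite mderivXU eq_sym (negPf ji) meval0 mul0r.
- exists (h + h') => s; have [e d] := Hh s; have [e' d'] := Hh' s.
  rewrite mevalD hornerD e e'; split=> //.
  rewrite derivD hornerD d d' -big_split; apply: eq_bigr => i _.
  by rewrite mderivD mevalD mulrDl.
- exists (h * h') => s; have [e d] := Hh s; have [e' d'] := Hh' s.
  rewrite mevalM hornerM e e'; split=> //.
  rewrite derivM hornerD !hornerM d d' -e -e' mulr_suml mulr_sumr -big_split.
  by apply: eq_bigr => i _; rewrite mderivM mevalD !mevalM /=; ring.
Qed.

End Polynomials.

(** * Rank-one factorization and frames *)

Section RankOne.
Variable k : fieldType.

Definition outer m n (u : 'rV[k]_m) (v : 'rV[k]_n) : 'rV[k]_(m * n) :=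
  mxvec (u^T *m v).

Lemma outerE m n (u : 'rV[k]_m) (v : 'rV[k]_n) i j :
  outer u v 0 (mxvec_index i j) = u 0 i * v 0 j.
Proof. by rewrite /outer mxvecE mxE big_ord1 mxE. Qed.

Lemma det_mx22 (R : comNzRingType) (A : 'M[R]_2) :
  \det A = A 0 0 * A 1 1 - A 0 1 * A 1 0.
Proof.
rewrite (expand_det_row _ 0) !big_ord_recl big_ord0 addr0 /cofactor !det_mx11.
rewrite !mxE /= expr0 expr1 mul1r mulN1r mulrN.
by congr (_ * A _ _ - A _ _ * A _ _); apply: val_inj.
Qed.

(** The minors come with increasing row and column indices; the other relations follow by exchanging
    rows or columns, or are trivial when indices coincide. *)
Lemma determinantal_minors m n (x : 'rV[k]_(m * n)) :
  determinantal_variety (m := m) (n := n) 2 x <->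
  forall a b c d, vec_mx x a b * vec_mx x c d = vec_mx x a d * vec_mx x c b.
Proof.
have detE (f : 'I_2 -> 'I_m) (g : 'I_2 -> 'I_n) :
    (\det (mxsub f g (generic_matrix k m n))).@[fun i => x 0 i] =
    vec_mx x (f 0) (g 0) * vec_mx x (f 1) (g 1) -
    vec_mx x (f 0) (g 1) * vec_mx x (f 1) (g 0).
  by rewrite det_mx22 !mxE mevalB !mevalM !mevalXU.
split=> [Hx|H p Ip].
  have core (a c : 'I_m) (b d : 'I_n) : (a < c)%N -> (b < d)%N ->
      vec_mx x a b * vec_mx x c d = vec_mx x a d * vec_mx x c b.
    move=> ac bd; apply/eqP; rewrite -subr_eq0; apply/eqP.
    pose f (i : 'I_2) := if i == 0 then a else c.
    pose g (i : 'I_2) := if i == 0 then b else d.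
    rewrite -(detE f g); apply: Hx => I [iI sI]; apply: sI.
    by exists f, g; split=> // -[[|[|i]] i2] // [[|[|j]] j2].
  move=> a b c d; case: (ltngtP a c) => [ac|ca|/val_inj ->]; last by rewrite mulrC.
    case: (ltngtP b d) => [bd|db|/val_inj -> //]; first exact: core.
    by rewrite -core.
  case: (ltngtP b d) => [bd|db|/val_inj -> //].
    by rewrite mulrC [RHS]mulrC -core.
  by rewrite mulrC [RHS]mulrC core.
pose I : set {mpoly k[m * n]} := [set p | p.@[fun i => x 0 i] = 0].
have sub : smallest (@is_ideal k m n) (@minors k m n 2) `<=` I.
  move=> q; apply; split; [split|].
  - by rewrite /I /= meval0.
  - by move=> q1 q2; rewrite /I /= mevalD => -> ->; rewrite addr0.
  - by move=> a q1; rewrite /I /= mevalM => ->; rewrite mulr0.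
  - by move=> _ [f [g [_ _ ->]]]; rewrite /I /= detE H subrr.
exact: sub.
Qed.

Lemma determinantal_rank1 m n (x : 'rV[k]_(m.+1 * n.+1)) :
  determinantal_variety (m := m.+1) (n := n.+1) 2 x <->
  exists u v, x = outer u v.
Proof.
rewrite determinantal_minors; split=> [H|[u [v ->]] a b c d]; last first.
  by rewrite /outer mxvecK !mxE !big_ord1 !mxE mulrACA [RHS]mulrACA [v 0 b * _]mulrC.
have [->|/rV0Pn[j xj]] := eqVneq x 0.
  exists 0, 0; apply/rowP => j; case/mxvec_indexP: j => a b.
  by rewrite outerE !mxE mul0r.
case/mxvec_indexP: j xj => a b xab; have {}xab : vec_mx x a b != 0 by rewrite mxE.
exists (\row_c (vec_mx x c b / vec_mx x a b)), (\row_d vec_mx x a d).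
apply/rowP => j; case/mxvec_indexP: j => c d; rewrite outerE !mxE.
have := H a b c d; rewrite !mxE => e; rewrite mxE in xab.
by apply: (mulfI xab); rewrite e mulrCA; field.
Qed.

(* u is the first row of an invertible matrix with remaining rows K, whose
   inverse has columns la and L. *)
Definition frame m (u : 'rV[k]_m.+1) (la : 'cV[k]_m.+1) (K : 'M[k]_(m, m.+1))
    (L : 'M[k]_(m.+1, m)) :=
  [/\ u *m la = 1%:M, K *m la = 0, u *m L = 0, K *m L = 1%:M &
      la *m u + L *m K = 1%:M].

Lemma frame_exists m (u : 'rV[k]_m.+1) : u != 0 -> exists la K L, frame u la K L.
Proof.
move=> u0; have ru : \rank u = 1%N by rewrite rank_rV u0.
pose E : 'M[k]_(1 + m) := row_ebase u; pose C := col_ebase u.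
(* As u has rank one, it is the unit [C] times the first row of the invertible [E]; the remaining
   rows of [E] complete it to a basis. *)
pose g := block_mx C 0 0 1%:M *m E.
have uE : u = C *m usubmx E.
  rewrite -[LHS](mulmx_ebase u) ru -mulmxA; congr (_ *m _).
  have pE (B : 'M[k]_(1 + m)) : (pid_mx 1 : 'M_(1, 1 + m)) *m B = usubmx B.
    by rewrite pid_mx_row -[B in LHS]vsubmxK mul_row_col mul1mx mul0mx addr0.
  exact: pE.
pose K : 'M[k]_(m, 1 + m) := dsubmx E.
have gE : g = col_mx u K.
  by rewrite /g -[E in LHS]vsubmxK mul_block_col !mul0mx addr0 add0r mul1mx -uE.
have ug : g \in unitmx.
  rewrite unitmx_mul row_ebase_unit andbT unitmxE det_ublock det1 mulr1.
  by rewrite -unitmxE col_ebase_unit.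
pose la := lsubmx (invmx g); pose L := rsubmx (invmx g).
have giE : invmx g = row_mx la L by rewrite hsubmxK.
have := mulmxV ug; rewrite giE gE mul_col_row (@scalar_mx_block _ 1 m).
case/eq_block_mx => ula uL Kla KL.
have := mulVmx ug; rewrite giE gE mul_row_col => sum.
by exists la, K, L.
Qed.

End RankOne.

(** * Charts of the nonzero part of X *)

Section RankOneCharts.
Variables (k : closedFieldType) (m n : nat).
Variables (u0 : 'rV[k]_m.+1) (la : 'cV[k]_m.+1) (K : 'M[k]_(m, m.+1)) (L : 'M[k]_(m.+1, m)).
Variables (v0 : 'rV[k]_n.+1) (mu : 'cV[k]_n.+1) (K' : 'M[k]_(n, n.+1)) (L' : 'M[k]_(n.+1, n)).
Hypotheses (fu : frame u0 la K L) (fv : frame v0 mu K' L').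
Local Notation D := (n.+1 + m)%N.
Local Notation A := (affine_space k D).
Local Notation X := (@determinantal_variety k m.+1 n.+1 2).
Implicit Types p : 'rV[k]_D.

(* Coordinates (t, b, a) on k^(1 + n + m), parametrizing the matrices
   t (u0 + a K) (x) (v0 + b K'). *)
Definition par_t p : k := p 0 (lshift m ord0).
Definition par_u p : 'rV[k]_m.+1 := u0 + rsubmx p *m K.
Definition par_v p : 'rV[k]_n.+1 :=
  v0 + (\row_j p 0 (lshift m (lift ord0 j))) *m K'.
Definition par p : 'rV[k]_(m.+1 * n.+1) := outer (par_t p *: par_u p) (par_v p).

(** When u la = 1, the frame identity la u0 + L K = 1 gives u = u0 + (u L) K, so u L are the
    coordinates of u; similarly v L' for v. *)
Definition par_mk (t : k) (u : 'rV[k]_m.+1) (v : 'rV[k]_n.+1) : 'rV[k]_D :=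
  row_mx (row_mx t%:M (v *m L') : 'rV_(1 + n)) (u *m L).

Lemma par_t_mk t u v : par_t (par_mk t u v) = t.
Proof.
rewrite /par_t row_mxEl; transitivity
  ((row_mx t%:M (v *m L') : 'rV_(1 + n)) 0 (lshift n 0)).
  by congr (_ _ _); apply: val_inj.
by rewrite row_mxEl mxE eqxx.
Qed.

Lemma par_u_mk t u v : u *m la = 1%:M -> par_u (par_mk t u v) = u.
Proof.
move=> ula; rewrite /par_u row_mxKr -mulmxA -{1}[u0]mul1mx -ula -mulmxA -mulmxDr.
by have [_ _ _ _ ->] := fu; rewrite mulmx1.
Qed.

Lemma par_v_mk t u v : v *m mu = 1%:M -> par_v (par_mk t u v) = v.
Proof.
move=> vmu; rewrite /par_v (_ : \row_j _ = v *m L'); last first.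
  apply/rowP => j; rewrite mxE row_mxEl; transitivity
    ((row_mx t%:M (v *m L') : 'rV_(1 + n)) 0 (rshift 1 j)).
    by congr (_ _ _); apply: val_inj.
  by rewrite row_mxEr.
rewrite -mulmxA -{1}[v0]mul1mx -vmu -mulmxA -mulmxDr.
by have [_ _ _ _ ->] := fv; rewrite mulmx1.
Qed.

Lemma par_u_la p : par_u p *m la = 1%:M.
Proof. by have [h1 h2 _ _ _] := fu; rewrite mulmxDl h1 -mulmxA h2 mulmx0 addr0. Qed.

Lemma par_u_L p : par_u p *m L = rsubmx p.
Proof.
by have [_ _ h3 h4 _] := fu; rewrite mulmxDl h3 -mulmxA h4 mulmx1 add0r.
Qed.

Lemma par_v_mu p : par_v p *m mu = 1%:M.
Proof. by have [h1 h2 _ _ _] := fv; rewrite mulmxDl h1 -mulmxA h2 mulmx0 addr0. Qed.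

Lemma par_mkK p : par_mk (par_t p) (par_u p) (par_v p) = p.
Proof.
have [_ _ h3 h4 _] := fv.
rewrite /par_mk par_u_L mulmxDl h3 -mulmxA h4 mulmx1 add0r -[RHS]hsubmxK.
congr (row_mx _ _); apply: etrans (hsubmxK (lsubmx p : 'rV_(1 + n))).
congr (row_mx _ _).
  by apply/rowP => i; rewrite !ord1 !mxE /= /par_t; congr (p _ _); apply: val_inj.
by apply/rowP => i; rewrite !mxE; congr (p _ _); apply: val_inj.
Qed.

Lemma par_t_polynomial : polynomial_map par_t.
Proof. exact: polynomial_coord. Qed.

Lemma par_u_polynomial i : polynomial_map (fun p => par_u p 0 i).
Proof.
under eq_fun do rewrite !mxE; apply: polynomial_add; first exact: polynomial_cst.
apply: polynomial_sum => j; apply: polynomial_mul; last exact: polynomial_cst.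
by under eq_fun do rewrite mxE; exact: polynomial_coord.
Qed.

Lemma par_v_polynomial i : polynomial_map (fun p => par_v p 0 i).
Proof.
under eq_fun do rewrite !mxE; apply: polynomial_add; first exact: polynomial_cst.
apply: polynomial_sum => j; apply: polynomial_mul; last exact: polynomial_cst.
by under eq_fun do rewrite mxE; exact: polynomial_coord.
Qed.

Lemma par_polynomial i : polynomial_map (fun p => par p 0 i).
Proof.
case/mxvec_indexP: i => a b; under eq_fun do rewrite outerE mxE.
apply: polynomial_mul; last exact: par_v_polynomial.
by apply: polynomial_mul; [exact: par_t_polynomial | exact: par_u_polynomial].
Qed.

Lemma par_determinantal p : X (par p).
Proof. by apply/determinantal_rank1; exists (par_t p *: par_u p), (par_v p). Qed.

Lemma par_mkE t u v : u *m la = 1%:M -> v *m mu = 1%:M ->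
  par (par_mk t u v) = outer (t *: u) v.
Proof. by move=> ul vm; rewrite /par par_t_mk par_u_mk // par_v_mk. Qed.

Definition Xpoint (x : 'rV[k]_(m.+1 * n.+1)) (Xx : X x) : subspace X :=
  @exist _ (fun z => z \in X) x (mem_set Xx).

Definition Xpar p : subspace X := Xpoint (par_determinantal p).

Lemma regular_Xpar : @regular_map k A (subspace X) Xpar.
Proof.
apply: regular_map_subspace; apply: regular_map_affine => i.
exact: polynomial_regular (par_polynomial i).
Qed.

Definition Xmat (x : subspace X) : 'M[k]_(m.+1, n.+1) := vec_mx (val x).

Lemma regular_Xmat i j : is_regular setT (fun x => Xmat x i j).
Proof.
have [_ H] := @regular_map_val k _ X.
by apply: (regular_ext _ (H _ _ (regular_coord (mxvec_index i j)))) => x _;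
  rewrite /Xmat mxE.
Qed.

Definition Xt (x : subspace X) : k := (la^T *m Xmat x *m mu) 0 0.

Lemma Xt_outer x (u : 'rV[k]_m.+1) (v : 'rV[k]_n.+1) : val x = outer u v ->
  Xt x = (u *m la) 0 0 * (v *m mu) 0 0.
Proof.
move=> xE; rewrite /Xt /Xmat xE /outer mxvecK -!mulmxA mulmxA -trmx_mul.
rewrite [u *m la]mx11_scalar [v *m mu]mx11_scalar tr_scalar_mx -scalar_mxM.
by rewrite !mxE eqxx !mulr1n.
Qed.

Lemma Xt_par p : Xt (Xpar p) = par_t p.
Proof.
rewrite (@Xt_outer (Xpar p) (par_t p *: par_u p) (par_v p)) //.
by rewrite par_v_mu -scalemxAl par_u_la !mxE !mulr1.
Qed.
(** For x = u (x) v, the column x mu is proportional to u and the row la^T x to v; dividing by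
    [Xt x] = (u la)(v mu) normalizes both. *)
Definition Xinv (x : subspace X) : 'rV[k]_D :=
  par_mk (Xt x) ((Xt x)^-1 *: (Xmat x *m mu)^T) ((Xt x)^-1 *: (la^T *m Xmat x)).

Lemma XinvK x : Xt x != 0 -> Xpar (Xinv x) = x.
Proof.
move=> tx; apply: val_inj; rewrite /= par_mkE.
- have /determinantal_rank1[u [v xE]] := set_valP x.
  have ME : Xmat x = u^T *m v by rewrite /Xmat xE /outer mxvecK.
  have tE := Xt_outer xE.
  rewrite xE scalerA divff // scale1r ME /outer; congr mxvec.
  have -> : u^T *m v *m mu = (v *m mu) 0 0 *: u^T.
    by rewrite -mulmxA {1}[v *m mu]mx11_scalar mul_mx_scalar.
  have -> : la^T *m (u^T *m v) = (u *m la) 0 0 *: v.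
    by rewrite mulmxA -trmx_mul {1}[u *m la]mx11_scalar tr_scalar_mx mul_scalar_mx.
  rewrite trmxK -scalemxAl -!scalemxAr !scalerA.
  by rewrite mulrCA [X in _^-1 * X]mulrC -tE mulVf // scale1r.
- rewrite -scalemxAl; apply/matrixP => i j.
  rewrite !ord1 mxE -[la in X in _ * X]trmxK -trmx_mul mulmxA [X in _ * X]mxE.
  by rewrite mulVf // mxE eqxx mulr1n.
- rewrite -scalemxAl; apply/matrixP => i j; rewrite !ord1 mxE [RHS]mxE eqxx mulr1n.
  by rewrite mulVf.
Qed.

Lemma XparK p : par_t p != 0 -> Xinv (Xpar p) = p.
Proof.
move=> tp; rewrite /Xinv Xt_par -[RHS]par_mkK.
have -> : Xmat (Xpar p) = par_t p *: ((par_u p)^T *m par_v p).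
  by rewrite /Xmat /= /par /outer mxvecK linearZ /= -scalemxAl.
rewrite -scalemxAl -mulmxA par_v_mu mulmx1 linearZ /= trmxK -scalemxAr mulmxA.
by rewrite -trmx_mul par_u_la trmx1 mul1mx !scalerA mulVf // !scale1r.
Qed.

Lemma Xt_regular : is_regular setT Xt.
Proof.
have oT := @open_setT k (subspace X).
apply: regular_mulmx => // *; last exact: regular_cst.
apply: regular_mulmx => // *; first exact: regular_cst.
exact: regular_Xmat.
Qed.

Lemma par_mk_regular (S : fspace k) (V : set S) (t : S -> k)
    (u : S -> 'rV[k]_m.+1) (v : S -> 'rV[k]_n.+1) :
  is_regular V t -> (forall i, is_regular V (fun x => u x 0 i)) ->
  (forall i, is_regular V (fun x => v x 0 i)) ->
  @regular_on k S A V (fun x => par_mk (t x) (u x) (v x)).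
Proof.
move=> rt ru rv; have oV := regular_open rt.
apply: regular_on_affine => // i; rewrite /par_mk; case: (splitP i) => j ij.
- have -> : i = lshift m j by exact: val_inj.
  rewrite -[j]/(j : 'I_(1 + n)); case: (splitP (j : 'I_(1 + n))) => l jl.
  + have -> : j = lshift n l by exact: val_inj.
    apply: regular_ext rt => x _; rewrite row_mxEl.
    by rewrite [RHS](row_mxEl (_ : 'rV_1)) ord1 mxE eqxx.
  + have -> : j = rshift 1 l by exact: val_inj.
    apply: (regular_ext (f := fun x => (v x *m L') 0 l)).
      by move=> x _; rewrite row_mxEl [RHS](row_mxEr (_ : 'rV_1)).
    apply: regular_mulmx => // [i' j'|*]; last exact: regular_cst.
    by rewrite ord1.
- have -> : i = rshift n.+1 j by exact: val_inj.
  apply: (regular_ext (f := fun x => (u x *m L) 0 j)).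
    by move=> x _; rewrite row_mxEr.
  apply: regular_mulmx => // [i' j'|*]; last exact: regular_cst.
  by rewrite ord1.
Qed.

Lemma Xinv_regular :
  @regular_on k (subspace X) A [set x | setT x /\ Xt x != 0] Xinv.
Proof.
have oV := open_regular_neq0 Xt_regular.
set V := [set x | _] in oV *.
have rV f : is_regular setT f -> is_regular V f by exact: regular_restrict.
have rM i j : is_regular V (fun x => Xmat x i j) by exact/rV/regular_Xmat.
have riT : is_regular V (fun x => (Xt x)^-1) by exact: regular_inv Xt_regular.
apply: par_mk_regular => [|i|i]; first exact: rV Xt_regular.
- apply: (regular_ext (f := fun x => (Xt x)^-1 * (Xmat x *m mu) i 0)).
    by move=> x _; rewrite [RHS]mxE [X in _ = _ * X]mxE.
  by apply: regular_mul => //; apply: regular_mulmx => // *; exact: regular_cst.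
- apply: (regular_ext (f := fun x => (Xt x)^-1 * (la^T *m Xmat x) 0 i)).
    by move=> x _; rewrite [RHS]mxE.
  by apply: regular_mul => //; apply: regular_mulmx => // *; exact: regular_cst.
Qed.

(** [Xpar] contracts t = 0 to the origin, so only its restriction to t != 0 is an open embedding. *)
Lemma Xpar_chart x : Xt x != 0 ->
  exists (j : subspace [set p : A | setT p /\ par_t p != 0] -> subspace X) r w,
    [/\ is_open [set p : A | setT p /\ par_t p != 0], open_embedding j r &  j w = x].
Proof.
move=> tx.
have oU : is_open [set p : A | setT p /\ par_t p != 0].
  exact: open_regular_neq0 (polynomial_regular par_t_polynomial).
set U := [set p | _] in oU *.
have UE y : Xt y != 0 -> U (Xinv y) by rewrite /U /= /Xinv par_t_mk.
pose w : subspace U := @exist _ (fun z => z \in U) (Xinv x) (mem_set (UE x tx)).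
have [rU embU] := open_embedding_val w oU.
have [[rv1 rv2] vK vo vf] := embU.
have rUK p : U p -> val (rU p) = p.
  move=> Up; exact: (congr1 val (vK (@exist _ (fun z => z \in U) p (mem_set Up)))).
exists (fun p : subspace U => Xpar (val p)), (rU \o Xinv), w; split=> //; last exact: XinvK.
have oV := open_regular_neq0 Xt_regular.
apply: (@open_embeddingI _ _ _ _ _ [set x | setT x /\ Xt x != 0]) => //.
- exact: regular_map_comp (@regular_map_val k _ U) regular_Xpar.
- move=> p /=; rewrite -[RHS]vK; congr (rU _); apply: XparK.
  by have [] := set_valP p.
- by move=> p; split=> //; rewrite Xt_par; have [] := set_valP p.
- by move=> y [_ ty]; rewrite /= rUK ?XinvK //; exact: (UE y).
- have [r1 r2] := Xinv_regular.
  have pE Z : [set x | setT x /\ Xt x != 0] `&` (rU \o Xinv) @^-1` Z =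
      [set x | setT x /\ Xt x != 0] `&` Xinv @^-1` (val @` Z).
    apply/seteqP; split=> y [[_ ty] Zy]; split=> //.
      by exists (rU (Xinv y)) => //; apply: rUK; exact: (UE y).
    by case: Zy => z Zz zE; rewrite /= -zE vK.
  by split=> Z; [move=> oZ | move=> f rf]; rewrite pE;
    [exact/r1/vo | exact: r2 (vf _ _ rf)].
Qed.

End RankOneCharts.

(** * Nonsingular points, dimension and tangent spaces of X *)

Section Determinantal.
Variables (k : closedFieldType) (m n : nat).
Local Notation D := (n.+1 + m)%N.
Local Notation X := (@determinantal_variety k m.+1 n.+1 2).

(** The curve s |-> (u + s z) (x) (v + s w), which stays in X. *)
Definition outer_curve (u z : 'rV[k]_m.+1) (v w : 'rV[k]_n.+1)
    (j : 'I_(m.+1 * n.+1)) : {poly k} :=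
  mxvec (\matrix_(a, b) (((u 0 a)%:P + z 0 a *: 'X) * ((v 0 b)%:P + w 0 b *: 'X))) 0 j.

Lemma outer_curveE u z v w j s :
  (outer_curve u z v w j).[s] = outer (u + s *: z) (v + s *: w) 0 j.
Proof.
case/mxvec_indexP: j => a b; rewrite outerE /outer_curve mxvecE mxE hornerM !hornerD.
by rewrite !hornerC !hornerZ !hornerX !mxE [s * _]mulrC [s * _]mulrC.
Qed.

Lemma outer_curve_deriv u z v w j :
  (outer_curve u z v w j)^`().[0] = (outer u w + outer z v) 0 j.
Proof.
case/mxvec_indexP: j => a b; rewrite mxE !outerE /outer_curve mxvecE mxE derivM.
rewrite !derivD !derivC !derivZ !derivX !add0r hornerD !hornerM !hornerD.
by rewrite !hornerC !hornerZ !hornerC !hornerX; ring.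
Qed.

Lemma nonzero_frames (x : subspace X) : val x != 0 :> 'rV[k]_(m.+1 * n.+1) ->
  exists u la K L v mu K' L',
    [/\ frame u la K L, frame v mu K' L', val x = outer u v & Xt la mu x = 1].
Proof.
move=> x0; have /determinantal_rank1[u [v xE]] := set_valP x.
have u0 : u != 0.
  apply: contra_neq x0 => u0; rewrite xE u0.
  by apply/rowP => j; case/mxvec_indexP: j => a b; rewrite outerE !mxE mul0r.
have v0 : v != 0.
  apply: contra_neq x0 => v0; rewrite xE v0.
  by apply/rowP => j; case/mxvec_indexP: j => a b; rewrite outerE !mxE mulr0.
have [la [K [L fu]]] := frame_exists u0; have [mu [K' [L' fv]]] := frame_exists v0.
exists u, la, K, L, v, mu, K', L'; split=> //; rewrite (Xt_outer _ _ xE).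
by case: fu => -> _ _ _ _; case: fv => -> _ _ _ _; rewrite !mxE eqxx mulr1.
Qed.

Lemma local_chart (x : subspace X) : val x != 0 :> 'rV[k]_(m.+1 * n.+1) ->
  exists (U : set (affine_space k D)) (j : subspace U -> subspace X) r w,
    [/\ is_open U, open_embedding j r & j w = x].
Proof.
move=> /nonzero_frames[u [la [K [L [v [mu [K' [L' [fu fv _ tx]]]]]]]]].
have [|j [r [w [oU emb jw]]]] := Xpar_chart fu fv (x := x).
  by rewrite tx oner_neq0.
by eexists; exists j, r, w; split; first exact: oU.
Qed.

Lemma determinantal_nonsingular (x : subspace X) :
  val x != 0 :> 'rV[k]_(m.+1 * n.+1) -> nonsingular_at x.
Proof.
move=> /local_chart[U [j [r [w [oU emb <-]]]]].
apply/(nonsingular_at_transfer emb).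
have [rU embU] := open_embedding_val w oU.
by apply/(nonsingular_at_transfer embU); exact: affine_nonsingular_at.
Qed.

(** A chart at the all-ones matrix gives a chain of length D. Conversely, D + 1 polynomials on X
    become dependent after pulling back to the D parameters of [par], and the relation extends from
    the chart to all of X. *)
Lemma determinantal_dim : has_dim (subspace X) D.
Proof.
pose one s : 'rV[k]_s.+1 := const_mx 1.
have one0 s : one s != 0 by apply/rV0Pn; exists 0; rewrite mxE oner_neq0.
have Xo : X (outer (one m) (one n)).
  by apply/determinantal_rank1; exists (one m), (one n).
split.
  have [|U [j [r [w [oU emb jw]]]]] := @local_chart (Xpoint Xo).
    apply/rV0Pn; exists (mxvec_index 0 0).
    by rewrite outerE !mxE mulr1 oner_neq0.
  have [rU embU] := open_embedding_val w oU.
  have := (dim_at_transfer emb w D).1 ((dim_at_transfer embU w D).2 (affine_dim_at _)).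
  by case=> -[C [cC _]] _; exists C.
have [la [K [L fu]]] := frame_exists (one0 m).
have [mu [K' [L' fv]]] := frame_exists (one0 n).
pose Fc (f : subspace X -> k) := exists p, f = ev p \o val.
apply: (@chain_bound k _ Fc).
- move=> _ [p ->]; have [_ H] := @regular_map_val k _ X.
  exact: (H _ _ (ev_regular p)).
- move=> C y cC nCy; have [V [oV VE]] := subspace_open cC.
  have Vy : V (val y) by have : (~` C) y by []; rewrite VE.
  have [p [py H]] := affine_open oV Vy.
  exists (ev p \o val); split=> //; first by exists p.
  move=> z Cz; apply/eqP/negPn/negP => /H Vz.
  by have : (~` C) z by rewrite VE.
move=> g /choice[p gE].
have /choice[F FE] : forall i, exists q : {mpoly k[D]},
    (fun y => ev (p i) (par (one m) K (one n) K' y)) = ev q.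
  by move=> i; apply: polynomial_meval => j; exact: par_polynomial.
have [Q Q0 HQ] := mpoly_dependent F; exists Q => // x.
have [R RE] : polynomial_map (fun y => Q.@[fun i => ev (p i) y]).
  by apply: polynomial_meval => i; exists (p i).
have /determinantal_rank1[u [v xE]] := set_valP x.
have R0 u' v' : (u' *m la) 0 0 != 0 -> (v' *m mu) 0 0 != 0 -> ev R (outer u' v') = 0.
  move=> u'0 v'0.
  have Xy : X (outer u' v') by apply/determinantal_rank1; exists u', v'.
  have := XinvK fu fv (x := Xpoint Xy).
  rewrite (Xt_outer _ _ (erefl : val (Xpoint Xy) = outer u' v')) mulf_neq0 //.
  move=> /(_ isT)/(congr1 val) /= <-.
  rewrite -RE -[RHS](HQ (fun i => (Xinv la L mu L' (Xpoint Xy)) 0 i)).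
  apply: meval_eq => i; exact: (congr1 (@^~ _) (FE i)).
(* Moving along [one] leads into the chart: as one la = 1, the quantity (u + s one) la vanishes for
   a single s, and likewise for v. So the relation holds at almost all points of the curve, hence at
   s = 0. *)
have [h hE] := meval_curve R (outer_curve u (one m) v (one n)).
have hs s : h.[s] = ev R (outer (u + s *: one m) (v + s *: one n)).
  rewrite -(hE s).1 /ev; apply: meval_eq => i; exact: outer_curveE.
have [one_la _ _ _ _] := fu; have [one_mu _ _ _ _] := fv.
pose lu := 'X + ((u *m la) 0 0)%:P; pose lv := 'X + ((v *m mu) 0 0)%:P.
have : h * (lu * lv) = 0.
  apply: contrapT => /eqP/closed_nonrootP[s]; rewrite rootE !hornerM !hornerD.
  rewrite !hornerC !hornerX !mulf_eq0 !negb_or => /andP[h0 /andP[us vs]].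
  case/negP: h0; rewrite hs R0 // mulmxDl -scalemxAl ?one_la ?one_mu.
    by rewrite mxE [X in _ + X]mxE [X in _ + _ * X]mxE eqxx mulr1 addrC.
  by rewrite mxE [X in _ + X]mxE [X in _ + _ * X]mxE eqxx mulr1 addrC.
have X0 c : ('X + c%:P == 0 :> {poly k}) = false by rewrite -size_poly_eq0 size_XaddC.
move=> /eqP; rewrite !mulf_eq0 !X0 !orbF => /eqP h0.
have := hs 0; rewrite h0 horner0 !scale0r !addr0 -xE -RE => ->.
by apply: meval_eq => i; rewrite gE.
Qed.

(** One direction differentiates curves in X. For the other, the minors through a fixed nonzero
    entry (a, b) suffice: their differentials determine w from its row a and its column b. *)
Lemma tangent_determinantal (u : 'rV[k]_m.+1) (v : 'rV[k]_n.+1)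
    (w : 'rV[k]_(m.+1 * n.+1)) : u != 0 -> v != 0 ->
  (forall p : {mpoly k[m.+1 * n.+1]}, (forall y, X y -> p.@[fun i => y 0 i] = 0) ->
     \sum_i p^`M(i).@[fun j => outer u v 0 j] * w 0 i = 0) <->
  exists z l, w = outer u l + outer z v.
Proof.
move=> u0 v0; split=> [H|[z [l ->]] p Xp]; last first.
  have [h hE] := meval_curve p (outer_curve u z v l).
  have h0 : h = 0.
    apply: contrapT => /eqP/closed_nonrootP[s]; rewrite rootE -(hE s).1.
    rewrite (meval_eq _ (fun j => outer_curveE u z v l j s)) Xp ?eqxx //.
    by apply/determinantal_rank1; eexists; eexists.
  have [_] := hE 0; rewrite h0 deriv0 horner0 => e; rewrite [RHS]e.
  apply: eq_bigr => i _; rewrite outer_curve_deriv; congr (_ * _).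
  by apply: meval_eq => j; rewrite outer_curveE !scale0r !addr0.
have [a ua] := rV0Pn _ u0; have [b vb] := rV0Pn _ v0.
pose W := vec_mx w : 'M_(m.+1, n.+1).
have rel c d : u 0 a * v 0 b * W c d + W a b * (u 0 c * v 0 d) =
    u 0 a * v 0 d * W c b + W a d * (u 0 c * v 0 b).
  pose p : {mpoly k[m.+1 * n.+1]} := 'X_(mxvec_index a b) * 'X_(mxvec_index c d) -
    'X_(mxvec_index a d) * 'X_(mxvec_index c b).
  have Xp y : X y -> p.@[fun i => y 0 i] = 0.
    move=> /determinantal_minors/(_ a b c d); rewrite !mxE => e.
    by rewrite mevalB !mevalM !mevalXU e subrr.
  have sumX i (f : 'I_(m.+1 * n.+1) -> k) : \sum_j (i == j)%:R * f j = f i.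
    rewrite (bigD1 i) //= eqxx mul1r big1 ?addr0 // => j.
    by rewrite eq_sym => /negPf ->; rewrite mul0r.
  pose x := outer u v 0.
  have pE j : p^`M(j).@[fun j => x j] * w 0 j =
      (mxvec_index a b == j)%:R * (x (mxvec_index c d) * w 0 j) +
      (mxvec_index c d == j)%:R * (x (mxvec_index a b) * w 0 j) -
      ((mxvec_index a d == j)%:R * (x (mxvec_index c b) * w 0 j) +
      (mxvec_index c b == j)%:R * (x (mxvec_index a d) * w 0 j)).
    rewrite /p mderivB !mderivM !mderivXU mevalB !mevalD !mevalM !mevalXU.
    have mb (e : bool) : e%:R.@[fun j => x j] = e%:R :> k.
      by case: e; rewrite ?meval1 ?meval0.
    by rewrite !mb; ring.
  have := H p Xp; under eq_bigr do rewrite pE.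
  rewrite sumrB !big_split /= !sumX /x !outerE => /eqP.
  rewrite subr_eq0 => /eqP e; rewrite /W !mxE.
  by rewrite [LHS]addrC [X in X + _ = _]mulrC e [RHS]addrC [X in _ = X + _]mulrC.
(* l matches row a and z matches column b; the correction in z avoids counting their common entry
   (a, b) twice. *)
exists (\row_c (W c b / v 0 b - W a b * u 0 c / (u 0 a * v 0 b))), (\row_d (W a d / u 0 a)).
apply/rowP => j; case/mxvec_indexP: j => c d; rewrite !mxE !outerE !mxE.
have uv0 : u 0 a * v 0 b != 0 by rewrite mulf_neq0.
apply: (mulfI uv0); move/(canRL (addrK _)): (rel c d); rewrite /W !mxE => ->.
by field; rewrite ua vb.
Qed.

End Determinantal.

(** * The Nash blowup *)

Section NashCharts.
Variables (k : closedFieldType) (m n : nat).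
Local Notation D := (n.+1 + m)%N.
Local Notation r := (m.+1 * n.+1)%N.
Local Notation A := (affine_space k D).
Local Notation X := (@determinantal_variety k m.+1 n.+1 2).
Local Notation G := (grassmannian k D r).
Local Notation XG := (product_space (subspace X) G).

(* W is the tangent space of X at the nonzero multiples of outer u v. *)
Definition is_tangent (u : 'rV[k]_m.+1) (v : 'rV[k]_n.+1) (W : {vspace 'rV[k]_r}) :=
  forall w : 'rV[k]_r, w \in W <-> exists z l, w = outer u l + outer z v.

Lemma outer_scale a b (u : 'rV[k]_m.+1) (v : 'rV[k]_n.+1) :
  outer (a *: u) (b *: v) = (a * b) *: outer u v.
Proof.
by apply/rowP => j; case/mxvec_indexP: j => i j; rewrite mxE !outerE !mxE mulrACA.
Qed.

Lemma outerDl (u u' : 'rV[k]_m.+1) (v : 'rV[k]_n.+1) :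
  outer (u + u') v = outer u v + outer u' v.
Proof.
by apply/rowP => j; case/mxvec_indexP: j => i j; rewrite mxE !outerE mxE mulrDl.
Qed.

Lemma outerDr (u : 'rV[k]_m.+1) (v v' : 'rV[k]_n.+1) :
  outer u (v + v') = outer u v + outer u v'.
Proof.
by apply/rowP => j; case/mxvec_indexP: j => i j; rewrite mxE !outerE mxE mulrDr.
Qed.

Lemma outerZl a (u : 'rV[k]_m.+1) (v : 'rV[k]_n.+1) : outer (a *: u) v = a *: outer u v.
Proof. by rewrite -[v in LHS]scale1r outer_scale mulr1. Qed.

Lemma outerZr a (u : 'rV[k]_m.+1) (v : 'rV[k]_n.+1) : outer u (a *: v) = a *: outer u v.
Proof. by rewrite -[u in LHS]scale1r outer_scale mul1r. Qed.

Lemma outer_eq0 (u : 'rV[k]_m.+1) (v : 'rV[k]_n.+1) :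
  u != 0 -> v != 0 -> outer u v != 0.
Proof.
move=> /rV0Pn[i ui] /rV0Pn[j vj]; apply/rV0Pn; exists (mxvec_index i j).
by rewrite outerE mulf_neq0.
Qed.

Lemma is_tangent_scale a b u v W : a != 0 -> b != 0 ->
  is_tangent u v W -> is_tangent (a *: u) (b *: v) W.
Proof.
move=> a0 b0 T w; rewrite T; split=> -[z [l ->]].
  exists (b^-1 *: z), (a^-1 *: l); rewrite !outer_scale mulfV // mulVf //.
  by rewrite !scale1r.
by exists (b *: z), (a *: l); rewrite !outerZl !outerZr.
Qed.

Lemma is_tangent_uniq u v W W' : is_tangent u v W -> is_tangent u v W' -> W = W'.
Proof.
move=> T T'; apply/vspaceP => w.
by apply/idP/idP => [/T/T'|/T'/T].
Qed.

Lemma mul_lin1 a b (f : 'rV[k]_a -> 'rV[k]_b) : linear f ->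
  forall x, x *m lin1_mx f = f x.
Proof.
move=> lf x.
have f0 : f 0 = 0 by rewrite -(addNr (0 : 'rV[k]_a)) -scaleN1r lf scaleN1r addNr.
have fsum (s : seq 'I_a) (c : 'I_a -> k) (y : 'I_a -> 'rV_a) :
    f (\sum_(i <- s) c i *: y i) = \sum_(i <- s) c i *: f (y i).
  by elim: s => [|i s IH]; rewrite ?big_nil // !big_cons lf IH.
rewrite {2}[x]row_sum_delta fsum; apply/rowP => j; rewrite mxE summxE.
by apply: eq_bigr => i _; rewrite !mxE.
Qed.

(** * The chart of the Nash blowup attached to a pair of frames *)

Section Frames.
Variables (u0 : 'rV[k]_m.+1) (la : 'cV[k]_m.+1) (K : 'M[k]_(m, m.+1)) (L : 'M[k]_(m.+1, m)).
Variables (v0 : 'rV[k]_n.+1) (mu : 'cV[k]_n.+1) (K' : 'M[k]_(n, n.+1)) (L' : 'M[k]_(n.+1, n)).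
Hypotheses (fu : frame u0 la K L) (fv : frame v0 mu K' L').
Variables (i0 : 'I_m) (j0 : 'I_n).
Implicit Types p q : 'rV[k]_D.

(** Parametrizes T(u,v) when u la = 1: in u (x) l + z (x) v the vector z may be taken in the row
    space of [K], the multiples of u being absorbed by l. This leaves (n + 1) + m parameters. *)
Definition tan_fun (u : 'rV[k]_m.+1) (v : 'rV[k]_n.+1) q : 'rV[k]_r :=
  outer u (lsubmx q) + outer (rsubmx q *m K) v.

Definition tan_mx u v : 'M[k]_(D, r) := lin1_mx (tan_fun u v).

Lemma mul_tan_mx u v q : q *m tan_mx u v = tan_fun u v q.
Proof.
apply: mul_lin1 => a x y; rewrite /tan_fun !linearP /= mulmxDl -scalemxAl.
by rewrite outerDl outerDr outerZl outerZr scalerDr addrACA.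
Qed.

(** In frame coordinates, one row of the matrix w and one column without the entry they share. Its
    kernel is the fixed complement that defines the chart of the Grassmannian. *)
Definition cross_fun (w : 'rV[k]_r) : 'rV[k]_D :=
  row_mx (la^T *m vec_mx w) ((L^T *m (vec_mx w *m mu))^T).

Definition cross_mx : 'M[k]_(r, D) := lin1_mx cross_fun.

Lemma mul_cross_mx w : w *m cross_mx = cross_fun w.
Proof.
apply: mul_lin1 => a x y; rewrite /cross_fun !linearP /= mulmxDl -scalemxAl.
by rewrite !linearP /= scale_row_mx add_row_mx.
Qed.

Lemma cross_outer u v : cross_fun (outer u v) =
  row_mx ((u *m la) 0 0 *: v) ((v *m mu) 0 0 *: (u *m L)).
Proof.
rewrite /cross_fun /outer mxvecK; congr (row_mx _ _).
  by rewrite mulmxA -trmx_mul {1}[u *m la]mx11_scalar tr_scalar_mx mul_scalar_mx.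
rewrite -mulmxA {1}[v *m mu]mx11_scalar mul_mx_scalar -scalemxAr linearZ /=.
by rewrite -trmx_mul trmxK.
Qed.

Lemma crossD w w' : cross_fun (w + w') = cross_fun w + cross_fun w'.
Proof. by rewrite -!mul_cross_mx mulmxDl. Qed.

(** The composite is unitriangular: it keeps l and adds to the other block a multiple of u L, which
    disappears when l mu = 0. *)
Lemma cross_tan u v q : u *m la = 1%:M -> v *m mu = 1%:M ->
  cross_fun (tan_fun u v q) =
  row_mx (lsubmx q) (rsubmx q + (lsubmx q *m mu) 0 0 *: (u *m L)).
Proof.
move=> ul vm; have [_ h2 _ h4 _] := fu.
rewrite /tan_fun crossD !cross_outer ul vm -!mulmxA h2 h4 mulmx0 mulmx1.
rewrite mxE eqxx add_row_mx [(0 : 'M_1) 0 0]mxE scale0r addr0 !scale1r.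
by rewrite [X in row_mx _ X]addrC.
Qed.

Lemma tan_cross_unit u v : u *m la = 1%:M -> v *m mu = 1%:M ->
  tan_mx u v *m cross_mx \in unitmx.
Proof.
move=> ul vm; rewrite -row_free_unit; apply: inj_row_free => q.
rewrite mulmxA mul_tan_mx mul_cross_mx cross_tan // => e.
have {e} : row_mx (lsubmx q) (rsubmx q + (lsubmx q *m mu) 0 0 *: (u *m L)) =
  row_mx 0 0 by rewrite e row_mx0.
case/eq_row_mx => ql; rewrite ql mul0mx [(0 : 'M_1) 0 0]mxE scale0r addr0 => qr.
by rewrite -(hsubmxK q) ql qr row_mx0.
Qed.

Lemma tan_full_subproof p : full_rank (mxvec (tan_mx (par_u u0 K p) (par_v v0 K' p))).
Proof.
rewrite /full_rank /= mxvecK.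
have := tan_cross_unit (par_u_la fu p) (par_v_mu fv p).
by rewrite -row_free_unit => /row_freeP[B HB];
  apply/row_freeP; exists (cross_mx *m B); rewrite mulmxA.
Qed.

Definition tan_full p : subspace (@full_rank k D r) :=
  @exist _ (fun z => z \in @full_rank k D r) _ (mem_set (tan_full_subproof p)).

Lemma regular_tan_full : @regular_map k A (subspace (@full_rank k D r)) tan_full.
Proof.
apply: regular_map_subspace; apply: regular_map_affine => i; apply: polynomial_regular.
case/mxvec_indexP: i => a b /=; under eq_fun do rewrite mxvecE mxE.
case/mxvec_indexP: b => i j; under eq_fun do rewrite mxE !outerE.
apply: polynomial_add; apply: polynomial_mul.
- exact: par_u_polynomial.
- exact: polynomial_cst.
- exact: polynomial_cst.
- exact: par_v_polynomial.
Qed.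

Lemma tan_full_tangent p :
  is_tangent (par_u u0 K p) (par_v v0 K' p) (gspace (grass_proj (tan_full p))).
Proof.
move=> w; rewrite /gspace /= mxvecK mem_row_space.
have [_ _ _ _ h5] := fu; have ul := par_u_la fu p.
split=> [[q ->]|[z [l ->]]].
  by rewrite mul_tan_mx; exists (rsubmx q *m K), (lsubmx q).
set u := par_u _ _ _; set v := par_v _ _ _.
(* Write z = (z la) u + z' with z' la = 0, so that z' = z' L K. *)
exists (row_mx (l + (z *m la) 0 0 *: v) ((z - (z *m la) 0 0 *: u) *m L)).
rewrite mul_tan_mx /tan_fun row_mxKl row_mxKr outerDr outerZr -addrA; congr (_ + _).
rewrite -outerZl -outerDl; congr outer.
set z' := z - _; have z'la : z' *m la = 0.
  rewrite mulmxBl -scalemxAl ul; apply/matrixP => i j.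
  by rewrite !ord1 !mxE eqxx mulr1 subrr.
have -> : z' *m L *m K = z'.
  by rewrite -[RHS]mulmx1 -h5 mulmxDr !mulmxA z'la mul0mx add0r.
by rewrite addrC subrK.
Qed.

Lemma tan_full_chart p : grass_chart cross_mx (grass_proj (tan_full p)).
Proof.
apply/grass_chart_proj; rewrite /= mxvecK.
exact: tan_cross_unit (par_u_la fu p) (par_v_mu fv p).
Qed.

(** Such q are fixed by the unitriangular composite, so the adapted basis gives [tan_fun] itself,
    with no inverse matrix and linearly in u and v. *)
Lemma tan_full_coord p q : (lsubmx q *m mu) 0 0 = 0 ->
  q *m grass_coord cross_mx (grass_proj (tan_full p)) =
  tan_fun (par_u u0 K p) (par_v v0 K' p) q.
Proof.
move=> q0; have ul := par_u_la fu p; have vm := par_v_mu fv p.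
have un := tan_cross_unit ul vm.
rewrite grass_coord_proj /= mxvecK // mulmxA -mul_tan_mx; congr (_ *m _).
rewrite -[RHS](mulmxK un) mulmxA mul_tan_mx mul_cross_mx cross_tan //.
by rewrite q0 scale0r addr0 hsubmxK.
Qed.

(** The line bundle inside X x G, with [u] and [v] encoded by their tangent space; t = 0 is its zero
    section over the origin. *)
Definition nash_set : set XG := [set y | exists u v t, [/\ u != 0, v != 0,
  val y.1 = outer (t *: u) v & is_tangent u v (gspace y.2)]].

Definition nash_point p : XG := (Xpar u0 K v0 K' p, grass_proj (tan_full p)).

Lemma regular_nash_point : @regular_map k A XG nash_point.
Proof.
apply: regular_map_pair; first exact: regular_Xpar.
exact: regular_map_comp regular_tan_full _.
Qed.

Lemma par_u_neq0 p : par_u u0 K p != 0.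
Proof.
apply/eqP => u0'; have := par_u_la fu p; rewrite u0' mul0mx => /matrixP/(_ 0 0).
by rewrite !mxE eqxx => /eqP; rewrite eq_sym oner_eq0.
Qed.

Lemma par_v_neq0 p : par_v v0 K' p != 0.
Proof.
apply/eqP => v0'; have := par_v_mu fv p; rewrite v0' mul0mx => /matrixP/(_ 0 0).
by rewrite !mxE eqxx => /eqP; rewrite eq_sym oner_eq0.
Qed.

Lemma nash_point_set p : nash_set (nash_point p).
Proof.
exists (par_u u0 K p), (par_v v0 K' p), (par_t p); split=> //.
- exact: par_u_neq0.
- exact: par_v_neq0.
- exact: tan_full_tangent.
Qed.

Definition nash_chart p : subspace nash_set :=
  @exist _ (fun z => z \in nash_set) _ (mem_set (nash_point_set p)).

Lemma regular_nash_chart : @regular_map k A (subspace nash_set) nash_chart.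
Proof. by apply: regular_map_subspace; exact: regular_nash_point. Qed.

Definition nash_base (y : subspace nash_set) : subspace X := (val y).1.
Definition nash_dir (y : subspace nash_set) : G := (val y).2.

Lemma regular_nash_base : regular_map nash_base.
Proof. exact: regular_map_comp (@regular_map_val _ _ _) (@regular_map_fst _ _ _). Qed.

Lemma regular_nash_dir : regular_map nash_dir.
Proof. exact: regular_map_comp (@regular_map_val _ _ _) (@regular_map_snd _ _ _). Qed.

Definition nash_coord y := grass_coord cross_mx (nash_dir y).

(* Over T(u,v) with u la = v mu = 1, the two elements of the adapted basis used
   here are u (x) w and z (x) v, where w is the row j0 of K' and z the row i0 of
   K; contracting them with columns of L' and L yields u and v. *)
Definition nash_u y : 'rV[k]_m.+1 :=
  (vec_mx (row_mx (row j0 K') 0 *m nash_coord y) *m col j0 L')^T.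
Definition nash_v y : 'rV[k]_n.+1 :=
  (col i0 L)^T *m vec_mx (row_mx 0 (delta_mx 0 i0) *m nash_coord y).
Definition nash_inv y : 'rV[k]_D :=
  par_mk L L' (Xt la mu (nash_base y)) (nash_u y) (nash_v y).

Lemma nash_chartK : cancel nash_chart nash_inv.
Proof.
move=> p; rewrite /nash_inv /nash_u /nash_v /nash_coord /=.
have [_ h2 _ h4 _] := fu; have [_ h2' _ h4' _] := fv.
have row_mu : row j0 K' *m mu = 0 by rewrite -row_mul h2' row0.
have e1 : row j0 K' *m col j0 L' = 1%:M.
  apply/matrixP => i j; rewrite !ord1; have /matrixP/(_ j0 j0) := h4'.
  by rewrite !mxE !eqxx => <-; apply: eq_bigr => l _; rewrite !mxE.
have e2 : row i0 K *m col i0 L = 1%:M.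
  apply/matrixP => i j; rewrite !ord1; have /matrixP/(_ i0 i0) := h4.
  by rewrite !mxE !eqxx => <-; apply: eq_bigr => l _; rewrite !mxE.
rewrite !tan_full_coord ?row_mxKl ?row_mu ?mul0mx ?[(0 : 'M_1) 0 0]mxE //.
rewrite /tan_fun !row_mxKl !row_mxKr mul0mx -rowE.
have o0 u : outer u (0 : 'rV[k]_n.+1) = 0 :> 'rV[k]_r by rewrite /outer mulmx0 linear0.
have o0' v : outer (0 : 'rV[k]_m.+1) v = 0 :> 'rV[k]_r.
  by rewrite /outer trmx0 mul0mx linear0.
rewrite o0 o0' addr0 add0r /outer !mxvecK -mulmxA e1 mulmx1 trmxK.
rewrite mulmxA -trmx_mul e2 trmx1 mul1mx /nash_base /= (Xt_par fu fv).
exact: (par_mkK fu fv).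
Qed.

(** Transversality forces u la != 0: otherwise u (x) (row j0 of K') would be a nonzero vector of
    T(u,v) with zero cross. The same argument with row i0 of K gives v mu != 0. *)
Lemma nash_chart_range y :
  grass_chart cross_mx (nash_dir y) <-> range nash_chart y.
Proof.
split=> [cy|[p _ <-]]; last exact: tan_full_chart.
have [u [v [t [u'0 v'0 xE T]]]] := set_valP y.
have [_ h2 _ h4 _] := fu; have [_ h2' _ h4' _] := fv.
have rowN0 s (M : 'M[k]_(s, s.+1)) N i : M *m N = 1%:M -> row i M != 0.
  move=> MN; apply/eqP => r0; have := row1 k i; rewrite -MN row_mul r0 mul0mx.
  by move=> /rowP/(_ i); rewrite !mxE !eqxx => /eqP; rewrite eq_sym oner_eq0.
have [M00 o00] : (0 : 'M[k]_1) 0 0 = 0 /\ outer (0 : 'rV[k]_m.+1) v = 0 :> 'rV[k]_r.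
  by rewrite mxE /outer trmx0 mul0mx linear0.
have ul : (u *m la) 0 0 != 0.
  apply/eqP => ul; case/eqP: (outer_eq0 u'0 (rowN0 _ _ _ j0 h4')); apply: cy.
    by apply/T; exists 0, (row j0 K'); rewrite o00 addr0.
  rewrite mul_cross_mx cross_outer ul scale0r -row_mul h2' row0.
  by rewrite M00 scale0r row_mx0.
have vm : (v *m mu) 0 0 != 0.
  apply/eqP => vm; case/eqP: (outer_eq0 (rowN0 _ _ _ i0 h4) v'0); apply: cy.
    by apply/T; exists (row i0 K), 0; rewrite /outer mulmx0 linear0 add0r.
  rewrite mul_cross_mx cross_outer vm scale0r -row_mul h2 row0.
  by rewrite M00 scale0r row_mx0.
have norm1 s (w : 'rV[k]_s) (c : 'cV[k]_s) :
    (w *m c) 0 0 != 0 -> ((w *m c) 0 0)^-1 *: w *m c = 1%:M.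
  move=> wc; rewrite -scalemxAl {2}[w *m c]mx11_scalar scale_scalar_mx mulVf //.
(* u and v are normalized and t absorbs the two factors, so the point of X is unchanged. *)
pose p := par_mk L L' (t * ((u *m la) 0 0 * (v *m mu) 0 0))
  (((u *m la) 0 0)^-1 *: u) (((v *m mu) 0 0)^-1 *: v).
have pu : par_u u0 K p = ((u *m la) 0 0)^-1 *: u.
  by apply: (par_u_mk _ fu); exact: norm1.
have pv : par_v v0 K' p = ((v *m mu) 0 0)^-1 *: v.
  by apply: (par_v_mk _ fv); exact: norm1.
exists p => //; apply: val_inj; apply: injective_projections; apply: val_inj.
- rewrite /= xE /par pu pv par_t_mk scalerA outer_scale outerZl; congr (_ *: _).
  by field; rewrite ul vm.
- apply: (is_tangent_uniq (tan_full_tangent p)); rewrite pu pv.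
  by apply: is_tangent_scale; rewrite ?invr_eq0.
Qed.

Lemma nash_embedding : @open_embedding k (subspace nash_set) A nash_chart nash_inv.
Proof.
have [d1 d2] := regular_nash_dir; have [b1 b2] := regular_nash_base.
pose V := nash_dir @^-1` grass_chart cross_mx.
have oV : is_open V by apply: d1; exact: grass_chart_open.
have rN i j : is_regular V (fun y => nash_coord y i j).
  exact: d2 (@grass_coord_regular _ _ _ cross_mx i j).
have rmx a b (f : subspace nash_set -> 'rV[k]_(a * b)) :
    (forall i j, is_regular V (fun y => f y i j)) ->
    forall i j, is_regular V (fun y => vec_mx (f y) i j).
  by move=> rf i j; apply: (regular_ext _ (rf 0 (mxvec_index i j))) => y _; rewrite [RHS]mxE.
apply: (@open_embeddingI _ _ _ _ _ V) => //.
- exact: regular_nash_chart.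
- exact: nash_chartK.
- exact: tan_full_chart.
- by move=> y /nash_chart_range[p _ <-]; rewrite nash_chartK.
- apply: par_mk_regular => [|i|i].
  + have := b2 _ _ (@Xt_regular _ _ _ la mu); exact: regular_restrict.
  + apply: (regular_ext (f := fun y =>
        (vec_mx (row_mx (row j0 K') 0 *m nash_coord y) *m col j0 L') i 0)).
      by move=> y _; rewrite [RHS]mxE.
    apply: regular_mulmx => // *; last exact: regular_cst.
    by apply: rmx => *; apply: regular_mulmx => // *; exact: regular_cst.
  + apply: regular_mulmx => // *; first exact: regular_cst.
    by apply: rmx => *; apply: regular_mulmx => // *; exact: regular_cst.
Qed.

End Frames.

Hypotheses (m_gt0 : (0 < m)%N) (n_gt0 : (0 < n)%N).

(** The matrices have sizes m + 1 and n + 1, so sizes at least two provide the rows of [K] and [K']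
    used to read off u and v. *)
Let i0 : 'I_m := Ordinal m_gt0.
Let j0 : 'I_n := Ordinal n_gt0.

Lemma nash_set_point (y : XG) : nash_set y ->
  exists u0 la K L v0 mu K' L' (fu : frame u0 la K L) (fv : frame v0 mu K' L') p,
    nash_point fu fv p = y.
Proof.
move=> [u [v [t [u0 v0 xE T]]]].
have [la [K [L fu]]] := frame_exists u0; have [mu [K' [L' fv]]] := frame_exists v0.
exists u, la, K, L, v, mu, K', L', fu, fv, (par_mk L L' t u v).
have [ul _ _ _ _] := fu; have [vm _ _ _ _] := fv.
have pu := par_u_mk L' fu t v ul; have pv := par_v_mk L fv t u vm.
apply: injective_projections; apply: val_inj; first by rewrite /= (par_mkE fu fv).
by apply: (is_tangent_uniq (tan_full_tangent fu fv _)); rewrite pu pv.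
Qed.

Lemma nash_set_chart (y : subspace nash_set) :
  exists (j : A -> subspace nash_set) s, open_embedding j s /\ range j y.
Proof.
have [u0 [la [K [L [v0 [mu [K' [L' [fu [fv [p py]]]]]]]]]]] := nash_set_point (set_valP y).
exists (nash_chart fu fv), (nash_inv la L mu K' L' i0 j0); split.
  exact: nash_embedding.
by exists p => //; apply: val_inj.
Qed.

Lemma closed_forall (S : fspace k) I (C : I -> set S) :
  (forall i, is_closed (C i)) -> is_closed [set x | forall i, C i x].
Proof.
move=> cC; apply: open_local => x /existsNP[i nCx]; exists (~` C i).
by split=> [||z nCz Cz]; [exact: cC | exact: nCx | exact: nCz].
Qed.

Lemma outer_sumr (u : 'rV[k]_m.+1) (l : 'rV[k]_n.+1) :
  outer u l = \sum_b l 0 b *: outer u (delta_mx 0 b).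
Proof.
apply/rowP => j; case/mxvec_indexP: j => i j; rewrite summxE outerE (bigD1 j) //=.
rewrite mxE outerE mxE !eqxx mulr1 mulrC big1 ?addr0 // => b bj.
by rewrite mxE outerE mxE eq_sym (negPf bj) andbF !mulr0.
Qed.

Lemma outer_suml (z : 'rV[k]_m.+1) (v : 'rV[k]_n.+1) :
  outer z v = \sum_a z 0 a *: outer (delta_mx 0 a) v.
Proof.
apply/rowP => j; case/mxvec_indexP: j => i j; rewrite summxE outerE (bigD1 i) //=.
rewrite mxE outerE mxE !eqxx mul1r big1 ?addr0 // => b bj.
by rewrite mxE outerE mxE eq_sym (negPf bj) andbF mul0r mulr0.
Qed.

(* The conditions: some u (x) k^n and some k^m (x) v lie in W, as do (column of
   x) (x) k^n and k^m (x) (row of x). *)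
Lemma closed_nash_set : is_closed nash_set.
Proof.
have rd : regular_map (snd : XG -> G) := @regular_map_snd _ _ _.
have [_ rb] : regular_map (fst : XG -> subspace X) := @regular_map_fst _ _ _.
have rM i j : is_regular setT (fun y : XG => Xmat y.1 i j).
  exact: rb (@regular_Xmat _ _ _ i j).
pose C1 := [set y : XG | exists2 u : 'rV[k]_m.+1, u != 0 &
  forall b : 'I_n.+1, \sum_i u 0 i *: outer (delta_mx 0 i) (delta_mx 0 b) \in gspace y.2].
pose C2 := [set y : XG | exists2 v : 'rV[k]_n.+1, v != 0 &
  forall a : 'I_m.+1, \sum_j v 0 j *: outer (delta_mx 0 a) (delta_mx 0 j) \in gspace y.2].
pose C3 := [set y : XG | forall (bb : 'I_n.+1 * 'I_n.+1),
  outer (col bb.1 (Xmat y.1))^T (delta_mx 0 bb.2) \in gspace y.2].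
pose C4 := [set y : XG | forall (aa : 'I_m.+1 * 'I_m.+1),
  outer (delta_mx 0 aa.2) (row aa.1 (Xmat y.1)) \in gspace y.2].
suff -> : nash_set = (C1 `&` C2) `&` (C3 `&` C4).
  apply: closed_setI; apply: closed_setI.
  - exact: closed_degenerate.
  - exact: (closed_degenerate rd (fun j a => outer (delta_mx 0 a) (delta_mx 0 j))).
  - apply: closed_forall => -[b' b]; apply: closed_mem => // j.
    case/mxvec_indexP: j => i j; apply: (regular_ext (f := fun y : XG =>
      Xmat y.1 i b' * (delta_mx 0 b : 'rV_n.+1) 0 j)) => [y _|].
      by rewrite outerE [X in _ = X * _]mxE [X in _ = X * _]mxE.
    by apply: regular_mul => //; apply: regular_cst; exact: open_setT.
  - apply: closed_forall => -[a' a]; apply: closed_mem => // j.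
    case/mxvec_indexP: j => i j; apply: (regular_ext (f := fun y : XG =>
      (delta_mx 0 a : 'rV_m.+1) 0 i * Xmat y.1 a' j)) => [y _|].
      by rewrite outerE [X in _ = _ * X]mxE.
    by apply: regular_mul => //; apply: regular_cst; exact: open_setT.
apply/seteqP; split=> y.
  move=> [u [v [t [u0 v0 xE T]]]].
  have Tl l : outer u l \in gspace y.2.
    by apply/T; exists 0, l; rewrite /outer trmx0 mul0mx linear0 addr0.
  have Tr z : outer z v \in gspace y.2.
    by apply/T; exists z, 0; rewrite /outer mulmx0 linear0 add0r.
  have ME : Xmat y.1 = (t *: u)^T *m v by rewrite /Xmat xE /outer mxvecK.
  split; split.
  - by exists u => // b; rewrite -outer_suml.
  - by exists v => // a; rewrite -outer_sumr.
  - move=> [b' b] /=; suff -> : (col b' (Xmat y.1))^T = (t * v 0 b') *: u.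
      by rewrite outerZl memvZ.
    by apply/rowP => i; rewrite ME !mxE big_ord1 !mxE; ring.
  - move=> [a' a] /=; suff -> : row a' (Xmat y.1) = (t * u 0 a') *: v.
      by rewrite outerZr memvZ.
    by apply/rowP => i; rewrite ME !mxE big_ord1 !mxE; ring.
move=> [[[u u0 Hu] [v v0 Hv]] [H3 H4]].
have Tl l : outer u l \in gspace y.2.
  by rewrite outer_sumr; apply: memv_suml => b _; apply: memvZ; rewrite outer_suml.
have Tr z : outer z v \in gspace y.2.
  by rewrite outer_suml; apply: memv_suml => a _; apply: memvZ; rewrite outer_sumr.
have [la [K [L fu]]] := frame_exists u0; have [mu [K' [L' fv]]] := frame_exists v0.
have [ul h2 uL h4 sumL] := fu; have [vm h2' vL h4' sumL'] := fv.
have T : is_tangent u v (gspace y.2).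
  pose p := par_mk L L' 0 u v.
  have := tan_full_tangent fu fv p.
  (* C1 and C2 give that T(u,v) is contained in W; the two have the same dimension. *)
  rewrite (par_u_mk L' fu 0 v ul) (par_v_mk L fv 0 u vm).
  set W := gspace _ => TW; suff <- : W = gspace y.2 by [].
  apply/eqP; rewrite eqEdim; apply/andP; split; last first.
    by rewrite (set_valP (grass_proj (tan_full fu fv p))) (set_valP y.2).
  by apply/subvP => w /TW[z [l ->]]; apply: rpredD.
have /determinantal_rank1[u' [v' xE]] := set_valP y.1.
have [x0|x0] := eqVneq (outer u' v') 0.
  by exists u, v, 0; split=> //; rewrite xE x0 outerZl scale0r.
have ME : Xmat y.1 = u'^T *m v' by rewrite /Xmat xE /outer mxvecK.
have [u'0 v'0] : u' != 0 /\ v' != 0.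
  by split; apply: contra_neq x0 => ->; rewrite /outer ?trmx0 ?mul0mx ?mulmx0 linear0.
(* C3 puts u' (x) k^n inside T(u,v). Multiplying by L^T and L' kills T(u,v), and on u' (x) (row j0
   of K') it leaves u' L in column j0; hence u' L = 0. *)
have u'E : u' = (u' *m la) 0 0 *: u.
  have [b' vb'] := rV0Pn _ v'0.
  have T' l : outer u' l \in gspace y.2.
    rewrite outer_sumr; apply: memv_suml => b _; apply: memvZ.
    have := H3 (b', b); rewrite /= ME.
    have -> : (col b' (u'^T *m v'))^T = v' 0 b' *: u'.
      by apply/rowP => i; rewrite !mxE big_ord1 !mxE mulrC.
    by rewrite outerZl => /(memvZ (v' 0 b')^-1); rewrite scalerA mulVf // scale1r.
  have [z [l e]] := (T _).1 (T' (row j0 K')).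
  have {e} : u'^T *m row j0 K' = u^T *m l + z^T *m v.
    by apply: (can_inj mxvecK); rewrite linearD.
  move=> /(congr1 (fun M => L^T *m M *m L')).
  rewrite mulmxDr mulmxDl !mulmxA -!trmx_mul uL trmx0 !mul0mx add0r.
  rewrite -!mulmxA vL !mulmx0 -row_mul h4' => /matrixP e.
  have u'L : u' *m L = 0.
    apply/rowP => i; have := e i j0; rewrite !mxE big_ord1 !mxE eqxx mulr1.
    done.
  by rewrite -[LHS]mulmx1 -sumL mulmxDr !mulmxA u'L mul0mx addr0
    {1}[u' *m la]mx11_scalar mul_scalar_mx.
have v'E : v' = (v' *m mu) 0 0 *: v.
  have [a' ua'] := rV0Pn _ u'0.
  have T' z : outer z v' \in gspace y.2.
    rewrite outer_suml; apply: memv_suml => a _; apply: memvZ.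
    have := H4 (a', a); rewrite /= ME.
    have -> : row a' (u'^T *m v') = u' 0 a' *: v'.
      by apply/rowP => i; rewrite !mxE big_ord1 !mxE.
    by rewrite outerZr => /(memvZ (u' 0 a')^-1); rewrite scalerA mulVf // scale1r.
  have [z [l e]] := (T _).1 (T' (row i0 K)).
  have {e} : (row i0 K)^T *m v' = u^T *m l + z^T *m v.
    by apply: (can_inj mxvecK); rewrite linearD.
  move=> /(congr1 (fun M => L^T *m M *m L')).
  rewrite mulmxDr mulmxDl !mulmxA -!trmx_mul uL trmx0 !mul0mx add0r.
  rewrite -!mulmxA vL !mulmx0 -row_mul h4 => /matrixP e.
  have v'L : v' *m L' = 0.
    apply/rowP => j; have := e i0 j; rewrite !mxE big_ord1 !mxE eqxx mul1r.
    done.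
  by rewrite -[LHS]mulmx1 -sumL' mulmxDr !mulmxA v'L mul0mx addr0
    {1}[v' *m mu]mx11_scalar mul_scalar_mx.
exists u, v, ((u' *m la) 0 0 * (v' *m mu) 0 0); split=> //.
by rewrite xE {1}u'E {1}v'E outer_scale outerZl.
Qed.

Let gauss : set XG := [set y : XG | nonsingular_at y.1 /\
  is_tangent_space X (val (y.1 : subspace X)) (gspace y.2)].

(** Away from 0 the tangent space is known. The origin is excluded by dimension: lines through 0
    make every rank-one matrix tangent there, so W would be everything, whereas (m + 1)(n + 1) > n +
    1 + m. *)
Lemma gauss_sub_nash_set : gauss `<=` nash_set.
Proof.
move=> y [_ T]; have /determinantal_rank1[u [v xE]] := set_valP y.1.
have [x0|x0] := eqVneq (outer u v) 0; last first.
  have [u0 v0] : u != 0 /\ v != 0.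
    by split; apply: contra_neq x0 => ->; rewrite /outer ?trmx0 ?mul0mx ?mulmx0 linear0.
  exists u, v, 1; split=> //; first by rewrite scale1r.
  by move=> w; rewrite (T w) xE; exact: tangent_determinantal.
have rank1 z l : outer z l \in gspace y.2.
  apply/(T _) => p Xp; rewrite xE x0.
  (* The line s |-> s (z (x) l) lies in X and has velocity z (x) l at 0. *)
  have [h hE] := meval_curve p (fun j => outer z l 0 j *: 'X).
  have h0 : h = 0.
    apply: contrapT => /eqP/closed_nonrootP[s]; rewrite rootE -(hE s).1.
    move=> /negP; apply; apply/eqP.
    have Xs : X (outer (s *: z) l) by apply/determinantal_rank1; eexists; eexists.
    rewrite -[RHS](Xp _ Xs); apply: meval_eq => j.
    by rewrite hornerZ hornerX outerZl mxE mulrC.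
  have [_] := hE 0; rewrite h0 deriv0 horner0 => e; rewrite [RHS]e.
  apply: eq_bigr => i _; rewrite derivZ derivX hornerZ hornerC mulr1.
  by congr (_ * _); apply: meval_eq => j; rewrite hornerZ hornerX mulr0 mxE.
have Wfull : gspace y.2 = fullv.
  apply/vspaceP => w; rewrite memvf.
  have -> : w = \sum_a outer (delta_mx 0 a) (row a (vec_mx w)).
    apply/rowP => j; case/mxvec_indexP: j => c d; rewrite summxE (bigD1 c) //=.
    rewrite outerE !mxE !eqxx mul1r big1 ?addr0 // => a ac.
    by rewrite outerE mxE eq_sym (negPf ac) andbF mul0r.
  exact: memv_suml.
have : \dim (gspace y.2) = D := set_valP y.2.
rewrite Wfull dimvf dim_matrix mul1r => e; exfalso; move: e m_gt0 n_gt0.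
by clear; nia.
Qed.

(** Each point lies in a chart, where the part t != 0 is dense and maps into the Gauss graph. *)
Lemma nash_set_closure : zariski_closure gauss = nash_set.
Proof.
apply/seteqP; split.
  exact: closure_min closed_nash_set gauss_sub_nash_set.
move=> y /nash_set_point[u0 [la [K [L [v0 [mu [K' [L' [fu [fv [p <-]]]]]]]]]]].
apply/closureP => U oU Up.
have [r1 _] := regular_nash_point fu fv.
have oT : is_open [set q : A | setT q /\ par_t q != 0].
  exact: open_regular_neq0 (polynomial_regular (@par_t_polynomial k m n)).
have [||q [Uq [_ tq]]] := affine_meet (r1 _ oU) oT.
- by exists p.
- by exists (par_mk L L' 1 0 0); split=> //; rewrite par_t_mk oner_neq0.
exists (nash_point fu fv q) => //.
have u'0 := par_u_neq0 fu q; have v'0 := par_v_neq0 fv q.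
have tu0 : par_t q *: par_u u0 K q != 0 by rewrite scaler_eq0 negb_or tq.
split; first by apply: determinantal_nonsingular; exact: (outer_eq0 tu0 v'0).
move=> w; rewrite (tangent_determinantal _ tu0 v'0) -[par_v _ _ _]scale1r.
by rewrite (is_tangent_scale tq (oner_neq0 k) (tan_full_tangent fu fv q) w) scale1r.
Qed.

Lemma affine_affine_space r : affine (affine_space k r).
Proof.
exists r, set0; have -> : zero_locus set0 = range (id : affine_space k r -> affine_space k r).
  by apply/seteqP; split=> [x _|x _ p []]; exists x.
apply: (@open_embedding_isomorphic k (affine_space k r) _ id id); split=> //.
- by move=> U oU; rewrite image_id.
- by move=> U f; rewrite image_id.
Qed.

(** For the existence half: a space covered by affine spaces is normal and is its own
    normalization. *)
Lemma charts_normalization_id (Y : fspace k) d :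
  (forall y, exists (c : affine_space k d -> Y) r, open_embedding c r /\ range c y) ->
  normalization (@id Y).
Proof.
move=> chart; have affc (c : affine_space k d -> Y) r :
    open_embedding c r -> affine (subspace (range c)).
  move=> emb; have [s [P iP]] := affine_affine_space d; exists s, P.
  exact: isomorphic_trans (isomorphic_sym (open_embedding_isomorphic emb)) iP.
split.
- move=> y; have [c [r [emb cy]]] := chart y; exists (range c); split=> //.
    exact: open_embedding_range emb.
  exact: affc emb.
- move=> y; have [c [r [emb [p _ <-]]]] := chart y.
  exact: (normal_at_transfer emb (@affine_normal_at _ _ p)).
- split=> // y; have [c [r [emb cy]]] := chart y; exists (range c); split=> //.
  + exact: open_embedding_range emb.
  + exact: affc emb.
  + exact: affc emb.
  exists 1%N, (fun=> fun=> 1); split=> [_|f rf].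
    by apply: regular_cst; exact: open_embedding_range emb.
  exists (fun=> f); split=> // x _; by rewrite big_ord1 mulr1.
- split=> //; exists setT; split.
  + exact: open_setT.
  + by apply/is_denseP => U _ [x Ux]; exists x.
  + by apply/is_denseP => U _ [x Ux]; exists x.
  exists val; split=> //; first exact: regular_map_val.
  apply/seteqP; split=> // y _.
  by exists (@exist _ (fun z => z \in setT) y (mem_set I)).
Qed.

End NashCharts.

Theorem corollary2p25 (k : closedFieldType) (p : nat) (m n : nat)
  (char_k : p \in [pchar k]) (hm : (2 <= m)%N) (hn : (2 <= n)%N) :
  (exists (N : fspace k) (nu : N -> nash_blowup (@determinantal_variety k m n 2)),
     normalized_nash_blowup nu) /\
  (forall (N : fspace k) (nu : N -> nash_blowup (@determinantal_variety k m n 2)),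
     normalized_nash_blowup nu -> nonsingular N).
Proof.
(* From here m and n are the sizes minus one, and the bounds become m > 0 and n > 0. *)
case: m hm => [//|m] m_gt0; case: n hn => [//|n] n_gt0 {p char_k}.
set X := @determinantal_variety k m.+1 n.+1 2.
suff chart (y : nash_blowup X) : exists (c : affine_space k (n.+1 + m) -> nash_blowup X) r,
    open_embedding c r /\ range c y.
  split=> [|N nu [_ _ fin bir]].
    exists (nash_blowup X), id; exact: charts_normalization_id chart.
  exact: finite_birational_nonsingular fin bir chart.
(* The type of y depends on [dimension (subspace X)], so y is generalized before this number is
   replaced by its value. *)
move: y; rewrite /nash_blowup /gauss_graph /nash_ambient.
rewrite (dimensionE (determinantal_dim k m n)).
have := @nash_set_closure k m n m_gt0 n_gt0.
rewrite /gspace => -> y; exact: nash_set_chart.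
Qed.
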